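(* Let $n\geq 3$ and let $M$ be a horosphere, a hypersphere or a hyperplane in the hyperbolic space $\mathbb{H}^n$. Let $H_M\geq 0$ denote the (constant) mean curvature of $M$, computed with respect to a global unit normal of $M$ chosen so that it is non-negative. Let $\Sigma$ be a connected properly embedded $\mathcal{C}^2$-hypersurface in $\mathbb{H}^n$ which coincides with $M$ outside a compact subset of $\mathbb{H}^n$, i.e. there is a compact set $K\subset\mathbb{H}^n$ with $\Sigma\setminus K=M\setminus K$. If, with respect to some global unit normal field $\nu$ on $\Sigma$, the mean curvature $H_\Sigma$ of $\Sigma$ satisfies $H_\Sigma\geq H_M$ at every point of $\Sigma$, then $\Sigma=M$.
   Context: $\mathbb{H}^n$ is the $n$-dimensional hyperbolic space of constant sectional curvature $-1$; in the halfspace model, $\mathbb{H}^n=\{(x_1,\ldots,x_n)\in\mathbb{R}^n : x_n>0\}$ with the metric $ds^2=\frac{dx_1^2+\cdots+dx_n^2}{x_n^2}$. A hyperplane in $\mathbb{H}^n$ is a complete totally geodesic hypersurface. A hypersphere in $\mathbb{H}^n$ is a connected component of a set of points equidistant (at a fixed positive distance) from a hyperplane. Horospheres have their usual meaning (up to isometry, $\{x_n=1\}$ in the halfspace model). Hypersurfaces are without boundary. For an embedded $\mathcal{C}^2$-hypersurface $\Sigma$ with global unit normal $\nu$ in an $n$-dimensional Riemannian manifold, with Levi-Civita connection $\nabla$, the shape operator at $p\in\Sigma$ is $S_p u=-\nabla_u\nu$ for $u\in T_p\Sigma$, and the (normalized) mean curvature with respect to $\nu$ is $H=\frac{1}{n-1}\operatorname{trace}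 S$. It changes sign when $\nu$ is replaced by $-\nu$. With this convention, the unit sphere in Euclidean space has mean curvature $1$ with respect to its interior unit normal. *)

(* Defs.v *)
From HB Require Import structures.
From mathcomp Require Import all_boot all_order all_algebra.
From mathcomp Require Import all_classical all_reals all_analysis.
Set Implicit Arguments.
Unset Strict Implicit.
Unset Printing Implicit Defensive.
Import Order.TTheory GRing.Theory Num.Theory.
Import numFieldNormedType.Exports.
Local Open Scope classical_set_scope.
Local Open Scope ring_scope.

(* The halfspace model has dimension m.+1, and its points and tangent vectors
   are row vectors in 'rV[R]_m.+1. Maps are total; only their values on the
   relevant (open) set matter. *)

(* C^k on an open set U, through iterated directional derivatives. *)
Fixpoint Ck (R : realType) (V W : normedModType R) (k : nat) (U : set V)
    (f : V -> W) : Prop :=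
  if k is k'.+1 then
    (forall x v, U x -> derivable f x v) /\
    (forall v, Ck k' U (fun x => 'D_v f x))
  else forall x, U x -> {for x, continuous f}.

Definition smooth (R : realType) (V W : normedModType R) (U : set V)
    (f : V -> W) : Prop := forall k, Ck k U f.

Definition height (R : realType) (m : nat) (x : 'rV[R]_m.+1) : R :=
  x 0 ord_max.

Definition halfspace (R : realType) (m : nat) : set 'rV[R]_m.+1 :=
  [set x | 0 < height x].

Definition hmetric (R : realType) (m : nat) (x u v : 'rV[R]_m.+1) : R :=
  (\sum_i u 0 i * v 0 i) / height x ^+ 2.

Definition basis_vec (R : realType) (m : nat) (i : 'I_m.+1) : 'rV[R]_m.+1 :=
  delta_mx 0 i.

Definition gram (R : realType) (m : nat) (x : 'rV[R]_m.+1) : 'M[R]_m.+1 :=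
  \matrix_(i, j) hmetric x (basis_vec R i) (basis_vec R j).

(* Gamma^k_{ij}, the coefficients of the Levi-Civita connection. *)
Definition christoffel (R : realType) (m : nat) (x : 'rV[R]_m.+1)
    (k i j : 'I_m.+1) : R :=
  2^-1 * \sum_l invmx (gram x) k l *
    ('D_(basis_vec R i) (fun y => gram y j l) x
     + 'D_(basis_vec R j) (fun y => gram y i l) x
     - 'D_(basis_vec R l) (fun y => gram y i j) x).

Definition connection_form (R : realType) (m : nat) (x u v : 'rV[R]_m.+1) :
    'rV[R]_m.+1 :=
  \row_k \sum_i \sum_j christoffel x k i j * u 0 i * v 0 j.

(* Embedded C^2 hypersurface without boundary: locally a regular level set. *)
Definition C2_hypersurface (R : realType) (m : nat) (S : set 'rV[R]_m.+1) :
    Prop :=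
  S `<=` @halfspace R m /\
  forall p, S p -> exists (U : set 'rV[R]_m.+1) (f : 'rV[R]_m.+1 -> R),
    [/\ open U, U p, Ck 2 U f,
        (forall x, U x -> exists v, 'D_v f x != 0) &
        S `&` U = [set x | U x /\ f x = 0]].

Definition properly_embedded (R : realType) (m : nat)
    (S : set 'rV[R]_m.+1) : Prop :=
  forall K, K `<=` @halfspace R m -> compact K -> compact (S `&` K).

Definition curve_in (R : realType) (m : nat) (S : set 'rV[R]_m.+1)
    (p u : 'rV[R]_m.+1) (c : R -> 'rV[R]_m.+1) : Prop :=
  [/\ c 0 = p, (\forall t \near (0 : R), S (c t)) &
      is_derive (0 : R) (1 : R) c u].

Definition tangent (R : realType) (m : nat) (S : set 'rV[R]_m.+1)
    (p : 'rV[R]_m.+1) : set 'rV[R]_m.+1 :=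
  [set u | exists c, curve_in S p u c].

(* Continuity is enough: on a C^2 hypersurface, a continuous unit normal field
   is automatically C^1. *)
Definition unit_normal (R : realType) (m : nat) (S : set 'rV[R]_m.+1)
    (nu : 'rV[R]_m.+1 -> 'rV[R]_m.+1) : Prop :=
  {within S, continuous nu} /\
  forall p, S p -> hmetric p (nu p) (nu p) = 1 /\
    forall u, tangent S p u -> hmetric p (nu p) u = 0.

(* S_p u = w, i.e. w = - nabla_u nu, where nabla_u nu is computed as the
   covariant derivative of nu along a curve of S with velocity u at p. When S is
   a C^2 hypersurface and nu a unit normal, w exists and is unique for each
   tangent vector u. *)
Definition is_shape (R : realType) (m : nat) (S : set 'rV[R]_m.+1)
    (nu : 'rV[R]_m.+1 -> 'rV[R]_m.+1) (p u w : 'rV[R]_m.+1) : Prop :=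
  exists c dnu, [/\ curve_in S p u c,
    is_derive (0 : R) (1 : R) (nu \o c) dnu &
    w = - (dnu + connection_form p u (nu p))].

(* The rows of B form a basis of the tangent space, in which A is the matrix of
   the shape operator; the hypersurface has dimension m. *)
Definition is_mean_curvature (R : realType) (m : nat) (S : set 'rV[R]_m.+1)
    (nu : 'rV[R]_m.+1 -> 'rV[R]_m.+1) (p : 'rV[R]_m.+1) (h : R) : Prop :=
  exists (B : 'M[R]_(m, m.+1)) (A : 'M[R]_m),
    [/\ row_free B,
        (forall u, tangent S p u <-> (u <= B)%MS),
        (forall i, is_shape S nu p (row i B) (row i (A *m B))) &
        h = \tr A / m%:R].

Definition curve_length (R : realType) (m : nat) (c : R -> 'rV[R]_m.+1) :
    \bar R :=
  \int[lebesgue_measure]_(t in `[(0 : R), 1])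
    (Num.sqrt (hmetric (c t) (derive1 c t) (derive1 c t)))%:E.

(* Riemannian distance of H^{m.+1} if S is the halfspace, and intrinsic
   distance of S if S is a hypersurface. *)
Definition rdist (R : realType) (m : nat) (S : set 'rV[R]_m.+1)
    (x y : 'rV[R]_m.+1) : \bar R :=
  ereal_inf [set curve_length c | c in
    [set c : R -> 'rV[R]_m.+1 |
      [/\ Ck 1 [set: R] c, c 0 = x, c 1 = y & forall t, 0 <= t <= 1 -> S (c t)]]].

Definition complete_hypersurface (R : realType) (m : nat)
    (S : set 'rV[R]_m.+1) : Prop :=
  forall s : nat -> 'rV[R]_m.+1, (forall i, S (s i)) ->
    (forall e : R, 0 < e -> exists N : nat, forall i j : nat,
      (N <= i)%N -> (N <= j)%N -> (rdist S (s i) (s j) < e%:E)%E) ->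
    exists2 p, S p & forall e : R, 0 < e -> exists N : nat, forall i : nat,
      (N <= i)%N -> (rdist S (s i) p < e%:E)%E.

(* Vanishing second fundamental form; unit normals need only exist locally. *)
Definition totally_geodesic (R : realType) (m : nat)
    (S : set 'rV[R]_m.+1) : Prop :=
  forall U nu, open U -> unit_normal (S `&` U) nu ->
    forall p u w, is_shape (S `&` U) nu p u w -> w = 0.

(* Nonemptiness and connectedness are explicit: the empty set and finite
   disjoint unions of hyperplanes satisfy the other three conditions. *)
Definition hyperplane (R : realType) (m : nat) (M : set 'rV[R]_m.+1) : Prop :=
  [/\ M !=set0, connected M, C2_hypersurface M,
      complete_hypersurface M & totally_geodesic M].

Definition equidistant_set (R : realType) (m : nat) (P : set 'rV[R]_m.+1)
    (r : R) : set 'rV[R]_m.+1 :=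
  [set x | @halfspace R m x /\
    ereal_inf [set rdist (@halfspace R m) x y | y in P] = r%:E].

Definition hypersphere (R : realType) (m : nat) (M : set 'rV[R]_m.+1) : Prop :=
  exists P r x, [/\ hyperplane P, 0 < r, equidistant_set P r x &
    M = connected_component (equidistant_set P r) x].

Definition isometry (R : realType) (m : nat)
    (phi : 'rV[R]_m.+1 -> 'rV[R]_m.+1) : Prop :=
  let H := @halfspace R m in
  [/\ smooth H phi, phi @` H `<=` H,
      (exists psi : 'rV[R]_m.+1 -> 'rV[R]_m.+1,
        [/\ smooth H psi, psi @` H `<=` H,
            (forall x, H x -> psi (phi x) = x) &
            (forall x, H x -> phi (psi x) = x)]) &
      forall x u v, H x ->
        hmetric (phi x) ('D_u phi x) ('D_v phi x) = hmetric x u v].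

Definition horosphere (R : realType) (m : nat) (M : set 'rV[R]_m.+1) : Prop :=
  exists2 phi, isometry phi & M = phi @` [set x : 'rV[R]_m.+1 | height x = 1].

(* Main.v *)
Require Import Defs.
From HB Require Import structures.
From mathcomp Require Import all_boot all_order all_algebra.
From mathcomp Require Import all_classical all_reals all_analysis.
From mathcomp Require Import ring lra.
Import Order.TTheory GRing.Theory Num.Theory.
Import numFieldNormedType.Exports.
Local Open Scope classical_set_scope.
Local Open Scope ring_scope.

Set Implicit Arguments.
Unset Strict Implicit.
Unset Printing Implicit Defensive.

(** The hypersurfaces [M] of the theorem are the traces on the halfspace of the
    Euclidean spheres and hyperplanes [q = 0], where
    [q x = al |x|^2 + b.x + ga] ([quad]), with [height b <= 0],
    [D = |b|^2 - 4 al ga > 0] and [disc = D - (height b)^2 >= 0]; hyperplanes have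
    [height b = 0], hyperspheres [disc > 0] and horospheres [disc = 0]. The mean
    curvature of [q = 0] is [- height b / sqrt D], and the hypersurfaces
    [q = d x_n], for varying [d], are equidistant from [M].

    Suppose that [q] takes a negative value on [Sigma]. As [Sigma] coincides with
    [M] outside a compact set, [q / x_n] has a minimum [d < 0] on [Sigma], reached
    at some point [p], and [Sigma] lies on one side of the hypersurface
    [q = d x_n], which it touches at [p] and whose mean curvature is at most that of
    [M], hence at most that of [Sigma]. If the normal of [Sigma] at [p] points
    towards the side where [Sigma] is not, the strong maximum principle
    ([strong_touching]) makes [Sigma] a part of [q = d x_n], which is absurd outside
    the compact set. So [q >= 0] on [Sigma]; now [Sigma] touches [M] at the points
    outside the compact set, and the same principle gives [Sigma] included in [M],
    then [Sigma = M] by connectedness ([quadric_rigidity]).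

    The strong maximum principle rests on one inequality ([touching]): where a
    function restricted to a hypersurface is minimal, the trace of its Hessian on
    the tangent hyperplane is bounded below in terms of the mean curvature. It is
    applied to [q] minus a small multiple of Hopf's barrier, which is written as a
    polynomial in the ambient coordinates, so that no local graph is needed.

    The direction of the normal at [p] is where the topology enters. At a point
    [q0] of [M] outside the compact set it is known, because the mean curvature of
    [M] is nonnegative. A properly embedded hypersurface of the halfspace separates
    it locally into two sides which fit together globally ([side_function]), so the
    direction of the normal is transported from [q0] to [p] by any path which
    avoids [Sigma] ([orientation_transport]). Since [q / x_n >= d] on [Sigma], and
    [Sigma = M] outside the compact set, there is such a path if [q0] is chosen
    close to the boundary at infinity ([escapes_low]), or far away on a horizontal
    horosphere ([escapes_horizontal]).

    It remains to show that [M] is a quadric. The tangent hyperbolic hyperplane of a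
    totally geodesic hypersurface is locally constant, and completeness fills it
    ([hyperplane_quadric]). The function [asinh (q / x_n)], for [height b = 0] and
    [D = 1], is 1-Lipschitz for the hyperbolic distance ([rdist_ge]), and grows with
    speed 1 along geodesics orthogonal to [q = 0]; this gives the distance to a
    hyperplane, whence the hyperspheres ([hypersphere_quadric]), and the distance
    between two points, which isometries preserve, whence the horospheres
    ([horosphere_quadric]). *)

(** * Euclidean geometry of row vectors *)

Definition dot {R : realType} {m : nat} (u v : 'rV[R]_m.+1) : R :=
  \sum_i u 0 i * v 0 i.

Section Dot.
Context {R : realType} {m : nat}.
Implicit Types u v w x y : 'rV[R]_m.+1.

Lemma dotC u v : dot u v = dot v u.
Proof. by apply: eq_bigr => i _; rewrite mulrC. Qed.

Lemma dotDl u v w : dot (u + v) w = dot u w + dot v w.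
Proof.
by rewrite /dot -big_split; apply: eq_bigr => i _; rewrite mxE mulrDl.
Qed.

Lemma dotZl a u v : dot (a *: u) v = a * dot u v.
Proof. by rewrite /dot mulr_sumr; apply: eq_bigr => i _; rewrite mxE mulrA. Qed.

Lemma dotNl u v : dot (- u) v = - dot u v.
Proof. by rewrite -scaleN1r dotZl mulN1r. Qed.

Lemma dotBl u v w : dot (u - v) w = dot u w - dot v w.
Proof. by rewrite dotDl dotNl. Qed.

Lemma dotDr u v w : dot w (u + v) = dot w u + dot w v.
Proof. by rewrite dotC dotDl !(dotC _ w). Qed.

Lemma dotZr a u v : dot u (a *: v) = a * dot u v.
Proof. by rewrite dotC dotZl dotC. Qed.

Lemma dotNr u v : dot u (- v) = - dot u v.
Proof. by rewrite dotC dotNl dotC. Qed.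

Lemma dotBr u v w : dot w (u - v) = dot w u - dot w v.
Proof. by rewrite dotDr dotNr. Qed.

Lemma dot0l u : dot 0 u = 0.
Proof. by rewrite -(scale0r u) dotZl mul0r. Qed.

Lemma dot0r u : dot u 0 = 0.
Proof. by rewrite dotC dot0l. Qed.

Definition dotE := (dotDl, dotDr, dotBl, dotBr, dotZl, dotZr, dotNl, dotNr).

Lemma dot_ge0 u : 0 <= dot u u.
Proof. by apply: sumr_ge0 => i _; rewrite -expr2 sqr_ge0. Qed.

Lemma sqr_coord_le_dot u i : u 0 i ^+ 2 <= dot u u.
Proof.
rewrite /dot (bigD1 i)//= -expr2 lerDl; apply: sumr_ge0 => j _.
by rewrite -expr2 sqr_ge0.
Qed.

Lemma dot_eq0 u : (dot u u == 0) = (u == 0).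
Proof.
apply/eqP/eqP => [u0|->]; last exact: dot0l.
apply/rowP => i; rewrite mxE; apply/eqP.
by rewrite -sqrf_eq0 eq_le sqr_ge0 -{1}u0 sqr_coord_le_dot.
Qed.

Lemma dot_gt0 u : (0 < dot u u) = (u != 0).
Proof. by rewrite lt_def dot_eq0 dot_ge0 andbT. Qed.

Lemma dot_delta u i : dot u (delta_mx 0 i) = u 0 i.
Proof.
rewrite /dot (bigD1 i)//= big1 ?addr0 ?mxE ?eqxx ?mulr1// => j jNi.
by rewrite mxE eqxx (negbTE jNi) mulr0.
Qed.

Lemma cauchy_schwarz u v : dot u v ^+ 2 <= dot u u * dot v v.
Proof.
have [->|v0] := eqVneq v 0; first by rewrite !dot0r expr0n mulr0.
have := dot_ge0 (dot v v *: u - dot u v *: v).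
have v1 : 0 < dot v v by rewrite dot_gt0.
rewrite !dotE (dotC v u) => h; rewrite -subr_ge0 -(pmulr_rge0 _ v1).
by apply: le_trans h _; rewrite le_eqVlt; apply/orP; left; apply/eqP; ring.
Qed.

Lemma dotD_le u v : dot (u + v) (u + v) <= 2 * dot u u + 2 * dot v v.
Proof.
have := dot_ge0 (u - v); rewrite !dotE (dotC v u); lra.
Qed.

Lemma dot_mul_tr u v : dot u v = (u *m v^T) 0 0.
Proof. by rewrite mxE; apply: eq_bigr => i _; rewrite mxE. Qed.

Lemma dot_mulmx u v (Q : 'M[R]_m.+1) : dot (u *m Q) v = dot u (v *m Q^T).
Proof. by rewrite !dot_mul_tr trmx_mul trmxK mulmxA. Qed.

Lemma hmetricE x u v : hmetric x u v = dot u v / height x ^+ 2.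
Proof. by []. Qed.

(** Euclidean balls are what the geometric arguments produce, whereas the
    topology of row vectors comes from the supremum norm. *)
Lemma near_dotP (p : 'rV[R]_m.+1) (A : set 'rV[R]_m.+1) :
  nbhs p A <-> exists2 r, 0 < r & forall x, dot (x - p) (x - p) < r -> A x.
Proof.
split=> [/nbhs_normP[e /= e0 eA]|[r r0 rA]].
  exists (e ^+ 2); first exact: exprn_gt0.
  move=> x xp; apply: eA => /=.
  rewrite /ball_/= distrC; rewrite /Num.Def.normr/= mx_normrE.
  rewrite (bigmax_lt _ e0)// => -[i j] _ /=.
  rewrite (ord1 i) -(@ltr_pXn2r _ 2)// ?nnegrE// ?(ltW e0)//.
  by rewrite real_normK ?num_real//; apply: le_lt_trans xp; exact: sqr_coord_le_dot.
apply/(@nbhs_normP R _ p A).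
pose e := Num.min 1 (r / m.+1%:R).
have e0 : 0 < e by rewrite lt_min ltr01 divr_gt0.
exists e => // x /=; rewrite /ball_/= distrC /Num.Def.normr/= mx_normrE => xp.
apply: rA; rewrite /dot.
have h i : (x - p) 0 i * (x - p) 0 i < r / m.+1%:R.
  have : `|(x - p) 0 i| < e.
    by apply: le_lt_trans xp; exact: (le_bigmax _ (fun ij => `|(x - p) ij.1 ij.2|) (ord0, i)).
  move: e0; rewrite /e !lt_min => /andP[_ r1] /andP[x1 x2].
  rewrite -expr2 -real_normK ?num_real// expr2.
  have a0 := normr_ge0 ((x - p) 0 i).
  by apply: le_lt_trans x2; rewrite ler_piMr// ltW.
apply: lt_le_trans (_ : \sum_(i < m.+1) r / m.+1%:R <= _).
  by apply: ltr_sum => //; apply/hasP; exists ord0; rewrite ?mem_index_enum.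
by rewrite sumr_const card_ord -[X in X <= _]mulr_natr divfK ?pnatr_eq0.
Qed.

Lemma open_dotP (U : set 'rV[R]_m.+1) :
  open U <-> forall p, U p ->
    exists2 r, 0 < r & forall x, dot (x - p) (x - p) < r -> U x.
Proof.
rewrite openE; split=> h p /h; first by move/near_dotP.
by move=> H; apply/near_dotP.
Qed.

End Dot.

(** * Functions of class C^1 and C^2 *)

Definition grad {R : realType} {m : nat} (f : 'rV[R]_m.+1 -> R)
    (x : 'rV[R]_m.+1) : 'rV[R]_m.+1 :=
  \row_i 'D_(delta_mx 0 i) f x.

Definition hess {R : realType} {m : nat} (f : 'rV[R]_m.+1 -> R)
    (x : 'rV[R]_m.+1) : 'M[R]_m.+1 :=
  \matrix_(i, j) 'D_(delta_mx 0 i) ('D_(delta_mx 0 j) f) x.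

Section LineDerivative.
Context {R : realType} {V W : normedModType R}.
Implicit Types (f : V -> W) (x v : V).

Lemma is_derive_line f x v t : derivable f (x + t *: v) v ->
  is_derive t 1 (fun s : R => f (x + s *: v)) ('D_v f (x + t *: v)).
Proof.
have E : (fun h : R => h^-1 *: (((fun s : R => f (x + s *: v)) \o shift t) (h *: 1)
    - f (x + t *: v))) =
    (fun h : R => h^-1 *: ((f \o shift (x + t *: v)) (h *: v) - f (x + t *: v))).
  apply/funext => h /=; congr (_ *: (f _ - _)).
  by rewrite [_%:A]mulr1 scalerDl addrCA.
by move=> fd; apply: DeriveDef; rewrite /derivable /derive E.
Qed.

Lemma derivable_scale f x v (a : R) : derivable f x v ->
  derivable f x (a *: v) /\ 'D_(a *: v) f x = a *: 'D_v f x.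
Proof.
move=> fd.
have h1 : is_derive (0 : R) 1 (fun s : R => f (x + s *: v)) ('D_v f x).
  by have := @is_derive_line f x v 0; rewrite scale0r addr0; apply.
have h2 : is_derive (0 : R) 1 (fun s : R => f (x + s *: (a *: v))) (a *: 'D_v f x).
  have d1 : differentiable (fun s : R => f (x + s *: v)) (a * 0).
    by rewrite mulr0; apply/derivable1_diffP; case: h1.
  have d2 : differentiable (fun s : R => a * s) 0 by apply/derivable1_diffP.
  have E : (fun s : R => f (x + s *: (a *: v))) =
      (fun s : R => f (x + s *: v)) \o (fun s : R => a * s).
    by apply/funext => s /=; rewrite scalerA (mulrC a).
  rewrite E; apply: DeriveDef.
    by apply/derivable1_diffP/differentiable_comp.
  rewrite deriveE; last exact: differentiable_comp.
  rewrite diff_comp//= -!deriveE//.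
  have -> : 'D_1 (fun s : R => a * s) 0 = a by rewrite derive_val [_%:A]mulr1.
  rewrite deriveE// -[X in 'd _ _ X = _]mulr1 [LHS]linearZ/= -deriveE//.
  by rewrite mulr0; case: h1 => _ ->.
have E : (fun h : R => h^-1 *: (((fun s : R => f (x + s *: (a *: v))) \o shift (0 : R)) (h *: (1:R))
    - f (x + 0 *: (a *: v)))) =
    (fun h : R => h^-1 *: ((f \o shift x) (h *: (a *: v)) - f x)).
  apply/funext => h /=; congr (_ *: (f _ - f _)).
    by rewrite [_%:A]mulr1 addr0 addrC.
  by rewrite scale0r addr0.
by case: h2; rewrite /derivable /derive E.
Qed.

End LineDerivative.

Lemma mvt_line {R : realType} {V : normedModType R} (f : V -> R) (x v : V) :
  (forall t : R, 0 <= t <= 1 -> derivable f (x + t *: v) v) ->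
  exists2 t : R, 0 < t < 1 & f (x + v) - f x = 'D_v f (x + t *: v).
Proof.
move=> fd.
have [|||t + E] := @MVT _ (fun s : R => f (x + s *: v))
    (fun s => 'D_v f (x + s *: v)) 0 1.
- exact: ltr01.
- by move=> t; rewrite in_itv/= => /andP[t0 t1]; apply: is_derive_line; apply: fd; rewrite !ltW.
- apply: derivable_within_continuous => t; rewrite in_itv/= => t01.
  by have [] := @is_derive_line _ _ _ f x v t (fd _ t01).
rewrite in_itv/= => t01; exists t => //.
by move: E; rewrite subr0 mulr1 scale1r scale0r addr0.
Qed.

Section C1.
Context {R : realType} {m : nat}.
Notation V := 'rV[R]_m.+1.
Implicit Types (f g : V -> R) (U : set V) (x y u v h : V).

Lemma mvt_step f x v (h : R) :
  (forall t : R, 0 <= t <= 1 -> derivable f (x + (t * h) *: v) v) ->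
  exists2 t : R, 0 < t < 1 & f (x + h *: v) - f x = h * 'D_v f (x + (t * h) *: v).
Proof.
move=> fd; have [t /andP[t0 t1]|t t01 ->] := @mvt_line R V f x (h *: v).
  by rewrite scalerA; apply: (derivable_scale _ _).1; apply: fd; rewrite t0.
exists t => //; rewrite scalerA.
by rewrite (derivable_scale _ _).2//; case/andP: t01 => t0 t1; apply: fd; rewrite !ltW.
Qed.

Lemma near_dot_lt (x : V) e : 0 < e -> \forall y \near x, dot (y - x) (y - x) < e.
Proof. by move=> e0; apply/near_dotP; exists e. Qed.

(** Additivity in the direction: the increment along [u + v] is an increment
    along [u] followed by one along [v], and each is given by the mean value
    theorem, at points which tend to [x]. *)
Lemma C1_deriveD f U x u v : open U -> Ck 1 U f -> U x ->
  'D_(u + v) f x = 'D_u f x + 'D_v f x.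
Proof.
move=> oU [fd fc] Ux; apply/eqP; rewrite -subr_eq0 -normr_le0; apply/ler_addgt0Pl => e e0.
rewrite addr0.
have e3 : 0 < e / 3%:R by rewrite divr_gt0.
have cont w : \forall y \near x, U y /\ `|'D_w f x - 'D_w f y| < e / 3%:R.
  apply: filterI; first exact: open_nbhs_nbhs.
  by have /cvgrPdist_lt/(_ _ e3) := fc w x Ux.
have /near_dotP[r r0 hr] : \forall y \near x, (U y /\ `|'D_u f x - 'D_u f y| < e / 3%:R)
   /\ (U y /\ `|'D_v f x - 'D_v f y| < e / 3%:R) by apply: filterI; exact: cont.
have /cvg_ex[/= l lP] : derivable f x (u + v) by exact: fd.
have lE : 'D_(u + v) f x = l by apply/cvg_lim.
have /cvgrPdist_lt/(_ _ e3) [/= s s0 hs] := lP.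
pose B := 1 + 2 * dot u u + 2 * dot v v.
have B1 : 1 <= B by rewrite /B; have := dot_ge0 u; have := dot_ge0 v; lra.
pose h := Num.min (s / 2) (Num.min 1 (r / (2 * B))).
have h0 : 0 < h.
  rewrite !lt_min ltr01 !divr_gt0//= ?mulr_gt0//; lra.
have hhB : h ^+ 2 * B < r.
  have h1 : h <= 1 by rewrite !ge_min lexx ?orbT.
  have h2 : h * (2 * B) <= r.
    rewrite -ler_pdivlMr; last by rewrite mulr_gt0//; lra.
    by rewrite !ge_min lexx ?orbT.
  have : h ^+ 2 * B <= h * B.
    by rewrite ler_wpM2r ?expr2 ?ler_piMr//; [lra|exact: ltW].
  have : 0 < h * B by rewrite mulr_gt0//; lra.
  lra.
have pos (a b : R) : 0 <= a <= 1 -> 0 <= b <= 1 ->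
    dot (x + (a * h) *: u + (b * h) *: v - x) (x + (a * h) *: u + (b * h) *: v - x) < r.
  move=> /andP[a0 a1] /andP[b0 b1]; apply: le_lt_trans hhB.
  have -> : x + (a * h) *: u + (b * h) *: v - x = h *: (a *: u + b *: v).
    by apply/rowP => i; rewrite !mxE; ring.
  rewrite dotZl dotZr mulrA -expr2 ler_wpM2l ?sqr_ge0//.
  apply: le_trans (dotD_le _ _) _; rewrite !dotE /B.
  have a2 : a * (a * dot u u) <= dot u u.
    by rewrite mulrA ler_piMl ?dot_ge0// mulr_ile1.
  have b2 : b * (b * dot v v) <= dot v v.
    by rewrite mulrA ler_piMl ?dot_ge0// mulr_ile1.
  lra.
have z01 : (0:R) <= 0 <= (1:R) by rewrite lexx ler01.
have o01 : (0:R) <= 1 <= (1:R) by rewrite lexx ler01.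
have [t|a /andP[a0 a1] Eu] := @mvt_step f x u h.
  move=> t01; apply: fd.
  by have := pos t 0 t01 z01; rewrite mul0r scale0r addr0 => /hr[[]].
have [t|b /andP[b0 b1] Ev] := @mvt_step f (x + h *: u) v h.
  move=> t01; apply: fd.
  by have := pos 1 t o01 t01; rewrite mul1r => /hr[[]].
have {}a01 : 0 <= a <= 1 by rewrite !ltW.
have {}b01 : 0 <= b <= 1 by rewrite !ltW.
have := pos a 0 a01 z01; rewrite mul0r scale0r addr0 => /hr[[_ du] _].
have := pos 1 b o01 b01; rewrite mul1r => /hr[_ [_ dv]].
have hs2 : h <= s / 2 by rewrite !ge_min lexx.
have := hs h; rewrite /ball_/= sub0r normrN (gtr0_norm h0) gt_eqF//.
have -> : h < s by lra.
move=> /(_ erefl erefl).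
have -> : h^-1 *: (f (h *: (u + v) + x) - f x) =
  'D_v f (x + h *: u + (b * h) *: v) + 'D_u f (x + (a * h) *: u).
  have -> : h *: (u + v) + x = x + h *: u + h *: v by rewrite scalerDr addrC addrA.
  rewrite -(subrK (f (x + h *: u)) (f (x + h *: u + h *: v))) -addrA Ev Eu.
  by rewrite -mulrDr [LHS]mulrA mulVf ?mul1r// gt_eqF.
rewrite lE => H.
have -> : l - ('D_u f x + 'D_v f x) =
   (l - ('D_v f (x + h *: u + (b * h) *: v) + 'D_u f (x + (a * h) *: u)))
   - ('D_u f x - 'D_u f (x + (a * h) *: u)) - ('D_v f x - 'D_v f (x + h *: u + (b * h) *: v)).
  ring.
apply: le_trans (ler_normB _ _) _; apply: le_trans (lerD (ler_normB _ _) (lexx _)) _.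
lra.
Qed.

Lemma C1_deriveE f U x v : open U -> Ck 1 U f -> U x ->
  'D_v f x = dot (grad f x) v.
Proof.
move=> oU fC Ux.
have lin (s : seq 'I_m.+1) (F : 'I_m.+1 -> V) :
    'D_(\sum_(i <- s) F i) f x = \sum_(i <- s) 'D_(F i) f x.
  elim: s => [|i s IH]; first by rewrite !big_nil derive0.
  by rewrite !big_cons (C1_deriveD _ _ oU fC Ux) IH.
rewrite {1}(row_sum_delta v) lin; apply: eq_bigr => i _.
by rewrite (derivable_scale _ _).2 ?mxE; [rewrite mulrC|apply: fC.1].
Qed.

Lemma C1_mvt f U x h : open U -> Ck 1 U f ->
  (forall t : R, 0 <= t <= 1 -> U (x + t *: h)) ->
  exists2 t : R, 0 < t < 1 & f (x + h) - f x = dot (grad f (x + t *: h)) h.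
Proof.
move=> oU fC xU.
have [t t01|t t01 ->] := @mvt_line R V f x h; first by apply: fC.1; exact: xU.
exists t => //; rewrite (C1_deriveE _ oU fC)//; apply: xU.
by case/andP: t01 => t0 t1; rewrite !ltW.
Qed.

Lemma continuous_epsP f x : {for x, continuous f} <->
  forall e : R, 0 < e -> \forall y \near x, `|f y - f x| < e.
Proof.
split=> [fx e e0|H].
  have /cvgrPdist_lt/(_ _ e0) := fx; apply: filterS => y; by rewrite distrC.
apply/(@cvgrPdist_lt _ _ _ (nbhs x)) => e /H; apply: filterS => y.
by rewrite distrC.
Qed.

Lemma mx_continuous (T : topologicalType) (g : T -> V) (x : T) :
  (forall i, {for x, continuous (fun y : T => g y 0 i)}) -> {for x, continuous g}.
Proof.
move=> gc; apply/cvgrPdist_lt => e e0; near=> y.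
rewrite /Num.Def.normr/= mx_normrE (bigmax_lt _ e0)// => -[i j] _ /=.
rewrite (ord1 i) !mxE; move: j; near: y; apply: filter_forall => j.
by have /cvgrPdist_lt/(_ _ e0) := gc j.
Unshelve. all: by end_near. Qed.

Lemma cvg_dot (T : Type) (F : set_system T) (FF : Filter F) (g h : T -> V) (a b : V) :
  g @ F --> a -> h @ F --> b -> dot (g y) (h y) @[y --> F] --> dot a b.
Proof.
move=> ga hb; apply: (@cvg_big _ _ +%R 0) => [|i _]; first exact: add_continuous.
apply: cvgM.
  exact: (cvg_comp _ _ ga (@coord_continuous _ _ _ 0 i a)).
exact: (cvg_comp _ _ hb (@coord_continuous _ _ _ 0 i b)).
Qed.

Lemma continuous_dot (T : topologicalType) (g h : T -> V) (x : T) :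
  {for x, continuous g} -> {for x, continuous h} ->
  {for x, continuous (fun y : T => dot (g y) (h y))}.
Proof. exact: cvg_dot. Qed.

Lemma C1_grad_continuous f U x : Ck 1 U f -> U x -> {for x, continuous (grad f)}.
Proof.
move=> fC Ux; apply: mx_continuous => i.
have -> : (fun y => grad f y 0 i) = 'D_(delta_mx 0 i) f.
  by apply/funext => y; rewrite mxE.
exact: fC.2.
Qed.

(** The increment is squared so that only Euclidean lengths appear, to which the
    Cauchy-Schwarz inequality applies. *)
Lemma C1_taylor f U x e : open U -> Ck 1 U f -> U x -> 0 < e ->
  \forall y \near x,
    (f y - f x - dot (grad f x) (y - x)) ^+ 2 <= e * dot (y - x) (y - x).
Proof.
move=> oU fC Ux e0.
have gc := C1_grad_continuous fC Ux.
have /near_dotP[r r0 hr] : \forall y \near x, U y /\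
    dot (grad f y - grad f x) (grad f y - grad f x) < e.
  apply: filterI; first exact: open_nbhs_nbhs.
  have : {for x, continuous (fun y => dot (grad f y - grad f x) (grad f y - grad f x))}.
    have dc : {for x, continuous (fun y => grad f y - grad f x)}.
      exact: (cvgB gc (@cst_continuous _ _ (grad f x) x)).
    exact: (continuous_dot dc dc).
  by move=> /cvgrPdist_lt/(_ _ e0); rewrite subrr dot0l; apply: filterS => y;
    rewrite sub0r normrN ger0_norm ?dot_ge0.
apply/near_dotP; exists r => // y xy.
have seg (t : R) : 0 <= t <= 1 ->
    dot (x + t *: (y - x) - x) (x + t *: (y - x) - x) < r.
  move=> /andP[t0 t1]; apply: le_lt_trans xy.
  rewrite addrAC subrr add0r dotZl dotZr mulrA ler_piMl ?dot_ge0//.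
  by rewrite mulr_ile1.
have [t /seg/hr[]//|t /andP[t0 t1]] := C1_mvt oU fC (h := y - x) (x := x).
rewrite subrKC => ->; rewrite -dotBl.
apply: le_trans (cauchy_schwarz _ _) _.
rewrite ler_wpM2r ?dot_ge0//.
by have [|_ /ltW] := hr (x + t *: (y - x)); first by apply: seg; rewrite !ltW.
Qed.

Lemma C1_continuous f U : open U -> Ck 1 U f -> Ck 0 U f.
Proof.
move=> oU fC; suff H : forall x : V, U x -> {for x, continuous f} by move=> x /H.
move=> x Ux; apply/continuous_epsP => e e0.
have h1 := C1_taylor oU fC Ux (@ltr01 R).
have c2 : \forall y \near x, `|dot (grad f x) (y - x)| < e / 2.
  have : {for x, continuous (fun y => dot (grad f x) (y - x))}.
    have dc : {for x, continuous (fun y => y - x)}.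
      exact: (cvgB cvg_id (@cst_continuous _ _ x x)).
    exact: (continuous_dot (@cst_continuous _ _ (grad f x) x) dc).
  move=> /cvgrPdist_lt/(_ (e / 2)); rewrite subrr dot0r divr_gt0// => /(_ isT).
  by apply: filterS => y; rewrite sub0r normrN.
have h3 : \forall y \near x, dot (y - x) (y - x) < (e / 2) ^+ 2.
  by apply: near_dot_lt; rewrite exprn_gt0// divr_gt0.
near=> y.
have a1 : (f y - f x - dot (grad f x) (y - x)) ^+ 2 <= 1 * dot (y - x) (y - x) by near: y.
have a2 : `|dot (grad f x) (y - x)| < e / 2 by near: y.
have a3 : dot (y - x) (y - x) < (e / 2) ^+ 2 by near: y.
have e2 : 0 < e / 2 by rewrite divr_gt0.
have a4 : `|f y - f x - dot (grad f x) (y - x)| < e / 2.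
  rewrite -(@ltr_pXn2r _ 2)// ?nnegrE ?(ltW e2)// real_normK ?num_real//; lra.
rewrite -(subrK (dot (grad f x) (y - x)) (f y - f x)).
by apply: le_lt_trans (ler_normD _ _) _; lra.
Unshelve. all: by end_near. Qed.

Lemma C2_C1 f U : open U -> Ck 2 U f -> Ck 1 U f.
Proof.
move=> oU [fd fc]; split=> // v; exact: (C1_continuous oU (fc v)).
Qed.

End C1.

Definition taylor2 {R : realType} {m : nat} (f : 'rV[R]_m.+1 -> R)
    (p g : 'rV[R]_m.+1) (Q : 'M[R]_m.+1) : Prop :=
  forall e : R, 0 < e -> \forall x \near p,
    `|f x - f p - dot g (x - p) - 2^-1 * dot ((x - p) *m Q) (x - p)|
      <= e * dot (x - p) (x - p).

Section Taylor.
Context {R : realType} {m : nat}.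
Notation V := 'rV[R]_m.+1.
Implicit Types (f g : V -> R) (U : set V) (x y p u v : V).

Lemma is_derive_coord (W : normedModType R) (c : W -> V) (t w : W) (u : V) i :
  is_derive t w c u -> is_derive t w (fun s => c s 0 i) (u 0 i).
Proof.
move=> [cd <-]; rewrite derive_mx// mxE; apply: DeriveDef => //.
exact: (derivable_mxP _ _ _).1.
Qed.

Lemma is_derive_coordP (W : normedModType R) (c : W -> V) (t w : W) (u : V) :
  (forall i, is_derive t w (fun s => c s 0 i) (u 0 i)) -> is_derive t w c u.
Proof.
move=> cd; have dc : derivable c t w.
  by apply/derivable_mxP => i j; rewrite (ord1 i); case: (cd j).
apply: DeriveDef => //; rewrite derive_mx//; apply/rowP => i; rewrite mxE.
by case: (cd i).
Qed.

Lemma is_derive_dot (W : normedModType R) (c d : W -> V) (t w : W) (u v : V) :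
  is_derive t w c u -> is_derive t w d v ->
  is_derive t w (fun s => dot (c s) (d s)) (dot u (d t) + dot (c t) v).
Proof.
move=> hc hd.
have E : (fun s => dot (c s) (d s)) =
    \sum_i ((fun s => c s 0 i) * (fun s => d s 0 i)).
  by apply/funext => s; rewrite fct_sumE.
have [H1 H2] := is_derive_sum (fun i =>
  is_deriveM (is_derive_coord i hc) (is_derive_coord i hd)).
rewrite E; apply: DeriveDef => //; rewrite H2 /dot -big_split; apply: eq_bigr => i _ /=.
by rewrite addrC; congr (_ + _); rewrite /GRing.scale/= mulrC.
Qed.

Lemma is_derive_continuous (W : normedModType R) (c : R -> W) (t : R) (u : W) :
  is_derive t 1 c u -> {for t, continuous c}.
Proof. by case=> /derivable1_diffP/differentiable_continuous. Qed.

Lemma is_derive_affine (z w : V) (t : R) : is_derive t 1 (fun s : R => z + s *: w) w.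
Proof.
apply: is_derive_coordP => i.
have -> : (fun s : R => (z + s *: w) 0 i) = (fun s : R => z 0 i + w 0 i * s).
  by apply/funext => s; rewrite !mxE; ring.
by apply: is_derive_eq; rewrite /GRing.scale/=; ring.
Qed.

(** The curve need only be differentiable at [t], as is the case for the curves
    which define tangent vectors. *)
Lemma is_derive_C1_comp f U (c : R -> V) (t : R) (u : V) :
  open U -> Ck 1 U f -> U (c t) -> is_derive t 1 c u ->
  is_derive t 1 (f \o c) (dot (grad f (c t)) u).
Proof.
move=> oU fC Uc cd.
have [cdd cv] := cd.
have lc : (fun h : R => h^-1 *: ((c \o shift t) (h *: 1) - c t)) @ 0^' --> u.
  by rewrite -cv; exact: cdd.
suff H : (fun h : R => h^-1 *: ((f \o c \o shift t) (h *: 1) - (f \o c) t)) @ 0^'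
    --> dot (grad f (c t)) u.
  by apply: DeriveDef; [apply/cvg_ex; exists (dot (grad f (c t)) u)|exact/cvg_lim].
have ch : (fun h : R => c (h *: 1 + t)) @ 0^' --> c t.
  have ct := is_derive_continuous cd.
  have h1 : (fun h : R => h *: (1 : R) + t) @ 0^' --> t.
    apply/cvgrPdist_lt => e e0; near=> h.
    rewrite [_%:A]mulr1 opprD addrCA subrr addr0 normrN.
    by near: h; exact: dnbhs0_lt.
  exact: (cvg_comp _ _ h1 ct).
pose q h : V := h^-1 *: (c (h *: 1 + t) - c t).
have lq : dot (grad f (c t)) (q h) @[h --> 0^'] --> dot (grad f (c t)) u.
  have := @continuous_dot R m V (fun=> grad f (c t)) id u
     (@cst_continuous _ _ _ _) (fun A => id).
  by move=> H; apply: (cvg_comp _ _ lc H).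
have nq : dot (q h) (q h) @[h --> 0^'] --> dot u u.
  have := @continuous_dot R m V id id u (fun A => id) (fun A => id).
  by move=> H; apply: (cvg_comp _ _ lc H).
apply/cvgrPdist_lt => e e0.
pose M := dot u u + 1.
have M0 : 0 < M by have := dot_ge0 u; rewrite /M; lra.
pose e1 := (e / 2) ^+ 2 / M.
have e10 : 0 < e1 by rewrite divr_gt0// exprn_gt0// divr_gt0.
have /ch tay := C1_taylor oU fC Uc e10.
near=> h.
have h0 : h != 0 by near: h; exact: nbhs_dnbhs_neq.
have a1 : `|dot (grad f (c t)) u - dot (grad f (c t)) (q h)| < e / 2.
  by near: h; apply: (cvgrPdist_lt _ _).1 lq _ _; rewrite divr_gt0.
have a2 : `|dot u u - dot (q h) (q h)| < 1.
  by near: h; exact: ((cvgrPdist_lt _ _).1 nq _ ltr01).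
have a3 : (f (c (h *: 1 + t)) - f (c t) - dot (grad f (c t)) (c (h *: 1 + t) - c t)) ^+ 2
    <= e1 * dot (c (h *: 1 + t) - c t) (c (h *: 1 + t) - c t) by near: h.
have qE : c (h *: 1 + t) - c t = h *: q h by rewrite /q scalerA divff// scale1r.
have {}a2 : dot (q h) (q h) < M by rewrite /M; move: a2; rewrite ltr_norml; lra.
pose D := h^-1 * (f (c (h *: 1 + t)) - f (c t)) - dot (grad f (c t)) (q h).
have DE : (f (c (h *: 1 + t)) - f (c t) - dot (grad f (c t)) (h *: q h)) = h * D.
  by rewrite /D dotZr; field.
have a4 : `|D| < e / 2.
  rewrite -(@ltr_pXn2r _ 2)// ?nnegrE ?divr_ge0 ?(ltW e0)// real_normK ?num_real//.
  have hh : 0 < h ^+ 2 by rewrite exprn_even_gt0.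
  move: a3; rewrite qE DE exprMn dotZl dotZr.
  have -> : e1 * (h * (h * dot (q h) (q h))) = h ^+ 2 * (e1 * dot (q h) (q h)) by ring.
  rewrite ler_pM2l// => a3; apply: le_lt_trans a3 _.
  have -> : (e / 2) ^+ 2 = e1 * M by rewrite /e1 divfK// gt_eqF.
  by rewrite ltr_pM2l.
have -> : dot (grad f (c t)) u - h^-1 *: ((f \o c \o shift t) (h *: 1) - (f \o c) t) =
   dot (grad f (c t)) u - dot (grad f (c t)) (q h) - D.
  by rewrite /D /GRing.scale/=; ring.
by apply: le_lt_trans (ler_normB _ _) _; lra.
Unshelve. all: by end_near. Qed.

(** The gradient of a C^2 function is differentiable, with derivative the
    Hessian; the remainder of order two follows by the mean value theorem along
    the segment from [p], applied to [f] minus its Taylor polynomial. *)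
Lemma C2_taylor f U p : open U -> Ck 2 U f -> U p ->
  taylor2 f p (grad f p) (hess f p).
Proof.
move=> oU fC2 Up e e0.
have fC := C2_C1 oU fC2.
pose n := m.+1%:R : R.
have n0 : 0 < n by rewrite ltr0n.
have /near_dotP[r r0 hr] : \forall y \near p, U y /\ forall i,
    ('D_(delta_mx 0 i) f y - 'D_(delta_mx 0 i) f p
      - dot (grad ('D_(delta_mx 0 i) f) p) (y - p)) ^+ 2
      <= (e ^+ 2 / n) * dot (y - p) (y - p).
  apply: filterI; first exact: open_nbhs_nbhs.
  have en : 0 < e ^+ 2 / n by rewrite divr_gt0// exprn_gt0.
  apply: (@filter_forall V _ _ (nbhs p)) => i.
  exact: (C1_taylor oU (fC2.2 (delta_mx 0 i)) Up en).
have gr y : dot (y - p) (y - p) < r ->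
    dot (grad f y - grad f p - (y - p) *m hess f p)
        (grad f y - grad f p - (y - p) *m hess f p) <= e ^+ 2 * dot (y - p) (y - p).
  move=> /hr[_ H]; rewrite {1}/dot.
  apply: le_trans (_ : \sum_(i < m.+1) (e ^+ 2 / n) * dot (y - p) (y - p) <= _).
    apply: ler_sum => i _; rewrite -expr2; apply: le_trans (H i).
    rewrite le_eqVlt; apply/orP; left; apply/eqP; congr (_ ^+ 2).
    rewrite !mxE; congr (_ - _); rewrite dotC; apply: eq_bigr => j _.
    by rewrite !mxE.
  rewrite sumr_const card_ord -[X in X <= _]mulr_natr -/n.
  have nn : n != 0 by rewrite gt_eqF.
  by rewrite le_eqVlt; apply/orP; left; apply/eqP; field.
apply/near_dotP; exists r => // x xp.
set h := x - p in xp *.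
pose psi (t : R) := f (p + t *: h) - t * dot (grad f p) h
   - 2^-1 * t ^+ 2 * dot (h *m hess f p) h.
have seg (t : R) : 0 <= t <= 1 -> dot (p + t *: h - p) (p + t *: h - p) < r.
  move=> /andP[t0 t1]; apply: le_lt_trans xp.
  rewrite addrAC subrr add0r dotZl dotZr mulrA ler_piMl ?dot_ge0//.
  by rewrite mulr_ile1.
have dpsi (t : R) : 0 <= t <= 1 -> is_derive t 1 psi
    (dot (grad f (p + t *: h) - grad f p - (t *: h) *m hess f p) h).
  move=> t01; have [Ut _] := hr _ (seg _ t01).
  have h1 : is_derive t 1 (fun s : R => f (p + s *: h)) (dot (grad f (p + t *: h)) h).
    rewrite -(C1_deriveE _ oU fC Ut); apply: is_derive_line.
    exact: fC.1.
  apply: is_derive_eq.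
  rewrite -scalemxAl !dotE /GRing.scale/=.
  by field.
have [|||t] := @MVT _ psi (fun t => dot (grad f (p + t *: h) - grad f p - (t *: h) *m hess f p) h) 0 1.
- exact: ltr01.
- by move=> t; rewrite in_itv/= => /andP[t0 t1]; apply: dpsi; rewrite !ltW.
- apply: derivable_within_continuous => t; rewrite in_itv/= => t01.
  by have [] := dpsi _ t01.
rewrite in_itv/= => /andP[t0 t1]; rewrite subr0 mulr1 => E.
have {E} -> : f x - f p - dot (grad f p) h - 2^-1 * dot (h *m hess f p) h =
   dot (grad f (p + t *: h) - grad f p - (t *: h) *m hess f p) h.
  by rewrite -E /psi scale1r scale0r addr0 /h subrKC; ring.
have t01 : 0 <= t <= 1 by rewrite !ltW.
have := gr _ (seg _ t01).
have -> : p + t *: h - p = t *: h by rewrite addrAC subrr add0r.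
move=> G.
rewrite -(@ler_pXn2r _ 2)// ?nnegrE ?mulr_ge0 ?dot_ge0 ?(ltW e0)//.
rewrite real_normK ?num_real//.
apply: le_trans (cauchy_schwarz _ _) _.
rewrite exprMn (expr2 (dot h h)) mulrA ler_wpM2r ?dot_ge0//.
apply: le_trans G _; rewrite ler_wpM2l ?sqr_ge0// dotZl dotZr mulrA ler_piMl ?dot_ge0//.
by rewrite mulr_ile1// ltW.
Qed.

End Taylor.

(** * The Levi-Civita connection and traces on hyperplanes *)

Definition proj {R : realType} {m : nat} (N : 'rV[R]_m.+1) : 'M[R]_m.+1 :=
  1%:M - N^T *m N.

(** The trace of the quadratic form [Q] on the hyperplane orthogonal to [N], when
    [N] is a unit vector. *)
Definition ptrace {R : realType} {m : nat} (Q : 'M[R]_m.+1) (N : 'rV[R]_m.+1) : R :=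
  \tr Q - dot (N *m Q) N.

Section Connection.
Context {R : realType} {m : nat}.
Notation V := 'rV[R]_m.+1.
Implicit Types (x u v : V).

Definition en : V := delta_mx 0 ord_max.

Lemma dot_en u : dot u en = height u.
Proof. by rewrite dot_delta. Qed.

Lemma is_derive_coord_id x v i : is_derive x v (fun y : V => y 0 i) (v 0 i).
Proof.
have d : derivable (@id V) x v by exact: derivable_id.
have E := derive_mx d; rewrite derive_id in E.
by apply: DeriveDef; [exact: ((derivable_mxP _ _ _).1 d 0 i)|rewrite [in RHS]E mxE].
Qed.

Lemma gramE x i j : gram x i j = (i == j)%:R * (height x)^-1 ^+ 2.
Proof.
rewrite mxE hmetricE /basis_vec dot_delta mxE eqxx /= exprVn.
by rewrite eq_sym.
Qed.

Lemma invmx_gram x : height x != 0 -> invmx (gram x) = (height x ^+ 2)%:M.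
Proof.
move=> h0.
have gE : gram x = ((height x)^-1 ^+ 2)%:M.
  by apply/matrixP => i j; rewrite gramE mxE mulr_natl.
rewrite gE invmx_scalar; congr (_%:M).
by rewrite exprVn invrK.
Qed.

Lemma derive_gram x i j l : height x != 0 ->
  'D_(delta_mx 0 i) (fun y : V => gram y j l) x =
  - 2 * (j == l)%:R * (i == ord_max)%:R * (height x)^-1 ^+ 3.
Proof.
move=> h0.
have dh := is_derive_coord_id x (delta_mx 0 i) ord_max.
have dv : is_derive x (delta_mx 0 i : V) (fun y : V => (y 0 ord_max)^-1)
    (- (height x)^-1 ^+ 2 * (i == ord_max)%:R).
  have [d1 d2] := dh.
  apply: DeriveDef; first exact: derivableV.
  by rewrite deriveV// d2 mxE eqxx /= /GRing.scale/= exprVn (eq_sym i).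
have -> : (fun y : V => gram y j l) =
   (fun y : V => (j == l)%:R * (y 0 ord_max)^-1 ^+ 2).
  by apply/funext => y; rewrite gramE.
have d2 := is_deriveZ (j == l)%:R (is_deriveX 2 dv).
have [_ ->] := d2; rewrite /GRing.scale/= /height; ring.
Qed.

Lemma christoffelE x k i j : height x != 0 ->
  christoffel x k i j = - (height x)^-1 *
   ((j == k)%:R * (i == ord_max)%:R + (i == k)%:R * (j == ord_max)%:R
    - (i == j)%:R * (k == ord_max)%:R).
Proof.
move=> h0; rewrite /christoffel invmx_gram// (bigD1 k)//= big1 => [|l lk]; last first.
  by rewrite mxE eq_sym (negbTE lk) mulr0n mul0r.
rewrite mxE eqxx mulr1n /basis_vec !derive_gram// addr0.
by field.
Qed.

(** The halfspace metric is conformal to the Euclidean one, with a factor which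
    depends on the height only; [en] is the vertical direction. *)
Lemma connection_formE x u v : height x != 0 ->
  connection_form x u v = - (height x)^-1 *:
    (height u *: v + height v *: u - dot u v *: en).
Proof.
move=> h0; apply/rowP => k; rewrite !mxE.
under eq_bigr do under eq_bigr do rewrite christoffelE// -!mulrA.
under eq_bigr do rewrite -mulr_sumr.
rewrite -mulr_sumr; congr (_ * _).
have H1 : \sum_(i < m.+1) \sum_(j < m.+1)
   (j == k)%:R * (i == ord_max)%:R * (u 0 i * v 0 j) = height u * v 0 k.
  rewrite (bigD1 ord_max)//= [X in _ + X]big1 => [|i /negbTE ->]; last first.
    by rewrite big1// => j _; rewrite mulr0 mul0r.
  rewrite addr0 (bigD1 k)//= big1 => [|j /negbTE ->]; last by rewrite !mul0r.
  by rewrite !eqxx !mul1r addr0.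
have H2 : \sum_(i < m.+1) \sum_(j < m.+1)
   (i == k)%:R * (j == ord_max)%:R * (u 0 i * v 0 j) = height v * u 0 k.
  rewrite (bigD1 k)//= [X in _ + X]big1 => [|i /negbTE ->]; last first.
    by rewrite big1// => j _; rewrite !mul0r.
  rewrite addr0 (bigD1 ord_max)//= big1 => [|j /negbTE ->]; last by rewrite mulr0 mul0r.
  by rewrite !eqxx !mul1r addr0 mulrC.
have H3 : \sum_(i < m.+1) \sum_(j < m.+1)
   (i == j)%:R * (k == ord_max)%:R * (u 0 i * v 0 j) = dot u v * (k == ord_max)%:R.
  rewrite /dot mulr_suml; apply: eq_bigr => i _.
  rewrite (bigD1 i)//= big1 => [|j /negbTE]; last by rewrite eq_sym => ->; rewrite !mul0r.
  by rewrite eqxx mul1r addr0 mulrC.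
rewrite -H1 -H2 -[X in _ - X]H3 -big_split -sumrB; apply: eq_bigr => i _ /=.
by rewrite -big_split -sumrB; apply: eq_bigr => j _ /=; ring.
Qed.

End Connection.

Section Traces.
Context {R : realType} {m : nat}.
Notation V := 'rV[R]_m.+1.
Implicit Types (u v N : V) (Q Z : 'M[R]_m.+1).

Lemma proj_mul N v : v *m proj N = v - dot v N *: N.
Proof.
rewrite mulmxBr mulmx1 mulmxA; congr (_ - _).
have -> : v *m N^T = (dot v N)%:M by rewrite [LHS]mx11_scalar dot_mul_tr.
by rewrite mul_scalar_mx.
Qed.

Lemma proj_tr N : (proj N)^T = proj N.
Proof. by rewrite /proj linearB/= trmx1 trmx_mul trmxK. Qed.

Lemma proj_normal N : dot N N = 1 -> N *m proj N = 0.
Proof. by move=> N1; rewrite proj_mul N1 scale1r subrr. Qed.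

Lemma proj_idem N : dot N N = 1 -> proj N *m proj N = proj N.
Proof.
move=> N1; rewrite {1}/proj mulmxBl mul1mx -mulmxA proj_normal//.
by rewrite mulmx0 subr0.
Qed.

Lemma trace_proj Z N : dot N N = 1 -> \tr (proj N *m Z *m proj N) = ptrace Z N.
Proof.
move=> N1; rewrite mxtrace_mulC mulmxA proj_idem// /proj mulmxBl mul1mx.
rewrite linearB/= -mulmxA mxtrace_mulC; congr (_ - _).
by rewrite dot_mul_tr [X in \tr X]mx11_scalar mxtrace_scalar.
Qed.

Lemma ptrace_ge0 Z N : dot N N = 1 ->
  (forall u, dot N u = 0 -> 0 <= dot (u *m Z) u) -> 0 <= ptrace Z N.
Proof.
move=> N1 H; rewrite -trace_proj//; apply: sumr_ge0 => i _.
have -> : (proj N *m Z *m proj N) i i = dot (row i (proj N) *m Z) (row i (proj N)).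
  rewrite dot_mul_tr -!row_mul mxE tr_row proj_tr mxE [RHS]mxE.
  by apply: eq_bigr => j _; rewrite !mxE.
apply: H; rewrite dotC rowE proj_mul dotBl dotZl N1 mulr1 subrr//.
Qed.

(** The trace of an operator on the hyperplane orthogonal to [N], computed in a
    basis [B] of it, is the trace of its extension by zero on the line of [N]. *)
Lemma trace_basis (B : 'M[R]_(m, m.+1)) (A : 'M[R]_m) (C : 'M[R]_m.+1) N :
  dot N N = 1 -> row_free B -> (forall u, dot N u = 0 -> (u <= B)%MS) ->
  B *m C = A *m B -> C *m N^T = 0 -> \tr A = \tr C.
Proof.
move=> N1 /row_freeP[B' BB'] sB BC CN.
have /submxP[Y PE] : (proj N <= B)%MS.
  apply/row_subP => i; apply: sB.
  by rewrite dotC rowE proj_mul dotBl dotZl N1 mulr1 subrr.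
have z0 : proj N *m (1%:M - B' *m B) = 0.
  by rewrite PE mulmxBr mulmx1 -mulmxA (mulmxA B) BB' mul1mx subrr.
have cz : C *m (1%:M - B' *m B) = 0.
  have -> : 1%:M - B' *m B = N^T *m (N *m (1%:M - B' *m B)).
    by rewrite mulmxA; apply/eqP; rewrite -subr_eq0 -{1}(mul1mx (1%:M - _)) -mulmxBl z0.
  by rewrite mulmxA CN mul0mx.
rewrite -[A]mulmx1 -BB' mulmxA -BC -mulmxA mxtrace_mulC -mulmxA.
apply/eqP; rewrite eq_sym -subr_eq0 -linearB/= -[X in X - _]mulmx1.
by rewrite -mulmxBr cz mxtrace0.
Qed.

Lemma ptraceD Q Z N : ptrace (Q + Z) N = ptrace Q N + ptrace Z N.
Proof. by rewrite /ptrace linearD/= mulmxDr dotDl; ring. Qed.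

Lemma ptraceZ a Q N : ptrace (a *: Q) N = a * ptrace Q N.
Proof. by rewrite /ptrace linearZ/= -scalemxAr dotZl; ring. Qed.

Lemma ptrace_scalar a N : dot N N = 1 -> ptrace (a%:M) N = m%:R * a.
Proof.
move=> N1; rewrite /ptrace mxtrace_scalar mul_mx_scalar dotZl N1.
by rewrite -mulr_natl mulrSr; ring.
Qed.

Lemma ptrace_rank1 u N : dot N N = 1 ->
  ptrace (u^T *m u) N = dot u u - dot N u ^+ 2.
Proof.
move=> N1; rewrite /ptrace mxtrace_mulC [u *m u^T]mx11_scalar mxtrace_scalar.
rewrite -dot_mul_tr; congr (_ - _).
rewrite mulmxA; have -> : N *m u^T = (dot N u)%:M by rewrite [LHS]mx11_scalar dot_mul_tr.
by rewrite mul_scalar_mx dotZl (dotC u) expr2.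
Qed.

End Traces.

(** * Hypersurfaces as level sets, and the touching inequality *)

(** Both the regularity of the equation and its validity are required on [U] only,
    so that [U] can be shrunk and [f] replaced by its opposite. *)
Definition level_eq {R : realType} {m : nat} (S U : set 'rV[R]_m.+1)
    (f : 'rV[R]_m.+1 -> R) : Prop :=
  [/\ open U, Ck 2 U f, (forall x, U x -> grad f x != 0) &
      forall x, U x -> (S x <-> f x = 0)].

Section Parabolas.
Context {R : realType} {m : nat}.
Notation V := 'rV[R]_m.+1.
Implicit Types (x y p g u d : V) (f : V -> R) (Q : 'M[R]_m.+1).

Lemma parabola_size u d (t eta C : R) : `|t| <= 1 -> `|eta| <= C ->
  dot (u + (t * eta) *: d) (u + (t * eta) *: d) <= 2 * dot u u + 2 * C ^+ 2 * dot d d.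
Proof.
move=> t1 eC; apply: le_trans (dotD_le _ _) _; rewrite lerD2l dotZl dotZr.
rewrite -[leRHS]mulrA ler_wpM2l// mulrA ler_wpM2r ?dot_ge0//.
have C0 : 0 <= C by apply: le_trans eC; exact: normr_ge0.
rewrite -expr2 -real_normK ?num_real// ler_pXn2r ?nnegrE//.
by rewrite normrM -[C]mul1r ler_pM.
Qed.

Lemma near0_norm_lt (e : R) : 0 < e -> \forall t \near (0 : R), `|t| < e.
Proof. by move=> e0; apply: (@cvgr0_norm_lt _ _ _ (nbhs (0:R)) _ id). Qed.

Lemma near0P (A : set R) : (\forall t \near (0 : R), A t) ->
  exists2 s, 0 < s & forall t, `|t| < s -> A t.
Proof.
move=> /nbhs_normP[s/= s0 hs]; exists s => // t ts; apply: hs.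
by rewrite /ball_/= sub0r normrN.
Qed.

Lemma near_parabola p u d (C : R) (A : set V) : nbhs p A ->
  \forall t \near (0 : R), forall eta, `|eta| <= C ->
    A (p + t *: u + (t ^+ 2 * eta) *: d).
Proof.
move=> /near_dotP[r r0 hr].
pose B := 2 * dot u u + 2 * C ^+ 2 * dot d d + 1.
have B0 : 0 < B.
  have h1 := dot_ge0 u.
  have h2 : 0 <= C ^+ 2 * dot d d by rewrite mulr_ge0 ?sqr_ge0 ?dot_ge0.
  by rewrite /B -[2 * C ^+ 2 * _]mulrA; lra.
have e0 : 0 < Num.min 1 (r / B) by rewrite lt_min ltr01 divr_gt0.
near=> t => eta eC; apply: hr.
have t1 : `|t| < Num.min 1 (r / B) by near: t; exact: near0_norm_lt.
have -> : p + t *: u + (t ^+ 2 * eta) *: d - p = t *: (u + (t * eta) *: d).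
  by rewrite scalerDr scalerA mulrA -expr2; apply/rowP => i; rewrite !mxE; ring.
move: t1; rewrite lt_min => /andP[t1 t2].
rewrite dotZl dotZr mulrA.
have h1 := parabola_size u d (ltW t1) eC.
have h2 : t * t <= `|t|.
  by rewrite -expr2 -real_normK ?num_real// expr2 ler_piMl// ltW.
apply: le_lt_trans (_ : `|t| * B < r); last by rewrite -ltr_pdivlMr.
rewrite ler_pM ?dot_ge0//; first by rewrite -expr2 sqr_ge0.
by rewrite /B; lra.
Unshelve. all: by end_near. Qed.

(** Second order expansion along the parabolas [p + t u + t^2 eta d], uniformly
    in the parameter [eta]. *)
Lemma taylor_parabola f p g Q u d (C e : R) : taylor2 f p g Q -> 0 < e ->
  \forall t \near (0 : R), forall eta, `|eta| <= C ->
    `|f (p + t *: u + (t ^+ 2 * eta) *: d) - f p - t * dot g u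
      - t ^+ 2 * (eta * dot g d + 2^-1 * dot (u *m Q) u)| <= e * t ^+ 2.
Proof.
move=> tay e0.
pose B := 2 * dot u u + 2 * C ^+ 2 * dot d d + 1.
have B0 : 0 < B.
  have h1 := dot_ge0 u.
  have h2 : 0 <= C ^+ 2 * dot d d by rewrite mulr_ge0 ?sqr_ge0 ?dot_ge0.
  by rewrite /B -[2 * C ^+ 2 * _]mulrA; lra.
have eB : 0 < e / (2 * B) by rewrite divr_gt0// mulr_gt0.
have near_p := near_parabola u d C (tay _ eB).
pose a := 2^-1 * (dot (d *m Q) u + dot (u *m Q) d).
pose b := 2^-1 * dot (d *m Q) d.
pose M := `|C| * `|a| + C ^+ 2 * `|b| + 1.
have M0 : 0 < M by rewrite ltr_wpDl// addr_ge0// mulr_ge0 ?sqr_ge0.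
have d0 : 0 < Num.min 1 (e / (2 * M)) by rewrite lt_min ltr01 divr_gt0// mulr_gt0.
move: near_p (near0_norm_lt d0); apply: filterS2 => t H t1 eta eC.
have := H _ eC; set w := u + (t * eta) *: d; set X := f _ - f p.
have -> : p + t *: u + (t ^+ 2 * eta) *: d - p = t *: w.
  by rewrite scalerDr scalerA mulrA -expr2; apply/rowP => i; rewrite !mxE; ring.
move: t1; rewrite lt_min => /andP[t1 t2].
have wB : dot w w <= B.
  by apply: le_trans (parabola_size u d (ltW t1) eC) _; rewrite /B; lra.
have -> : X - dot g (t *: w) - 2^-1 * dot (t *: w *m Q) (t *: w) =
  (X - t * dot g u - t ^+ 2 * (eta * dot g d + 2^-1 * dot (u *m Q) u))
   - t ^+ 2 * (t * eta * a + (t * eta) ^+ 2 * b).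
  by rewrite /w /a /b -!scalemxAl !mulmxDl -!scalemxAl !dotE; ring.
set T := X - _ - _ => H1.
have tt : t ^+ 2 <= `|t|.
  by rewrite -real_normK ?num_real// expr2 ler_piMl// ltW.
have t20 : 0 <= t ^+ 2 by exact: sqr_ge0.
have H2 : `|t * eta * a + (t * eta) ^+ 2 * b| <= e / 2.
  apply: le_trans (_ : `|t| * M <= _); last first.
    apply: ltW; move: t2; rewrite ltr_pdivlMr ?mulr_gt0//; lra.
  apply: le_trans (ler_normD _ _) _; rewrite (normrM (t * eta) a) (normrM _ b) normrX (normrM t eta) exprMn.
  have C0 : `|eta| <= `|C| by apply: le_trans eC _; exact: ler_norm.
  have CE : C ^+ 2 = `|C| ^+ 2 by rewrite real_normK ?num_real.
  rewrite /M CE !mulrDr mulr1 -!mulrA.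
  have i1 : `|t| * (`|eta| * `|a|) <= `|t| * (`|C| * `|a|).
    by rewrite ler_wpM2l// ler_wpM2r.
  have i2 : `|t| ^+ 2 * (`|eta| ^+ 2 * `|b|) <= `|t| * (`|C| ^+ 2 * `|b|).
    rewrite (real_normK (num_real t)); apply: ler_pM => //.
    by rewrite ler_wpM2r// ler_pXn2r ?nnegrE.
  by have := normr_ge0 t; lra.
have H3 : `|t ^+ 2 * (t * eta * a + (t * eta) ^+ 2 * b)| <= t ^+ 2 * (e / 2).
  by rewrite normrM (ger0_norm t20) ler_wpM2l.
have H4 : e / (2 * B) * dot (t *: w) (t *: w) <= t ^+ 2 * (e / 2).
  rewrite dotZl dotZr.
  have -> : e / (2 * B) * (t * (t * dot w w)) = t ^+ 2 * (e / 2) * (dot w w / B).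
    by field; rewrite gt_eqF.
  apply: ler_piMr; first by rewrite mulr_ge0// divr_ge0// ltW.
  by rewrite ler_pdivrMr// mul1r.
rewrite -(subrK (t ^+ 2 * (t * eta * a + (t * eta) ^+ 2 * b)) T).
by apply: le_trans (ler_normD _ _) _; lra.
Qed.

(** The solutions of [f = 0] near [p] over the tangent direction [u]: moving
    from [p + t u] along the gradient, the intermediate value theorem gives one
    at a height between [(kappa - e) t^2] and [(kappa + e) t^2], where [kappa] is
    the height of the osculating parabola. *)
Lemma level_parabola f p g Q u (e : R) : taylor2 f p g Q -> g != 0 -> f p = 0 ->
  (\forall x \near p, {for x, continuous f}) -> dot g u = 0 -> 0 < e ->
  \forall t \near (0 : R), exists2 eta,
    `|eta + (2 * dot g g)^-1 * dot (u *m Q) u| <= e &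
    f (p + t *: u + (t ^+ 2 * eta) *: g) = 0.
Proof.
move=> tay g0 fp fc gu e0.
have a0 : 0 < dot g g by rewrite dot_gt0.
pose k := - ((2 * dot g g)^-1 * dot (u *m Q) u).
pose C := `|k| + e.
have e1 : 0 < e * dot g g / 2 by rewrite divr_gt0// mulr_gt0.
move: (taylor_parabola u g C tay e1) (near_parabola u g C fc); apply: filterS2.
move=> t H cont.
have inC s : `|s| <= e -> `|k + s| <= C.
  by move=> se; apply: le_trans (ler_normD _ _) _; rewrite lerD2l.
pose F (s : R) := f (p + t *: u + (t ^+ 2 * (k + s)) *: g).
have FE s : `|s| <= e -> `|F s - t ^+ 2 * (s * dot g g)| <= e * dot g g / 2 * t ^+ 2.
  move=> se; have := H _ (inC _ se); rewrite gu fp mulr0 !subr0 -/(F s).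
  have -> // : (k + s) * dot g g + 2^-1 * dot (u *m Q) u = s * dot g g.
  by rewrite /k; field; rewrite gt_eqF.
have t20 : 0 <= t ^+ 2 by exact: sqr_ge0.
have ee : `|e| <= e by rewrite ger0_norm// ltW.
have Fp : 0 <= F e.
  have := FE e ee; rewrite ler_norml => /andP[H1 _].
  have : 0 <= t ^+ 2 * (e * dot g g) by rewrite mulr_ge0// mulr_ge0// ltW.
  move: H1; lra.
have Fm : F (- e) <= 0.
  have := FE (- e); rewrite normrN => /(_ ee); rewrite ler_norml => /andP[_ H1].
  have : 0 <= t ^+ 2 * (e * dot g g) by rewrite mulr_ge0// mulr_ge0// ltW.
  move: H1; lra.
have Fc : {within `[- e, e], continuous F}.
  apply: continuous_in_subspaceT => s; rewrite inE/= in_itv/= => se.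
  have gc : {for s, continuous (fun s : R => p + t *: u + (t ^+ 2 * (k + s)) *: g)}.
    apply: (@is_derive_continuous R _ _ _ (t ^+ 2 *: g)).
    apply: is_derive_coordP => i.
    have -> : (fun s0 : R => (p + t *: u + (t ^+ 2 * (k + s0)) *: g) 0 i) =
       (fun s0 : R => (p + t *: u) 0 i + (t ^+ 2 * g 0 i) * (k + s0)).
      by apply/funext => z; rewrite !mxE; ring.
    apply: is_derive_eq; rewrite !mxE /GRing.scale/=; ring.
  apply: (continuous_comp gc); apply: cont; apply: inC; rewrite ler_norml; exact: se.
have Fv : Num.min (F (- e)) (F e) <= 0 <= Num.max (F (- e)) (F e).
  by rewrite ge_min le_max Fp Fm orbT.
have [s + Fs] := IVT (ge0_cp (ltW e0)).2 Fc Fv.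
rewrite in_itv/= => se; exists (k + s) => //.
by rewrite /k addrAC addNr add0r ler_norml.
Qed.

End Parabolas.

Section Tangent.
Context {R : realType} {m : nat}.
Notation V := 'rV[R]_m.+1.
Implicit Types (x y p g u d : V) (f : V -> R) (Q : 'M[R]_m.+1) (S U : set V).

Lemma level_eq_C1 S U f : level_eq S U f -> Ck 1 U f.
Proof. by case=> oU fC _ _; exact: C2_C1 fC. Qed.

Lemma level_eq_near S U f p : level_eq S U f -> U p -> nbhs p U.
Proof. by move=> [oU _ _ _] Up; exact: open_nbhs_nbhs. Qed.

Lemma level_eq_continuous S U f p : level_eq S U f -> U p ->
  \forall x \near p, {for x, continuous f}.
Proof.
move=> lS Up; have [oU _ _ _] := lS.
apply: filterS (level_eq_near lS Up) => x Ux.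
exact: (C1_continuous oU (level_eq_C1 lS)).
Qed.

Lemma level_eq_taylor S U f p : level_eq S U f -> U p ->
  taylor2 f p (grad f p) (hess f p).
Proof. by move=> [oU fC _ _] Up; exact: C2_taylor fC Up. Qed.

Lemma level_eq_parabola S U f p u (e : R) : level_eq S U f -> U p -> S p ->
  dot (grad f p) u = 0 -> 0 < e ->
  \forall t \near (0 : R), exists2 eta,
    `|eta + (2 * dot (grad f p) (grad f p))^-1 * dot (u *m hess f p) u| <= e &
    S (p + t *: u + (t ^+ 2 * eta) *: grad f p).
Proof.
move=> lS Up Sp gu e0; have [_ _ gn SU] := lS.
have H := level_parabola (level_eq_taylor lS Up) (gn _ Up) ((SU _ Up).1 Sp)
  (level_eq_continuous lS Up) gu e0.
have := near_parabola u (grad f p)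
  (e + `|(2 * dot (grad f p) (grad f p))^-1 * dot (u *m hess f p) u|)
  (level_eq_near lS Up).
move: H; apply: filterS2 => t [eta He fx] UU; exists eta => //.
apply/SU => //; apply: UU.
rewrite -[eta](addrK ((2 * dot (grad f p) (grad f p))^-1 * dot (u *m hess f p) u)).
by apply: le_trans (ler_normB _ _) _; rewrite lerD2r.
Qed.

Lemma is_derive_parabola (s : R -> R) p u g (C : R) :
  (\forall t \near (0 : R), `|s t| <= C) ->
  is_derive (0 : R) 1 (fun t => p + t *: u + (t ^+ 2 * s t) *: g) u.
Proof.
move=> sC.
have ds : is_derive (0 : R) 1 (fun t => t ^+ 2 * s t) 0.
  suff H : (fun h : R => h^-1 *: (((fun t => t ^+ 2 * s t) \o shift 0) (h *: 1)
      - (fun t => t ^+ 2 * s t) 0)) @ 0^' --> (0 : R).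
    by apply: DeriveDef; [apply/cvg_ex; exists 0|exact/cvg_lim].
  have C0 : 0 <= C.
    by have /nbhs_singleton := sC; apply: le_trans; exact: normr_ge0.
  apply/cvgrPdist_lt => e e0.
  have eC : 0 < e / (C + 1) by rewrite divr_gt0//; lra.
  near=> h.
  have h0 : h != 0 by near: h; exact: nbhs_dnbhs_neq.
  have h1 : `|h| < e / (C + 1) by near: h; exact: dnbhs0_lt.
  have h2 : `|s h| <= C by near: h; exact: cvg_within sC.
  rewrite /= addr0 [_%:A]mulr1 expr0n mul0r subr0 sub0r normrN.
  have -> : h^-1 *: (h ^+ 2 * s h) = h * s h by rewrite /GRing.scale/=; field.
  rewrite normrM; apply: le_lt_trans (_ : `|h| * (C + 1) < e).
    by rewrite ler_wpM2l//; lra.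
  by rewrite -ltr_pdivlMr//; lra.
apply: is_derive_coordP => i.
have -> : (fun t : R => (p + t *: u + (t ^+ 2 * s t) *: g) 0 i) =
   (fun t : R => p 0 i + u 0 i * t + g 0 i * (t ^+ 2 * s t)).
  by apply/funext => z; rewrite !mxE; ring.
have dg := is_deriveZ (g 0 i) ds.
have du := is_deriveD (is_derive_cst (p 0 i) (0 : R) (1 : R))
   (is_deriveZ (u 0 i) (is_derive_id (0 : R) (1 : R))).
have [H1 H2] := is_deriveD du dg.
apply: DeriveDef; first exact: H1.
by rewrite [LHS]H2 /GRing.scale/=; ring.
Unshelve. all: by end_near. Qed.

(** A vector orthogonal to the gradient is the velocity of a curve which follows
    the parabolas of [level_eq_parabola]. *)
Lemma tangent_levelP S U f p u : level_eq S U f -> U p -> S p ->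
  tangent S p u <-> dot (grad f p) u = 0.
Proof.
move=> lS Up Sp; have [oU fC gn SU] := lS; split.
  move=> [c [c0 cS cd]].
  have cc := is_derive_continuous cd.
  have cU : \forall t \near (0 : R), U (c t).
    by apply: cc; rewrite c0; exact: (level_eq_near lS Up).
  have Uc : U (c 0) by rewrite c0.
  have H := is_derive_C1_comp oU (level_eq_C1 lS) Uc cd.
  have E : \forall t \near (0 : R), (f \o c) t = cst 0 t.
    by move: cS cU; apply: filterS2 => t St Ut; apply/SU.
  have [_ H1] := near_eq_is_derive E H.
  by rewrite -[in LHS]c0 -H1 derive_cst.
move=> gu.
have H := level_eq_parabola lS Up Sp gu ltr01.
pose k := (2 * dot (grad f p) (grad f p))^-1 * dot (u *m hess f p) u.
pose A (t : R) : set R := [set eta | `|eta + k| <= 1 /\ S (p + t *: u + (t ^+ 2 * eta) *: grad f p)].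
pose s t := xget (- k) (A t).
have sP : \forall t \near (0 : R), `|s t + k| <= 1 /\ S (p + t *: u + (t ^+ 2 * s t) *: grad f p).
  apply: filterS H => t [eta h1 h2].
  by have : A t (s t) by apply: xgetPex; exists eta.
exists (fun t => p + t *: u + (t ^+ 2 * s t) *: grad f p); split.
- by rewrite scale0r expr0n mul0r scale0r !addr0.
- by apply: filterS sP => t [].
- apply: (@is_derive_parabola _ _ _ _ (1 + `|k|)).
  apply: filterS sP => t [+ _] => h.
  by rewrite -(addrK k (s t)); apply: le_trans (ler_normB _ _) _; rewrite lerD2r.
Qed.

End Tangent.

(** Unit vectors of the halfspace metric at [p] have Euclidean length [height p];
    this is the Euclidean unit normal. *)
Definition enormal {R : realType} {m : nat} (nu : 'rV[R]_m.+1 -> 'rV[R]_m.+1)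
    (p : 'rV[R]_m.+1) : 'rV[R]_m.+1 := (height p)^-1 *: nu p.

Section Touching.
Context {R : realType} {m : nat}.
Notation V := 'rV[R]_m.+1.
Implicit Types (x y p g u v w d : V) (f : V -> R) (Q : 'M[R]_m.+1) (S U : set V)
  (nu : V -> V).

Lemma enormal_unit S nu p : unit_normal S nu -> S p -> 0 < height p ->
  dot (enormal nu p) (enormal nu p) = 1.
Proof.
move=> [_ H] /H [+ _] hp; rewrite hmetricE /enormal dotZl dotZr => E.
by rewrite -[RHS]E; field; rewrite gt_eqF.
Qed.

Lemma unit_normal_orth S U f nu p u : level_eq S U f -> U p -> S p ->
  0 < height p -> unit_normal S nu -> dot (grad f p) u = 0 -> dot (nu p) u = 0.
Proof.
move=> lS Up Sp hp [_ H] gu; have [_ /(_ u)] := H _ Sp.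
move=> /(_ ((tangent_levelP u lS Up Sp).2 gu)); rewrite hmetricE => /eqP.
by rewrite mulf_eq0 invr_eq0 expf_eq0/= [height p == 0]gt_eqF// orbF => /eqP.
Qed.

Lemma orth_parallel g v : (forall u, dot g u = 0 -> dot v u = 0) ->
  dot g g *: v = dot v g *: g.
Proof.
move=> H; pose u := dot g g *: v - dot v g *: g.
have gu : dot g u = 0 by rewrite /u !dotE (dotC v g); ring.
have : dot u u = 0 by rewrite {1}/u dotBl !dotZl gu (H _ gu) !mulr0 subrr.
by move/eqP; rewrite dot_eq0 subr_eq0 => /eqP.
Qed.

Lemma unit_normal_parallel S U f nu p : level_eq S U f -> U p -> S p ->
  0 < height p -> unit_normal S nu ->
  dot (grad f p) (grad f p) *: nu p = dot (nu p) (grad f p) *: grad f p.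
Proof.
move=> lS Up Sp hp hnu; apply: orth_parallel => u.
exact: unit_normal_orth lS Up Sp hp hnu.
Qed.

Lemma grad_enormal S U f nu p : level_eq S U f -> U p -> S p ->
  0 < height p -> unit_normal S nu ->
  grad f p = dot (grad f p) (enormal nu p) *: enormal nu p /\
  dot (grad f p) (enormal nu p) != 0.
Proof.
move=> lS Up Sp hp hnu; have [_ _ gn _] := lS.
have N1 := enormal_unit hnu Sp hp.
have par : dot (grad f p) (grad f p) *: enormal nu p =
    dot (enormal nu p) (grad f p) *: grad f p.
  rewrite /enormal scalerA mulrC -scalerA (unit_normal_parallel lS Up Sp hp hnu).
  by rewrite scalerA dotZl.
move: (enormal nu p) N1 par => N N1 par.
have gg : dot (grad f p) (grad f p) = dot (grad f p) N ^+ 2.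
  have := congr1 (dot N) par; rewrite !dotZr N1 mulr1 => ->.
  by rewrite dotC -expr2.
have n0 : dot (grad f p) N != 0.
  by rewrite -sqrf_eq0 -gg dot_eq0 gn.
split=> //; apply: (scalerI n0).
by rewrite scalerA -expr2 -gg par dotC.
Qed.

Lemma is_derive_grad U f (c : R -> V) u : open U -> Ck 2 U f -> U (c 0) ->
  is_derive (0 : R) 1 c u ->
  is_derive (0 : R) 1 (grad f \o c) (u *m hess f (c 0)).
Proof.
move=> oU fC Uc cd; apply: is_derive_coordP => i.
have -> : (u *m hess f (c 0)) 0 i = dot (grad ('D_(delta_mx 0 i) f) (c 0)) u.
  by rewrite mxE dotC; apply: eq_bigr => j _; rewrite !mxE.
have -> : (fun s => (grad f \o c) s 0 i) = 'D_(delta_mx 0 i) f \o c.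
  by apply/funext => s; rewrite /= mxE.
exact: (is_derive_C1_comp oU (fC.2 (delta_mx 0 i)) Uc cd).
Qed.

(** The shape operator of a level set is the projection of minus its Euclidean
    Hessian, suitably scaled, plus a multiple of the identity which comes from
    the Christoffel symbols of the halfspace metric. The formula is obtained by
    differentiating the identity [|grad f|^2 nu = (nu . grad f) grad f]. *)
Lemma shape_level S U f nu p u w v : level_eq S U f -> U p -> S p ->
  0 < height p -> unit_normal S nu -> is_shape S nu p u w ->
  dot (grad f p) v = 0 ->
  dot w v = - (dot (nu p) (grad f p) / dot (grad f p) (grad f p))
     * dot (u *m hess f p) v + height (enormal nu p) * dot u v.
Proof.
move=> lS Up Sp hp hnu [c [dnu [[c0 cS cd] dn ->]]] gv.
have [oU fC gn SU] := lS.
have Sx x : S x -> U x -> dot (nu x) v * dot (grad f x) (grad f x) =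
    dot (nu x) (grad f x) * dot (grad f x) v \/ ~ 0 < height x.
  move=> Sx Ux; have [hx|] := pselect (0 < height x); [left|by right].
  by rewrite [LHS]mulrC -[LHS]dotZl (unit_normal_parallel lS Ux Sx hx hnu) [LHS]dotZl.
have uN : dot (nu p) u = 0.
  apply: (unit_normal_orth lS Up Sp hp hnu); apply/(tangent_levelP u lS Up Sp).
  by exists c.
have nv : dot (nu p) v = 0 by exact: (unit_normal_orth lS Up Sp hp hnu gv).
have Uc : U (c 0) by rewrite c0.
have dg := is_derive_grad oU fC Uc cd; rewrite c0 in dg.
have dcst := is_derive_cst v (0 : R) (1 : R).
have d1 := is_deriveM (is_derive_dot dn dcst) (is_derive_dot dg dg).
have d2 := is_deriveM (is_derive_dot dn dg) (is_derive_dot dg dcst).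
have cc := is_derive_continuous cd.
have cU : \forall t \near (0 : R), U (c t).
  by apply: cc; rewrite c0; exact: (level_eq_near lS Up).
have ch : \forall t \near (0 : R), 0 < height (c t).
  have dh := is_derive_continuous (is_derive_coord ord_max cd).
  have hp0 : 0 < c 0 0 ord_max by rewrite c0.
  have /cvgrPdist_lt/(_ _ hp0) := dh; apply: filterS => t; rewrite ltr_norml.
  rewrite /height; lra.
have E : \forall t \near (0 : R),
   ((fun s => dot ((nu \o c) s) (cst v s)) * (fun s => dot ((grad f \o c) s) ((grad f \o c) s))) t =
   ((fun s => dot ((nu \o c) s) ((grad f \o c) s)) * (fun s => dot ((grad f \o c) s) (cst v s))) t.
  move: cS cU ch; apply: filterS3 => t St Ut ht.
  by have [//|] := Sx _ St Ut.
have [_ e1] := near_eq_is_derive E d1.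
have [_ e2] := d2; rewrite {}e2 in e1.
have hp0 : height p != 0 by rewrite gt_eqF.
have g0 : dot (grad f p) (grad f p) != 0 by rewrite dot_eq0 gn.
rewrite connection_formE// (dotC u (nu p)) uN scale0r subr0.
have {}e1 : dot (nu p) (grad f p) * dot (u *m hess f p) v =
    dot (grad f p) (grad f p) * dot dnu v.
  move: e1; rewrite /= /cst !c0 nv gv !dot0r !scale0r !addr0 !add0r.
  exact.
rewrite !dotE nv /enormal /height mxE -/(height p) -/(height (nu p)).
have -> : dot dnu v = dot (nu p) (grad f p) * dot (u *m hess f p) v / dot (grad f p) (grad f p).
  by rewrite e1 mulrC mulKf.
field; by rewrite hp0 g0.
Qed.

(** The normal component of the level set equation: its mean curvature is a
    multiple of the Euclidean trace of the Hessian of [f] along the tangent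
    hyperplane, plus the vertical component of the normal. *)
Lemma mean_curvature_level S U f nu p (h : R) : (0 < m)%N ->
  level_eq S U f -> U p -> S p -> 0 < height p -> unit_normal S nu ->
  is_mean_curvature S nu p h ->
  m%:R * (height (enormal nu p) - h) =
  dot (nu p) (grad f p) / dot (grad f p) (grad f p)
    * ptrace (hess f p) (enormal nu p).
Proof.
move=> m0 lS Up Sp hp hnu [B [A [rB tB sB ->]]].
set N := enormal nu p; set g := grad f p; set Q := hess f p.
have N1 : dot N N = 1 by exact: (enormal_unit hnu Sp hp).
have [gN gN0] := grad_enormal lS Up Sp hp hnu; rewrite -/N -/g in gN gN0.
have perp u : dot N u = 0 <-> dot g u = 0.
  rewrite gN dotZl; split=> [->|/eqP]; first by rewrite mulr0.
  by rewrite mulf_eq0 (negbTE gN0) => /eqP.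
have tanP u : (u <= B)%MS <-> dot N u = 0.
  by rewrite -tB (tangent_levelP u lS Up Sp) perp.
pose a := - (dot (nu p) g / dot g g).
pose Z : 'M[R]_m.+1 := a *: Q + (height N)%:M.
pose C := proj N *m Z *m proj N.
have PNt : proj N *m N^T = 0.
  by apply: trmx_inj; rewrite trmx_mul trmxK proj_tr proj_normal// trmx0.
have BC : B *m C = A *m B.
  apply/row_matrixP => i.
  have uN : dot N (row i B) = 0 by apply/tanP; exact: row_sub.
  have wN : dot N (row i (A *m B)) = 0.
    by apply/tanP; rewrite row_mul; exact: submxMl.
  have uP : row i B *m proj N = row i B by rewrite proj_mul dotC uN scale0r subr0.
  rewrite row_mul /C !mulmxA uP; apply/eqP; rewrite -subr_eq0 -dot_eq0.
  set d := _ - _; have dN : dot N d = 0.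
    by rewrite dotBr wN dotC dot_mulmx proj_tr proj_normal// dot0r subrr.
  have dP : d *m proj N = d by rewrite proj_mul dotC dN scale0r subr0.
  have gd : dot g d = 0 by apply/perp.
  rewrite {1}/d dotBl dot_mulmx proj_tr dP.
  rewrite (shape_level lS Up Sp hp hnu (sB i) gd) -/N -/g -/Q.
  rewrite mulmxDr -scalemxAr mul_mx_scalar dotDl !dotZl /a.
  by rewrite subrr.
have CN : C *m N^T = 0 by rewrite /C -mulmxA PNt mulmx0.
have trA := trace_basis N1 rB (fun u => (tanP u).2) BC CN.
have m1 : m%:R != 0 :> R by rewrite pnatr_eq0 -lt0n.
have g0 : dot g g != 0 by rewrite gN dotZl dotZr N1 mulr1 mulf_neq0.
rewrite trA trace_proj// ptraceD ptraceZ ptrace_scalar// /a.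
by field; rewrite m1 g0.
Qed.

(** The curve of [S] with velocity [u] bends along [grad f], by the amount which
    cancels the second order term of [f]; the expansion of [Phi] along it has no
    first order term and a nonnegative second order term. *)
Lemma second_order_touching S U f p G Q (Phi : V -> R) : level_eq S U f -> U p ->
  S p -> taylor2 Phi p G Q -> (\forall x \near p, S x -> Phi p <= Phi x) ->
  forall u, dot (grad f p) u = 0 -> dot G u = 0 /\
   0 <= dot (u *m Q) u
     - dot G (grad f p) / dot (grad f p) (grad f p) * dot (u *m hess f p) u.
Proof.
move=> lS Up Sp tay mn u gu; set g := grad f p; have [_ _ gn _] := lS.
have g0 : 0 < dot g g by rewrite dot_gt0 gn.
set k := (2 * dot g g)^-1 * dot (u *m hess f p) u.
pose q := - k * dot G g + 2^-1 * dot (u *m Q) u.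
(* along the parabola of S with velocity u, Phi grows like t G.u + t^2 q *)
have key (e : R) : 0 < e -> \forall t \near (0 : R),
    0 <= t * dot G u + t ^+ 2 * (q + e).
  move=> e0.
  pose e1 := Num.min 1 (e / (2 * (`|dot G g| + 1))).
  have G1 : 0 < `|dot G g| + 1 by rewrite ltr_wpDl.
  have e10 : 0 < e1 by rewrite lt_min ltr01 divr_gt0// mulr_gt0.
  have e1G : e1 * `|dot G g| <= e / 2.
    apply: le_trans (_ : e1 * (`|dot G g| + 1) <= _).
      by rewrite ler_wpM2l ?(ltW e10)//; lra.
    rewrite -ler_pdivlMr//; apply: le_trans (_ : e / (2 * (`|dot G g| + 1)) <= _).
      by rewrite ge_min lexx orbT.
    by rewrite invfM mulrA.
  have h1 := level_eq_parabola lS Up Sp gu e10.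
  have e20 : 0 < e / 2 by rewrite divr_gt0.
  have h2 := taylor_parabola u g (`|k| + 1) tay e20.
  have h3 := near_parabola u g (`|k| + 1) mn.
  move: h1 h2 h3; apply: filterS3 => t [eta he hS] H2 H3.
  have etaC : `|eta| <= `|k| + 1.
    rewrite -(addrK k eta); apply: le_trans (ler_normB _ _) _.
    by rewrite addrC lerD2l; apply: le_trans he _; rewrite ge_min lexx.
  have P1 := H3 _ etaC hS.
  have := H2 _ etaC; rewrite ler_norml => /andP[_ P2].
  have P3 : (eta + k) * dot G g <= e / 2.
    apply: le_trans (ler_norm _) _; rewrite normrM.
    by apply: le_trans e1G; rewrite ler_wpM2r.
  have t20 : 0 <= t ^+ 2 by exact: sqr_ge0.
  have P4 : t ^+ 2 * ((eta + k) * dot G g) <= t ^+ 2 * (e / 2) by rewrite ler_wpM2l.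
  have -> : t * dot G u + t ^+ 2 * (q + e) =
    (t * dot G u + t ^+ 2 * (eta * dot G g + 2^-1 * dot (u *m Q) u) + e / 2 * t ^+ 2)
    + (t ^+ 2 * (e / 2) - t ^+ 2 * ((eta + k) * dot G g)).
    by rewrite /q; field.
  lra.
have Gu : dot G u = 0.
  have /near0P[s s0 hs] : \forall t \near (0 : R), 0 <= t * dot G u + t ^+ 2 * (q + 1).
    exact: key ltr01.
  pose M := `|q + 1| + 1.
  have M0 : 0 < M by rewrite ltr_wpDl.
  apply/eqP; rewrite -normr_le0; apply/ler_addgt0Pl => e e0; rewrite addr0.
  pose t := Num.min (s / 2) (e / M).
  have t0 : 0 < t by rewrite lt_min !divr_gt0.
  have ts : t < s by apply: le_lt_trans (_ : s / 2 < s); [rewrite ge_min lexx|lra].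
  have tM : t * M <= e by rewrite -ler_pdivlMr// ge_min lexx orbT.
  have h1 := hs t; have h2 := hs (- t); rewrite normrN (gtr0_norm t0) in h1 h2.
  have {}h1 := h1 ts; have {}h2 := h2 ts.
  have qM : t * (q + 1) <= t * M.
    by rewrite ler_wpM2l ?(ltW t0)// /M; have := ler_norm (q + 1); lra.
  rewrite ler_norml.
  move: h1 h2; rewrite sqrrN expr2 -!mulrA -mulrDr mulNr -mulrN -mulrDr !pmulr_rge0//.
  lra.
split=> //.
have q0 : 0 <= q.
  apply/ler_addgt0Pl => e /key; rewrite Gu => /near0P[s s0 hs].
  have s2 : 0 < s / 2 by rewrite divr_gt0.
  have := hs (s / 2); rewrite gtr0_norm// mulr0 add0r pmulr_rge0 ?exprn_gt0//.
  by rewrite addrC; apply; lra.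
have -> : dot (u *m Q) u - dot G g / dot g g * dot (u *m hess f p) u = 2 * q.
  by rewrite /q /k; field; rewrite gt_eqF.
by rewrite mulr_ge0.
Qed.

(** The analytic core of the argument: at a point where a function [Phi]
    restricted to the hypersurface is minimal, its gradient is normal, and the
    trace of its Hessian on the tangent hyperplane is bounded below in terms of
    the mean curvature. Both the level set equation and the multiplier of the
    constrained minimum are eliminated. *)
Lemma touching S U f nu p (h : R) G Q (Phi : V -> R) : (0 < m)%N ->
  level_eq S U f -> U p -> S p -> 0 < height p -> unit_normal S nu ->
  is_mean_curvature S nu p h ->
  taylor2 Phi p G Q -> (\forall x \near p, S x -> Phi p <= Phi x) ->
  G = dot G (enormal nu p) *: enormal nu p /\
  m%:R * dot G (enormal nu p) * (height (enormal nu p) - h) / height p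
    <= ptrace Q (enormal nu p).
Proof.
move=> m0 lS Up Sp hp hnu hc tay mn.
have H := second_order_touching lS Up Sp tay mn.
have E := mean_curvature_level m0 lS Up Sp hp hnu hc.
set N := enormal nu p in E *.
have N1 : dot N N = 1 by exact: (enormal_unit hnu Sp hp).
have [gN gN0] := grad_enormal lS Up Sp hp hnu; rewrite -/N in gN gN0.
set c := dot (grad f p) N in gN gN0.
have perp u : dot N u = 0 -> dot (grad f p) u = 0 by rewrite gN dotZl => ->; rewrite mulr0.
split.
  have := @orth_parallel N G (fun u Nu => (H _ (perp _ Nu)).1).
  by rewrite N1 scale1r.
have := @ptrace_ge0 _ _ (Q - (dot G (grad f p) / dot (grad f p) (grad f p)) *: hess f p) N N1.
move=> /(_ _)/le_trans => P.
have {P} : 0 <= ptrace (Q - (dot G (grad f p) / dot (grad f p) (grad f p)) *: hess f p) N.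
  apply: ptrace_ge0 => // u Nu; rewrite mulmxBr -scalemxAr dotBl dotZl.
  exact: (H _ (perp _ Nu)).2.
rewrite -scaleNr ptraceD ptraceZ mulNr subr_ge0; apply: le_trans.
have nuE : nu p = height p *: N by rewrite /N /enormal scalerA divff ?gt_eqF// scale1r.
have -> : dot G (grad f p) / dot (grad f p) (grad f p) * ptrace (hess f p) N =
   dot G N / height p * (dot (nu p) (grad f p) / dot (grad f p) (grad f p) * ptrace (hess f p) N).
  clearbody N; rewrite nuE gN !dotE N1; field.
  by rewrite gN0 gt_eqF.
by rewrite -E le_eqVlt; apply/orP; left; apply/eqP; ring.
Qed.

End Touching.

(** * Local position of a hypersurface relative to a quadric *)

Definition quad {R : realType} {m : nat} (al : R) (b : 'rV[R]_m.+1) (ga : R)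
    (x : 'rV[R]_m.+1) : R :=
  al * dot x x + dot b x + ga.

Section CkFacts.
Context {R : realType} {m : nat}.
Notation V := 'rV[R]_m.+1.
Implicit Types (x y p g u v w : V) (f : V -> R) (U : set V).

Lemma Ck_eq k U (f g : V -> R) : open U -> (forall x, U x -> f x = g x) ->
  Ck k U f -> Ck k U g.
Proof.
move=> oU; elim: k f g => [|k IH] f g fg.
  have near_eq (x : V) : U x -> \forall y \near x, f y = g y.
    by move=> Ux; apply: filterS (open_nbhs_nbhs (conj oU Ux)).
  move=> fc; suff H (x : V) : U x -> {for x, continuous g} by move=> x /H.
  move=> Ux; apply/continuous_epsP => e e0.
  have /continuous_epsP/(_ _ e0) : {for x, continuous f} by exact: fc.
  move: (near_eq _ Ux); apply: filterS2 => y <-.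
  by rewrite -(fg _ Ux).
have near_eq (x : V) : U x -> \forall y \near x, f y = g y.
  by move=> Ux; apply: filterS (open_nbhs_nbhs (conj oU Ux)).
move=> [fd fc]; split.
  by move=> x v Ux; apply: (near_eq_derivable (near_eq _ Ux)); exact: fd.
move=> v; apply: (IH _ _ _ (fc v)) => x Ux /=.
exact: (near_eq_derive _ (near_eq _ Ux)).
Qed.

Lemma Ck_opp k U f : open U -> Ck k U f -> Ck k U (fun x => - f x).
Proof.
move=> oU; elim: k f => [|k IH] f.
  by move=> fc x Ux; apply: (@cvgN _ _ _ (nbhs x)); exact: fc.
move=> [fd fc]; split=> [x v Ux|v].
  by apply: derivableN; exact: fd.
have := IH _ (fc v); apply: Ck_eq => // x Ux /=.
by rewrite [RHS]deriveN//; exact: fd.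
Qed.

Lemma grad_opp U f x : Ck 1 U f -> U x -> grad (fun x => - f x) x = - grad f x.
Proof.
move=> [fd _] Ux; apply/rowP => i; rewrite !mxE.
by rewrite [LHS]deriveN//; exact: fd.
Qed.

Lemma level_eq_opp S U f : level_eq S U f -> level_eq S U (fun x => - f x).
Proof.
move=> lS; have [oU fC gn SU] := lS; split.
- exact: oU.
- exact: Ck_opp oU fC.
- by move=> x Ux; rewrite (grad_opp (level_eq_C1 lS) Ux) oppr_eq0; exact: gn.
- move=> x Ux; rewrite SU//; split=> [->|/eqP]; rewrite ?oppr0//.
  by rewrite oppr_eq0 => /eqP.
Qed.

Lemma level_eq_sub S U W f : level_eq S U f -> open W -> W `<=` U ->
  level_eq S W f.
Proof.
move=> [oU fC gn SU] oW WU.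
have CW k (h : V -> R) : Ck k U h -> Ck k W h.
  elim: k h => [h hc x Wx|k IH h [hd hc]]; first by apply: hc; exact: WU.
  split=> [x v Wx|v]; first by apply: hd; exact: WU.
  exact: (IH _ (hc v)).
split; [exact: oW|exact: (CW 2 f fC)|by move=> x /WU/gn|by move=> x /WU/SU].
Qed.

Lemma C2_hypersurface_level S p : C2_hypersurface S -> S p ->
  exists U f, level_eq S U f /\ U p.
Proof.
move=> [_ H] /H[U [f [oU Up fC gn SU]]]; exists U, f; split=> //; split=> //.
- move=> x Ux; have [v] := gn _ Ux; apply: contraNneq => g0.
  by rewrite (C1_deriveE _ oU (C2_C1 oU fC) Ux) g0 dot0l.
- move=> x Ux; split=> [Sx|fx].
    have : (S `&` U) x by [].
    by rewrite SU => -[].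
  have : [set x | U x /\ f x = 0] x by [].
  by rewrite -SU => -[].
Qed.

Lemma is_derive_quad al b ga x v :
  is_derive x v (quad al b ga) (2 * al * dot x v + dot b v).
Proof.
have d1 := is_derive_dot (is_derive_id x v) (is_derive_id x v).
have d2 := is_derive_dot (is_derive_cst b x v) (is_derive_id x v).
have [H1 H2] := is_deriveD (is_deriveD (is_deriveZ al d1) d2) (is_derive_cst ga x v).
apply: DeriveDef; first exact: H1.
by rewrite [LHS]H2 /GRing.scale/= dot0l (dotC v x); ring.
Qed.

Lemma quad_C2 U al b ga : open U -> Ck 2 U (quad al b ga).
Proof.
move=> oU.
have D1 (a : R) (c : V) (d : R) (v : V) :
    'D_v (quad a c d) = quad 0 ((2 * a) *: v) (dot c v).
  apply/funext => x; have [_ ->] := is_derive_quad a c d x v.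
  by rewrite /quad dotZl (dotC v); ring.
split=> [x v Ux|v]; first by have [] := is_derive_quad al b ga x v.
rewrite D1; split=> [x w Ux|w]; first by have [] := is_derive_quad 0 ((2 * al) *: v) (dot b v) x w.
rewrite D1 /=.
have -> : quad 0 ((2 * 0) *: w) (dot ((2 * al) *: v) w) = cst (dot ((2 * al) *: v) w).
  by apply/funext => x; rewrite /quad mulr0 scale0r dot0l mul0r !add0r.
by move=> x Ux; exact: cst_continuous.
Qed.

Lemma grad_quad al b ga x : grad (quad al b ga) x = (2 * al) *: x + b.
Proof.
apply/rowP => i; rewrite mxE; have [_ ->] := is_derive_quad al b ga x (delta_mx 0 i).
by rewrite !dot_delta !mxE.
Qed.

Lemma quad_expand al b ga p x : quad al b ga x = quad al b ga p
  + dot (grad (quad al b ga) p) (x - p) + al * dot (x - p) (x - p).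
Proof. by rewrite grad_quad /quad !dotE (dotC x p); ring. Qed.

Lemma quad_taylor al b ga p :
  taylor2 (quad al b ga) p (grad (quad al b ga) p) (2 * al)%:M.
Proof.
move=> e e0; apply/near_dotP; exists 1 => // x _.
rewrite (quad_expand al b ga p x) mul_mx_scalar dotZl.
have -> : 2^-1 * (2 * al * dot (x - p) (x - p)) = al * dot (x - p) (x - p) by field.
set a := quad _ _ _ p; set c := dot (grad _ _) _; set d := al * _.
have -> : a + c + d - a - c - d = 0 by ring.
by rewrite normr0 mulr_ge0// ?dot_ge0// ltW.
Qed.

Lemma sqr_grad_quad al b ga x :
  dot (grad (quad al b ga) x) (grad (quad al b ga) x) =
  4 * al * quad al b ga x + (dot b b - 4 * al * ga).
Proof. by rewrite grad_quad /quad !dotE (dotC x b); ring. Qed.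

Lemma quad_opp al b ga x : quad (- al) (- b) (- ga) x = - quad al b ga x.
Proof. by rewrite /quad dotNl; ring. Qed.

End CkFacts.

Section Sides.
Context {R : realType} {m : nat}.
Notation V := 'rV[R]_m.+1.
Implicit Types (x y z p g u v w N : V) (f phi : V -> R) (S U : set V) (nu : V -> V).

Lemma ball_segment (p x y : V) (r t : R) : 0 <= t <= 1 ->
  dot (x - p) (x - p) < r -> dot (y - p) (y - p) < r ->
  dot (x + t *: (y - x) - p) (x + t *: (y - x) - p) < r.
Proof.
move=> /andP[t0 t1] xr yr.
have -> : x + t *: (y - x) - p = (x - p) + t *: ((y - p) - (x - p)).
  by apply/rowP => i; rewrite !mxE; ring.
move: (x - p) (y - p) xr yr => a c xr yr.
have -> : dot (a + t *: (c - a)) (a + t *: (c - a)) =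
   (1 - t) * dot a a + t * dot c c - t * (1 - t) * dot (c - a) (c - a).
  by rewrite !dotE (dotC c a); ring.
have h1 : 0 <= t * (1 - t) * dot (c - a) (c - a).
  by rewrite !mulr_ge0 ?dot_ge0// subr_ge0.
have h2 : (1 - t) * dot a a <= (1 - t) * Num.max (dot a a) (dot c c).
  by rewrite ler_wpM2l ?subr_ge0// le_max lexx.
have h3 : t * dot c c <= t * Num.max (dot a a) (dot c c).
  by rewrite ler_wpM2l// le_max lexx orbT.
have h4 : Num.max (dot a a) (dot c c) < r by rewrite gt_max xr.
lra.
Qed.

Lemma continuous_near_lt f x (a : R) : {for x, continuous f} -> f x < a ->
  \forall y \near x, f y < a.
Proof.
move=> fc fa; have /continuous_epsP/(_ (a - f x)) := fc.
rewrite subr_gt0 => /(_ fa); apply: filterS => y; rewrite ltr_norml; lra.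
Qed.

Lemma continuous_near_gt f x (a : R) : {for x, continuous f} -> a < f x ->
  \forall y \near x, a < f y.
Proof.
move=> fc fa; have /continuous_epsP/(_ (f x - a)) := fc.
rewrite subr_gt0 => /(_ fa); apply: filterS => y; rewrite ltr_norml; lra.
Qed.

Lemma continuous_shift f x v : {for x + v, continuous f} ->
  {for x, continuous (fun y : V => f (y + v))}.
Proof.
move=> fc; apply/continuous_epsP => e e0.
have /continuous_epsP/(_ _ e0)/near_dotP[r r0 hr] := fc.
apply/near_dotP; exists r => // y yr; apply: hr.
by rewrite opprD addrACA subrr addr0.
Qed.

(** From a point with [phi <= 0 < f], moving backwards along [N], where both
    functions decrease, would reach a zero of [f] at which [phi < 0]. *)
Lemma sides U f phi p N : open U -> Ck 1 U f -> Ck 1 U phi -> U p -> f p = 0 ->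
  0 < dot (grad f p) N -> 0 < dot (grad phi p) N ->
  (\forall z \near p, f z = 0 -> 0 <= phi z) ->
  \forall z \near p, (phi z < 0 -> f z < 0) /\ (phi z <= 0 -> f z <= 0).
Proof.
move=> oU fC phiC Up fp fN phiN fphi.
have gN (h : V -> R) : Ck 1 U h -> 0 < dot (grad h p) N ->
    \forall z \near p, 0 < dot (grad h z) N.
  move=> hC hN; have := C1_grad_continuous hC Up => gc.
  exact: (continuous_near_gt (continuous_dot gc (@cst_continuous _ _ N p)) hN).
have /near_dotP[r r0 hr] : \forall z \near p, (U z /\ (f z = 0 -> 0 <= phi z)) /\
    (0 < dot (grad f z) N /\ 0 < dot (grad phi z) N).
  apply: filterI; apply: filterI => //; [exact: open_nbhs_nbhs|exact: gN|exact: gN].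
have incr (h : V -> R) z (s : R) : Ck 1 U h ->
    (forall z, dot (z - p) (z - p) < r -> 0 < dot (grad h z) N) ->
    dot (z - p) (z - p) < r -> dot (z + s *: N - p) (z + s *: N - p) < r ->
    0 < s -> h z < h (z + s *: N).
  move=> hC hg zr zsr s0; rewrite -subr_gt0.
  have seg (t : R) : 0 <= t <= 1 ->
      dot (z + t *: (s *: N) - p) (z + t *: (s *: N) - p) < r.
    move=> t01; have := ball_segment t01 zr zsr.
    by have -> : z + s *: N - z = s *: N by rewrite addrAC subrr add0r.
  have [t /seg/hr[[]]//|t /andP[t0 t1] ->] := @C1_mvt _ _ h U z (s *: N) oU hC.
  rewrite dotZr mulr_gt0//; apply: hg; apply: seg; by rewrite !ltW.
pose nn := dot N N + 1.
have nn0 : 0 < nn by have := dot_ge0 N; rewrite /nn; lra.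
pose s0 := Num.min 1 (r / (8 * nn)).
have s00 : 0 < s0 by rewrite lt_min ltr01 divr_gt0// mulr_gt0.
have sN (s : R) : `|s| <= s0 -> 2 * (s ^+ 2 * dot N N) <= r / 4.
  move=> ss; have h1 : s0 <= 1 by rewrite ge_min lexx.
  have h2 : s0 * (8 * nn) <= r by rewrite -ler_pdivlMr ?mulr_gt0// ge_min lexx orbT.
  have h3 : s ^+ 2 <= s0.
    rewrite -real_normK ?num_real// expr2; apply: le_trans (_ : s0 * 1 <= _); last by rewrite mulr1.
    by rewrite ler_pM//; lra.
  have h4 : s ^+ 2 * dot N N <= s0 * nn.
    by rewrite ler_pM ?sqr_ge0 ?dot_ge0//; rewrite /nn; lra.
  lra.
have inball z (s : R) : dot (z - p) (z - p) < r / 8 -> `|s| <= s0 ->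
    dot (z + s *: N - p) (z + s *: N - p) < r.
  move=> zr ss; rewrite addrAC; apply: le_lt_trans (dotD_le _ _) _.
  have := sN _ ss; rewrite dotZl dotZr [s * (s * _)]mulrA -expr2; lra.
have fm : f (p - s0 *: N) < 0.
  have pr : dot (p - s0 *: N - p) (p - s0 *: N - p) < r.
    by rewrite -scaleNr inball// ?normrN ?gtr0_norm// subrr dot0l divr_gt0.
  rewrite -fp -{2}(subrK (s0 *: N) p); apply: incr => //.
  - by move=> z /hr[_ []].
  - by rewrite subrK subrr dot0l.
have near_m : \forall z \near p, f (z - s0 *: N) < 0.
  have pr : dot (p - s0 *: N - p) (p - s0 *: N - p) < r.
    by rewrite -scaleNr inball// ?normrN ?gtr0_norm// subrr dot0l divr_gt0.
  have [[Us _] _] := hr _ pr.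
  have fc : {for p - s0 *: N, continuous f} by exact: (C1_continuous oU fC).
  exact: (continuous_near_lt (continuous_shift fc) fm).
have r8 : 0 < r / 8 by rewrite divr_gt0.
move: near_m (near_dot_lt p r8); apply: filterS2 => z zm zr.
have back : 0 <= f z -> exists2 s : R, - s0 <= s <= 0 & f (z + s *: N) = 0.
  move=> fz; pose F (s : R) := f (z + s *: N).
  have Fc : {within `[- s0, 0], continuous F}.
    apply: continuous_in_subspaceT => s; rewrite inE/= in_itv/= => /andP[s1 s2].
    have [[Us _] _] : (U (z + s *: N) /\ (f (z + s *: N) = 0 -> 0 <= phi (z + s *: N))) /\
       (0 < dot (grad f (z + s *: N)) N /\ 0 < dot (grad phi (z + s *: N)) N).
      by apply: hr; apply: inball => //; rewrite ler_norml s1 /= (le_trans s2)// ltW.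
    apply: (@is_derive_continuous _ _ _ _ ('D_N f (z + s *: N))).
    by apply: is_derive_line; exact: fC.1.
  have Fv : Num.min (F (- s0)) (F 0) <= 0 <= Num.max (F (- s0)) (F 0).
    by rewrite ge_min le_max /F scale0r addr0 fz orbT scaleNr (ltW zm).
  have s0n : - s0 <= 0 by rewrite oppr_le0 ltW.
  have [s + Fs] := IVT s0n Fc Fv.
  by rewrite in_itv/= => ss; exists s.
have zr' : dot (z - p) (z - p) < r by lra.
have main : 0 <= f z -> phi z <= 0 -> f z = 0 /\ phi z = 0.
  move=> fz pz; have [s /andP[s1 s2] fs] := back fz.
  have ns : `|s| <= s0 by rewrite ler_norml s1 /= (le_trans s2)// ltW.
  have zs := inball _ _ zr ns.
  have [[_ /(_ fs) ps] _] := hr _ zs.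
  move: s2; rewrite le_eqVlt => /orP[/eqP sE|sn].
    by move: fs ps; rewrite sE scale0r addr0 => -> ps; split=> //; apply/eqP; rewrite eq_le pz.
  have : phi (z + s *: N) < phi z.
    rewrite -{2}(addrK (s *: N) z) -scaleNr; apply: incr; rewrite ?oppr_gt0//.
    - by move=> x /hr[_ []].
    - by rewrite scaleNr addrK.
  by lra.
split=> pz; [rewrite ltNge|rewrite leNgt]; apply/negP => fz.
  by have [_] := main fz (ltW pz); lra.
by have [] := main (ltW fz) pz; lra.
Qed.

Lemma dotD_ge u v : 2^-1 * dot u u - dot v v <= dot (u + v) (u + v).
Proof.
have := dotD_le (u + v) (- v); rewrite addrK dotNl dotNr opprK; lra.
Qed.

(** Chords between nearby points of a C^1 hypersurface are almost tangent to it at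
    both ends. In the barrier argument this makes the tangential part of the
    gradient of the barrier large. *)
Lemma flatness S U f nu p : level_eq S U f -> U p -> S p ->
  S `<=` @halfspace R m -> unit_normal S nu ->
  exists2 r, 0 < r & forall x y, S x -> S y ->
    dot (x - p) (x - p) < r -> dot (y - p) (y - p) < r ->
    dot (enormal nu x) (x - y) ^+ 2 <= 4^-1 * dot (x - y) (x - y).
Proof.
move=> lS Up Sp SH hnu; have [oU fC gn SU] := lS; have f1 := level_eq_C1 lS.
have g0 : 0 < dot (grad f p) (grad f p) by rewrite dot_gt0 gn.
have /near_dotP[r r0 hr] : \forall x \near p, U x /\
    dot (grad f x - grad f p) (grad f x - grad f p) < dot (grad f p) (grad f p) / 64.
  apply: filterI; first exact: open_nbhs_nbhs.
  have dc : {for p, continuous (fun y => grad f y - grad f p)}.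
    exact: (cvgB (C1_grad_continuous f1 Up) (@cst_continuous _ _ (grad f p) p)).
  apply: (continuous_near_lt (continuous_dot dc dc)).
  by rewrite subrr dot0l divr_gt0.
exists r => // x y Sx Sy xr yr.
have [Ux gx] := hr _ xr; have [Uy gy] := hr _ yr.
have [gN gN0] := grad_enormal lS Ux Sx (SH _ Sx) hnu.
have N1 := enormal_unit hnu Sx (SH _ Sx).
have seg (t : R) : 0 <= t <= 1 -> dot (y + t *: (x - y) - p) (y + t *: (x - y) - p) < r.
  by move=> t01; exact: ball_segment.
have [t /seg/hr[]//|t /andP[t0 t1]] := @C1_mvt _ _ f U y (x - y) oU f1.
rewrite subrKC (SU _ Ux).1// (SU _ Uy).1// subrr => E.
have t01 : 0 <= t <= 1 by rewrite !ltW.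
have [_ gt] := hr _ (seg _ t01).
move: gN gN0 N1; set N := enormal nu x; move: N => N.
set c := dot (grad f x) N => gN c0 N1.
set gz := grad f (y + t *: (x - y)) in E gt.
have gxE : dot (grad f x) (grad f x) = c ^+ 2 by rewrite gN !dotE N1; ring.
have h1 : dot (grad f x) (grad f x) >= dot (grad f p) (grad f p) * (31 / 64).
  have := dotD_ge (grad f p) (grad f x - grad f p); rewrite subrKC.
  by move: gx g0; clear; lra.
have h2 : dot (grad f x - gz) (grad f x - gz) <= dot (grad f p) (grad f p) / 16.
  have -> : grad f x - gz = (grad f x - grad f p) + (- (gz - grad f p)).
    by apply/rowP => i; rewrite !mxE; ring.
  apply: le_trans (dotD_le _ _) _; rewrite dotNl dotNr opprK.
  by move: gx gt g0; clear; lra.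
have h3 : (c * dot N (x - y)) ^+ 2 <= dot (grad f p) (grad f p) / 16 * dot (x - y) (x - y).
  rewrite -dotZl -gN.
  have -> : dot (grad f x) (x - y) = dot (grad f x - gz) (x - y) by rewrite dotBl -E subr0.
  apply: le_trans (cauchy_schwarz _ _) _; rewrite ler_wpM2r ?dot_ge0//.
have c2 : 0 < c ^+ 2 by rewrite exprn_even_gt0.
rewrite -(ler_pM2l c2) -exprMn; apply: le_trans h3 _.
rewrite mulrA ler_wpM2r ?dot_ge0//; rewrite gxE in h1.
by move: h1 g0; clear; lra.
Qed.

End Sides.

Section Compactness.
Context {R : realType} {m : nat}.
Notation V := 'rV[R]_m.+1.
Implicit Types (x y z p u v : V).

Lemma quad_continuous (al : R) (b : V) (ga : R) : continuous (quad al b ga).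
Proof.
move=> x; have fC := quad_C2 al b ga (@openT V).
exact: (C1_continuous openT (C2_C1 openT fC)).
Qed.

Lemma sqdist_quad p x : dot (x - p) (x - p) = quad 1 ((- 2) *: p) (dot p p) x.
Proof. by rewrite /quad !dotE (dotC x p); ring. Qed.

Lemma continuous_sqdist p : continuous (fun x => dot (x - p) (x - p)).
Proof.
have -> : (fun x => dot (x - p) (x - p)) = quad 1 ((- 2) *: p) (dot p p).
  by apply/funext => x; exact: sqdist_quad.
exact: quad_continuous.
Qed.

Lemma height_quad x : height x = quad 0 en 0 x.
Proof. by rewrite /quad (dotC en) dot_en; ring. Qed.

Lemma continuous_height : continuous (@height R m).
Proof.
have -> : @height R m = quad 0 en 0 by apply/funext => x; exact: height_quad.
exact: quad_continuous.
Qed.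

Lemma closed_le_cst (f : V -> R) (a : R) : continuous f -> closed [set x | f x <= a].
Proof.
move=> fc; have -> : [set x | f x <= a] = f @^-1` [set t | t <= a] by [].
by apply: closed_comp => [x _|]; [exact: fc|exact: closed_le].
Qed.

Lemma closed_ge_cst (f : V -> R) (a : R) : continuous f -> closed [set x | a <= f x].
Proof.
move=> fc; have -> : [set x | a <= f x] = f @^-1` [set t | a <= t] by [].
by apply: closed_comp => [x _|]; [exact: fc|exact: closed_ge].
Qed.

Lemma compact_ball p (r : R) : compact [set x | dot (x - p) (x - p) <= r].
Proof.
apply: bounded_closed_compact; last exact: closed_le_cst (continuous_sqdist (p := p)).
pose rr : R := `|r|.
have rr0 : 0 <= rr by exact: normr_ge0.
have r_rr : r <= rr by exact: ler_norm.
exists (`|p| + (1 + rr)); split; first exact: num_real.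
move=> M hM x /= xr; apply: le_trans (ltW hM).
rewrite -(subrK p x) addrC; apply: le_trans (ler_normD _ _) _; rewrite lerD2l.
rewrite /Num.Def.normr/= mx_normrE; apply: bigmax_le => [|[i j] _ /=].
  by rewrite addr_ge0.
rewrite (ord1 i).
have := le_trans (sqr_coord_le_dot (x - p) j) (le_trans xr r_rr).
rewrite -real_normK ?num_real// => h.
have a0 := normr_ge0 ((x - p) 0 j).
rewrite leNgt; apply/negP => h2.
have : (1 + rr) ^+ 2 < `|(x - p) 0 j| ^+ 2 by rewrite ltr_pXn2r ?nnegrE// addr_ge0.
have : 0 <= rr ^+ 2 by exact: sqr_ge0.
by rewrite sqrrD; move: h rr0; clear; lra.
Qed.

Lemma compact_min (A : set V) (f : V -> R) : A !=set0 -> compact A -> continuous f ->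
  exists2 c, A c & forall t, A t -> f c <= f t.
Proof.
move=> A0 cA fc; have [c cA' cm] := EVT_min_rV A0 cA (continuous_subspaceT fc).
by exists c => [|t At]; [rewrite inE in cA'|apply: cm; rewrite inE].
Qed.

Lemma taylor2D (f g : V -> R) p G1 Q1 G2 Q2 : taylor2 f p G1 Q1 -> taylor2 g p G2 Q2 ->
  taylor2 (fun x => f x + g x) p (G1 + G2) (Q1 + Q2).
Proof.
move=> tf tg e e0; have e2 : 0 < e / 2 by rewrite divr_gt0.
move: (tf _ e2) (tg _ e2); apply: filterS2 => x.
move: (x - p) => v h1 h2; rewrite mulmxDr !dotDl.
set X := (f x - _ - _ - _) in h1; set Y := (g x - _ - _ - _) in h2.
have -> : f x + g x - (f p + g p) - (dot G1 v + dot G2 v) -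
   2^-1 * (dot (v *m Q1) v + dot (v *m Q2) v) = X + Y.
  by rewrite /X /Y; ring.
by apply: le_trans (ler_normD _ _) _; move: h1 h2; clear; lra.
Qed.

Lemma taylor2Z (a : R) (f : V -> R) p G Q : taylor2 f p G Q ->
  taylor2 (fun x => a * f x) p (a *: G) (a *: Q).
Proof.
move=> tf e e0; have a1 : 0 < `|a| + 1 by rewrite ltr_wpDl.
have e2 : 0 < e / (`|a| + 1) by rewrite divr_gt0.
move: (tf _ e2); apply: filterS => x h1.
rewrite -scalemxAr !dotZl.
set X := (f x - _ - _ - _) in h1.
have -> : a * f x - a * f p - a * dot G (x - p) -
   2^-1 * (a * dot ((x - p) *m Q) (x - p)) = a * X by rewrite /X; ring.
rewrite normrM.
apply: le_trans (_ : (`|a| + 1) * (e / (`|a| + 1) * dot (x - p) (x - p)) <= _).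
  by rewrite ler_pM// lerDl.
by rewrite le_eqVlt; apply/orP; left; apply/eqP; field; rewrite gt_eqF.
Qed.

Lemma taylor2_quad_sqr (al : R) (b : V) (ga : R) p (q := quad al b ga) (g := grad q p) :
  taylor2 (fun x => q x ^+ 2) p ((2 * q p) *: g)
    ((2 * q p * (2 * al))%:M + 2 *: (g^T *m g)).
Proof.
move=> e e0.
have gc : {for p, continuous (fun x => dot g (x - p))}.
  have -> : (fun x => dot g (x - p)) = quad 0 g (- dot g p).
    by apply/funext => x; rewrite /quad dotBr; ring.
  exact: (@quad_continuous _ _ _ p).
pose M := 2 * `|al| + al ^+ 2 + 1.
have M0 : 0 < M.
  by have := sqr_ge0 al; have := normr_ge0 al; rewrite /M; clear; lra.
have eM : 0 < Num.min 1 (e / M) by rewrite lt_min ltr01 divr_gt0.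
have /continuous_epsP/(_ _ eM) := gc; rewrite subrr dot0r.
move: (near_dot_lt p eM); apply: filterS2 => x xp; rewrite subr0 => gx.
set v := x - p in xp gx *.
have -> : q x = q p + dot g v + al * dot v v by exact: quad_expand.
clearbody v.
have vg : v *m (g^T *m g) = dot g v *: g.
  rewrite mulmxA; have -> : v *m g^T = (dot g v)%:M.
    by rewrite [LHS]mx11_scalar -dot_mul_tr dotC.
  by rewrite mul_scalar_mx.
rewrite mulmxDr mul_mx_scalar -scalemxAr vg dotDl !dotZl.
have -> : (q p + dot g v + al * dot v v) ^+ 2 - q p ^+ 2 - 2 * q p * dot g v
   - 2^-1 * (2 * q p * (2 * al) * dot v v + 2 * (dot g v * dot g v)) =
   dot v v * (2 * al * dot g v + al ^+ 2 * dot v v) by field.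
rewrite normrM (ger0_norm (dot_ge0 v)) mulrC ler_wpM2r ?dot_ge0//.
move: xp gx; rewrite !lt_min => /andP[v1 v2] /andP[g1 g2].
apply: le_trans (ler_normD _ _) _.
rewrite normrM normrM (ger0_norm (ler0n _ 2)) normrM (ger0_norm (sqr_ge0 _)) (ger0_norm (dot_ge0 v)).
have i1 : `|al| * `|dot g v| <= `|al| * (e / M) by rewrite ler_wpM2l// ltW.
have i2 : al ^+ 2 * dot v v <= al ^+ 2 * (e / M) by rewrite ler_wpM2l ?sqr_ge0// ltW.
have i3 : M * (e / M) = e by rewrite mulrC divfK// gt_eqF.
have i4 : 0 < e / M by rewrite divr_gt0.
move: i3; rewrite {1}/M !mulrDl mul1r; move: i1 i2 i4; clear; lra.
Qed.

End Compactness.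

Section NormalField.
Context {R : realType} {m : nat}.
Notation V := 'rV[R]_m.+1.
Implicit Types (x y z p u v : V) (S : set V) (nu : V -> V).

Lemma enormal_cvg S nu p : unit_normal S nu -> S p -> 0 < height p ->
  enormal nu x @[x --> within S (nbhs p)] --> enormal nu p.
Proof.
move=> [nc _] Sp hp.
have nup : nu x @[x --> within S (nbhs p)] --> nu p.
  by have /subspace_continuousP/(_ _ Sp) := nc.
apply: cvgZ => //; apply: cvgV; first by rewrite gt_eqF.
by apply: cvg_within_filter; exact: continuous_height.
Qed.

Lemma enormal_dot_near_lt S nu p (g : V -> V) (a : R) : unit_normal S nu -> S p ->
  0 < height p -> {for p, continuous g} -> dot (enormal nu p) (g p) < a ->
  \forall x \near p, S x -> dot (enormal nu x) (g x) < a.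
Proof.
move=> hnu Sp hp gc ga.
have gw : g x @[x --> within S (nbhs p)] --> g p by exact: cvg_within_filter.
have FF : Filter (within S (nbhs p)) by apply: within_filter.
have := @cvg_dot _ _ _ _ FF _ _ _ _ (enormal_cvg hnu Sp hp) gw.
move=> /cvgrPdist_lt/(_ (a - dot (enormal nu p) (g p))).
rewrite subr_gt0 => /(_ ga); rewrite !near_withinE.
by apply: filterS => x H Sx; have := H Sx; rewrite ltr_norml; clear; lra.
Qed.

End NormalField.

(** * The strong maximum principle for a hypersurface touching a quadric *)

Section StrongMaximum.
Context {R : realType} {m : nat}.
Notation V := 'rV[R]_m.+1.
Implicit Types (x y z p u v w : V) (S : set V) (nu : V -> V).

(** The function [s x = (|z-y|^2 - |x-y|^2 - |x-z|^2) / 2] is positive exactly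
    in the ball whose diameter is the segment from [y] to [z]; it is the quadric
    from which the barrier [s + K s^2] is built. *)
Definition barrier y z : V -> R :=
  quad (- 1) (y + z) (2^-1 * (dot (z - y) (z - y) - dot y y - dot z z)).

Lemma barrierE y z x : barrier y z x =
  2^-1 * (dot (z - y) (z - y) - dot (x - y) (x - y) - dot (x - z) (x - z)).
Proof.
by rewrite /barrier /quad !dotE (dotC x y) (dotC x z) (dotC z y); field.
Qed.

Lemma grad_barrier y z x : grad (barrier y z) x = - ((x - y) + (x - z)).
Proof.
by rewrite grad_quad; apply/rowP => i; rewrite !mxE; ring.
Qed.

Lemma barrier_taylor y z p (K : R) (s := barrier y z) (g := grad s p) :
  taylor2 (fun x => s x + K * s x ^+ 2) p ((1 + 2 * K * s p) *: g)
    ((- 2 * (1 + 2 * K * s p))%:M + (2 * K) *: (g^T *m g)).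
Proof.
pose c0 := 2^-1 * (dot (z - y) (z - y) - dot y y - dot z z).
have T := taylor2D (quad_taylor (- 1) (y + z) c0 p)
  (taylor2Z K (taylor2_quad_sqr (- 1) (y + z) c0 p)).
have E1 : (1 + 2 * K * s p) *: g = g + K *: ((2 * s p) *: g).
  by rewrite scalerDl scale1r scalerA; congr (_ + _ *: _); ring.
have E2 : (- 2 * (1 + 2 * K * s p))%:M + (2 * K) *: (g^T *m g) =
   (2 * (- 1))%:M + K *: ((2 * s p * (2 * (- 1)))%:M + 2 *: (g^T *m g)).
  rewrite scalerDr scalerA scale_scalar_mx addrA.
  congr (_ + _ *: _); last by ring.
  by rewrite -raddfD/=; congr (_%:M); ring.
by rewrite E1 E2; exact: T.
Qed.

(** Numerical heart of the barrier argument: the inequality obtained at an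
    interior minimum of [q - e (s + K s^2)] fails when [K] is large. Here [mu] is
    the normal component of the gradient there, [hn] the height, [T] the square
    of the tangential part of [grad s], and [a] stands for [1 + 2 K s]. *)
Lemma barrier_contradiction (M e a K T hn mu bn sn H0 D C eta : R) :
  0 < M -> 0 < e -> 0 <= a <= 2 -> 0 < eta -> eta <= hn -> 0 <= H0 -> 0 < D ->
  - bn <= H0 * Num.sqrt D -> mu < 0 -> D - C * e <= mu ^+ 2 -> 0 <= C ->
  M * (bn - e * a * sn - mu * H0) <= (2 * M * e * a - 2 * K * e * T) * hn ->
  (4 * M + (2 * M * `|sn| + M * H0 * (C / Num.sqrt D)) / eta) < 2 * K * T -> False.
Proof.
move=> M0 e0 /andP[a0 a2] eta0 etah H00 D0 bH mu0 muD C0 main big.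
have r0 : 0 < Num.sqrt D by rewrite sqrtr_gt0.
have rr : Num.sqrt D ^+ 2 = D by rewrite sqr_sqrtr// ltW.
move: (Num.sqrt D) r0 rr bH big => r r0 rr bH big.
have mur : r - C * e / r <= - mu.
  rewrite leNgt; apply/negP => h.
  have h1 : - mu < r - C * e / r by [].
  have h2 : 0 <= C * e / r by rewrite divr_ge0// ?mulr_ge0// ltW.
  have h3 : mu ^+ 2 < (r - C * e / r) * r.
    rewrite -sqrrN expr2; apply: le_lt_trans (_ : - mu * r < _).
      by rewrite ler_wpM2l//; lra.
    by rewrite ltr_pM2r.
  have h4 : (r - C * e / r) * r = D - C * e by rewrite -rr; field; rewrite gt_eqF.
  by rewrite h4 in h3; lra.
have H1 : - (H0 * (C / r)) * e <= bn - mu * H0.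
  have : H0 * (r - C * e / r) <= H0 * - mu by rewrite ler_wpM2l.
  have -> : H0 * (r - C * e / r) = H0 * r - H0 * (C / r) * e by ring.
  lra.
have H2 : e * a * sn <= e * (2 * `|sn|).
  rewrite -mulrA ler_pM2l//; apply: le_trans (ler_norm _) _.
  by rewrite normrM (ger0_norm a0) ler_wpM2r.
have hn0 : 0 < hn by lra.
have H3 : M * (- (H0 * (C / r)) * e - e * (2 * `|sn|)) <= (2 * M * e * a - 2 * K * e * T) * hn.
  by apply: le_trans main; rewrite ler_pM2l//; lra.
have H4 : 2 * K * T * hn <= 4 * M * hn + (2 * M * `|sn| + M * H0 * (C / r)).
  rewrite -(ler_pM2l e0).
  have : 2 * M * e * a * hn <= 2 * M * e * 2 * hn.
    by rewrite ler_pM2r// ler_pM2l// !mulr_gt0.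
  lra.
have H5 : (2 * M * `|sn| + M * H0 * (C / r)) <= (2 * M * `|sn| + M * H0 * (C / r)) / eta * hn.
  rewrite [leRHS]mulrAC ler_pdivlMr//; rewrite ler_wpM2l//.
  have cr : 0 <= C / r by rewrite divr_ge0// ltW.
  by rewrite addr_ge0// mulr_ge0// ?mulr_ge0// ltW.
have : (4 * M + (2 * M * `|sn| + M * H0 * (C / r)) / eta) * hn < 2 * K * T * hn.
  by rewrite ltr_pM2r.
rewrite mulrDl; lra.
Qed.

(** At an interior local minimum [w] of [q - e (s + K s^2)] on [S], the touching
    inequality bounds from below the trace of a Hessian in which the term
    [- 2 e K (grad s)^2] dominates, since by flatness [grad s] has a large
    tangential part. *)
Lemma barrier_minimum S nu (al : R) (b : V) (ga H0 : R) y z w (K e kappa eta : R)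
    (s := barrier y z) (R2 := dot (z - y) (z - y))
    (q := quad al b ga) (D := dot b b - 4 * al * ga) :
  (0 < m)%N -> C2_hypersurface S -> unit_normal S nu ->
  (forall p, S p -> exists2 h, is_mean_curvature S nu p h & H0 <= h) ->
  0 <= H0 -> 0 < D -> - height b <= H0 * Num.sqrt D ->
  (forall x, S x -> 0 <= q x) ->
  S w -> 0 < e <= 1 -> 0 < K -> 0 <= s w -> K * s w <= 2^-1 ->
  dot (w - z) (w - z) <= R2 / 16 ->
  4^-1 * dot (w - z) (w - z) >= dot (enormal nu w) (w - z) ^+ 2 ->
  4^-1 * dot (w - y) (w - y) >= dot (enormal nu w) (w - y) ^+ 2 ->
  0 < eta <= height w ->
  dot (enormal nu w) (grad q w) <= - kappa -> 0 < kappa ->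
  2 * e * (1 + 5 * R2) < kappa ->
  q w <= e * (s w + K * s w ^+ 2) ->
  (\forall x \near w, S x -> q w - e * (s w + K * s w ^+ 2) <= q x - e * (s x + K * s x ^+ 2)) ->
  (4 * m%:R + (2 * m%:R * (1 + 5 * R2)
     + m%:R * H0 * ((4 * `|al| * R2 + 2 * (4 * `|al| * R2 + D + 5 * R2)) / Num.sqrt D)) / eta)
    < 2 * K * (R2 / 16) -> False.
Proof.
move=> m0 hS hnu hH H00 D0 bH qS Sw /andP[e0 e1] K0 s0 Ks wz Nz Ny /andP[eta0 etaw] Nq kap0 ekap qw mn big.
have [SH _] := hS; have hw := SH _ Sw : 0 < height w.
have [U [f [lS Uw]]] := C2_hypersurface_level hS Sw.
have [h hh Hh] := hH _ Sw.
have N1 := enormal_unit hnu Sw hw.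
set a := 1 + 2 * K * s w.
have a12 : 0 <= a <= 2.
  have : 0 <= K * s w by rewrite mulr_ge0// ltW.
  by rewrite /a; move: Ks; clear; lra.
set gs := grad s w; set gq := grad q w.
pose G := gq + (- e) *: (a *: gs).
pose Q : 'M[R]_m.+1 := (2 * al)%:M + (- e) *: ((- 2 * a)%:M + (2 * K) *: (gs^T *m gs)).
have tay : taylor2 (fun x => q x + (- e) * (s x + K * s x ^+ 2)) w G Q.
  exact: (taylor2D (quad_taylor al b ga w) (taylor2Z (- e) (barrier_taylor y z w K))).
have mn' : \forall x \near w, S x ->
   q w + (- e) * (s w + K * s w ^+ 2) <= q x + (- e) * (s x + K * s x ^+ 2).
  by move: mn; apply: filterS => x H /H; rewrite !mulNr.
have [GN main] := touching m0 lS Uw Sw hw hnu hh tay mn'.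
move: (enormal nu w) N1 Nz Ny Nq GN main => N N1 Nz Ny Nq GN main.
set mu := dot G N in GN main.
have R20 : 0 <= R2 by exact: dot_ge0.
have gsE : gs = - ((w - y) + (w - z)) by exact: grad_barrier.
have wyR : dot (w - y) (w - y) <= R2.
  by move: s0; rewrite /s barrierE -/R2; have := dot_ge0 (w - z); clear; lra.
have gs5 : dot gs gs <= 5 * R2.
  rewrite gsE dotNl dotNr opprK; apply: le_trans (dotD_le _ _) _.
  by move: wyR wz R20; clear; lra.
(* the tangential part of grad s is bounded below by flatness *)
have T16 : R2 / 16 <= dot gs gs - dot N gs ^+ 2.
  have tang u : dot (u - dot N u *: N) (u - dot N u *: N) = dot u u - dot N u ^+ 2.
    by rewrite !dotE N1 (dotC u N); ring.
  have h1 : R2 / 2 - R2 / 16 <= dot (w - y) (w - y).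
    have := dotD_le (z - w) (w - y).
    have -> : z - w + (w - y) = z - y by rewrite addrA subrK.
    have -> : dot (z - w) (z - w) = dot (w - z) (w - z) by rewrite -opprB dotNl dotNr opprK.
    by rewrite -/R2; move: wz; clear; lra.
  have h2 := dotD_ge ((w - y) - dot N (w - y) *: N) ((w - z) - dot N (w - z) *: N).
  rewrite -tang gsE.
  have -> : - (w - y + (w - z)) - dot N (- (w - y + (w - z))) *: N =
     - ((w - y) - dot N (w - y) *: N + ((w - z) - dot N (w - z) *: N)).
    by rewrite dotNr (dotDr (w - y)); apply/rowP => i; rewrite !mxE; ring.
  rewrite dotNl dotNr opprK; apply: le_trans h2.
  rewrite !tang; have := sqr_ge0 (dot N (w - z)).
  by move: h1 Ny wz R20; clear; lra.
have muE : mu = dot gq N - e * a * dot gs N by rewrite /mu /G !dotE; ring.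
have Ngs : `|dot gs N| <= 1 + 5 * R2.
  have : dot gs N ^+ 2 <= 5 * R2.
    by apply: le_trans (cauchy_schwarz _ _) _; rewrite N1 mulr1.
  rewrite -real_normK ?num_real// => h1.
  have := sqr_ge0 (`|dot gs N| - 1); rewrite sqrrB1.
  by have := sqr_ge0 `|dot gs N|; move: h1; clear; lra.
have mu0 : mu < 0.
  rewrite muE; have : - (e * a * dot gs N) <= 2 * e * (1 + 5 * R2).
    apply: le_trans (ler_norm _) _; rewrite normrN normrM.
    rewrite ler_pM// normrM (ger0_norm (ltW e0)) mulrC ler_pM2r//.
    by case/andP: a12 => a0 a2; rewrite ger0_norm.
  by rewrite dotC in Nq; move: Nq ekap; clear; lra.
have Gn : mu * height N = 2 * al * height w + height b - e * a * height gs.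
  have E : G 0 ord_max = (mu *: N) 0 ord_max by rewrite {1}GN.
  by rewrite [RHS]mxE in E; rewrite /height -E /G /gq grad_quad !mxE; ring.
have q0 : 0 <= q w := qS _ Sw.
have qR : q w <= R2.
  have s2 : s w <= R2 / 2.
    rewrite /s barrierE -/R2; have := dot_ge0 (w - z); have := dot_ge0 (w - y); clear; lra.
  have : K * s w ^+ 2 <= 2^-1 * s w by rewrite expr2 mulrA ler_wpM2r.
  have s3 : 0 <= s w + K * s w ^+ 2 by rewrite addr_ge0// mulr_ge0 ?sqr_ge0// ltW.
  have : e * (s w + K * s w ^+ 2) <= 1 * (s w + K * s w ^+ 2) by rewrite ler_wpM2r.
  by move: qw s2 R20 s0; clear; lra.
have qe : q w <= e * R2.
  apply: le_trans qw _; rewrite ler_pM2l//.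
  have s2 : s w <= R2 / 2.
    rewrite /s barrierE -/R2; have := dot_ge0 (w - z); have := dot_ge0 (w - y); clear; lra.
  have : K * s w ^+ 2 <= 2^-1 * s w by rewrite expr2 mulrA ler_wpM2r.
  by move: s2 R20 s0; clear; lra.
pose C := 4 * `|al| * R2 + 2 * (4 * `|al| * R2 + D + 5 * R2).
have C0 : 0 <= C.
  have : 0 <= `|al| * R2 by rewrite mulr_ge0.
  by rewrite /C; move: R20 D0; clear; lra.
have gqE : dot gq gq = 4 * al * q w + D by exact: sqr_grad_quad.
have alq : `|al * q w| <= `|al| * R2 by rewrite normrM ler_wpM2l// ger0_norm.
have alqe : - (al * q w) <= `|al| * R2 * e.
  rewrite -mulrN; apply: le_trans (ler_norm _) _; rewrite normrM normrN (ger0_norm q0).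
  by rewrite -mulrA ler_wpM2l// mulrC.
have muD : D - C * e <= mu ^+ 2.
  have -> : mu ^+ 2 = dot G G by rewrite GN !dotE N1; ring.
  have -> : dot G G = dot gq gq - 2 * e * a * dot gq gs + (e * a) ^+ 2 * dot gs gs.
    by rewrite /G !dotE (dotC gs gq); ring.
  have h1 : 0 <= (e * a) ^+ 2 * dot gs gs by rewrite mulr_ge0 ?sqr_ge0 ?dot_ge0.
  have h2 : `|dot gq gs| <= 2^-1 * (4 * `|al| * R2 + D + 5 * R2).
    have := dot_ge0 (gq - gs); have := dot_ge0 (gq + gs).
    rewrite !dotE (dotC gs gq) gqE.
    have := ler_norm (al * q w).
    by rewrite ler_norml; move: alq gs5; clear; lra.
  have h3 : 2 * e * a * dot gq gs <= e * (2 * (4 * `|al| * R2 + D + 5 * R2)).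
    have -> : 2 * e * a * dot gq gs = e * (2 * (a * dot gq gs)) by ring.
    rewrite ler_pM2l// ler_pM2l//; apply: le_trans (ler_norm _) _; rewrite normrM.
    case/andP: a12 => a0 a2; rewrite ger0_norm//.
    by apply: le_trans (_ : 2 * `|dot gq gs| <= _); [rewrite ler_wpM2r|move: h2; clear; lra].
  by rewrite gqE /C; move: alqe h1 h3; clear; lra.
have m1 : 0 < m%:R :> R by rewrite ltr0n.
have PT : ptrace Q N = m%:R * (2 * al + 2 * e * a) - 2 * K * e * (dot gs gs - dot N gs ^+ 2).
  rewrite /Q scalerDr scalerA scale_scalar_mx addrA -raddfD/= ptraceD ptraceZ.
  by rewrite ptrace_scalar// ptrace_rank1//; ring.
have hw' : 0 < height w := hw.
have main2 : m%:R * (height b - e * a * height gs - mu * H0) <=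
    (2 * m%:R * e * a - 2 * K * e * (dot gs gs - dot N gs ^+ 2)) * height w.
  have : m%:R * mu * (height N - H0) / height w <= ptrace Q N.
    apply: le_trans main; rewrite ler_pM2r ?invr_gt0// -!mulrA ler_pM2l//.
    rewrite !mulrBr lerD2l lerN2; rewrite ler_nM2l//.
  rewrite PT ler_pdivrMr// -mulrA mulrBr Gn; clear; lra.
apply: (barrier_contradiction m1 e0 a12 eta0 etaw H00 D0 bH mu0 muD C0 main2).
have hgs : `|height gs| <= 1 + 5 * R2.
  have : height gs ^+ 2 <= 5 * R2 by apply: le_trans gs5; exact: sqr_coord_le_dot.
  rewrite -real_normK ?num_real// => h1.
  have := sqr_ge0 (`|height gs| - 1); rewrite sqrrB1.
  by have := sqr_ge0 `|height gs|; move: h1; clear; lra.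
apply: le_lt_trans (_ : _ <= 4 * m%:R + (2 * m%:R * (1 + 5 * R2) + m%:R * H0 * (C / Num.sqrt D)) / eta) _.
  rewrite lerD2l ler_pM2r ?invr_gt0// lerD2r ler_pM2l// mulr_gt0//.
apply: lt_le_trans big _.
by rewrite ler_pM2l ?mulr_gt0.
Qed.

(** Hopf's argument. If [q] did not vanish identically on [S] near a zero [p0],
    there would be a point [y] of [S] with [q y > 0] and a nearest zero [z] to it;
    the barrier on the ball with diameter [yz] then has an interior minimum
    close to [z]. *)
Lemma strong_touching S nu (al : R) (b : V) (ga H0 : R) (p0 : V)
    (q := quad al b ga) (D := dot b b - 4 * al * ga) :
  (0 < m)%N -> C2_hypersurface S -> properly_embedded S -> unit_normal S nu ->
  (forall p, S p -> exists2 h, is_mean_curvature S nu p h & H0 <= h) ->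
  0 <= H0 -> 0 < D -> - height b <= H0 * Num.sqrt D ->
  (forall x, S x -> 0 <= q x) -> S p0 -> q p0 = 0 ->
  dot (enormal nu p0) (grad q p0) < 0 ->
  \forall x \near p0, S x -> q x = 0.
Proof.
move=> m0 hS pS hnu hH H00 D0 bH qS Sp0 qp0 Np0.
have [SH _] := hS; have hp0 : 0 < height p0 := SH _ Sp0.
have [U [f [lS Up0]]] := C2_hypersurface_level hS Sp0.
have [r1 r10 flat] := flatness lS Up0 Sp0 SH hnu.
pose kappa := - dot (enormal nu p0) (grad q p0) / 2.
have kap0 : 0 < kappa by rewrite divr_gt0// oppr_gt0.
have gqc : {for p0, continuous (grad q)}.
  exact: (C1_grad_continuous (C2_C1 openT (quad_C2 al b ga openT))).
have kapN : dot (enormal nu p0) (grad q p0) < - kappa.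
  by rewrite /kappa; move: Np0; clear; lra.
pose eta := height p0 / 2.
have eta0 : 0 < eta by rewrite divr_gt0.
have etah : eta < height p0 by rewrite /eta; move: hp0; clear; lra.
have hc : {for p0, continuous (@height R m)} by exact: (@continuous_height R m p0).
have /near_dotP[r2 r20 hr2] : \forall x \near p0,
    (S x -> dot (enormal nu x) (grad q x) < - kappa) /\ eta < height x.
  apply: filterI; first exact: (enormal_dot_near_lt hnu Sp0 hp0 gqc kapN).
  exact: (continuous_near_gt hc etah).
pose r := Num.min r1 r2.
have r0 : 0 < r by rewrite lt_min r10 r20.
have r16 : 0 < r / 16 by rewrite divr_gt0.
apply: filterS (near_dot_lt p0 r16) => y yr Sy.
apply/eqP/negPn/negP => qy0.
have qy : 0 < q y by rewrite lt_def qy0 qS.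
pose K0 := [set x : V | dot (x - p0) (x - p0) <= r / 4].
have K0H : K0 `<=` @halfspace R m.
  move=> x /= xr; have /hr2[_ ] : dot (x - p0) (x - p0) < r2.
    apply: le_lt_trans xr _; apply: lt_le_trans (_ : r <= _); last by rewrite ge_min lexx orbT.
    by move: r0; clear; lra.
  by move=> /(lt_trans eta0).
have cK0 : compact K0 by exact: compact_ball.
have cSK := pS _ K0H cK0.
pose Z := (S `&` K0) `&` [set x | q x <= 0].
have cZ : compact Z.
  by apply: compact_closedI => //; apply: closed_le_cst; exact: quad_continuous.
have Z0 : Z !=set0.
  exists p0; split; last by rewrite /= qp0.
  by split=> //; rewrite /K0/= subrr dot0l divr_ge0// ltW.
have [z [[Sz zK] qz] zmin] := compact_min Z0 cZ (@continuous_sqdist _ _ y).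
have {}qz : q z = 0 by apply/eqP; rewrite eq_le (qS _ Sz) andbT.
pose R2 := dot (z - y) (z - y).
have R2r : R2 < r / 16.
  apply: le_lt_trans (_ : dot (p0 - y) (p0 - y) < _).
    apply: zmin; split; last by rewrite /= qp0.
    by split=> //; rewrite /K0/= subrr dot0l divr_ge0// ltW.
  by rewrite -opprB dotNl dotNr opprK.
have R20 : 0 < R2.
  rewrite dot_gt0 subr_eq0; apply: contraTneq qy => <-.
  by rewrite qz ltxx.
have far x : S x -> dot (x - y) (x - y) < R2 -> 0 < q x.
  move=> Sx xy; rewrite lt_def qS// andbT; apply/eqP => qx.
  suff : R2 <= dot (x - y) (x - y) by rewrite leNgt xy.
  apply: zmin; split; last by rewrite /= qx.
  split=> //; rewrite /K0/= -(subrKA y); apply: le_trans (dotD_le _ _) _.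
  by move: xy R2r yr; clear; lra.
pose s := barrier y z.
have sz : s z = 0.
  by rewrite /s barrierE (subrr z) dot0l; ring.
pose E0 := (4 * m%:R + (2 * m%:R * (1 + 5 * R2)
   + m%:R * H0 * ((4 * `|al| * R2 + 2 * (4 * `|al| * R2 + D + 5 * R2)) / Num.sqrt D)) / eta).
pose K := `|E0| * 8 / R2 + 1.
have K1 : 0 < K by rewrite ltr_wpDl// divr_ge0 ?mulr_ge0// ltW.
have KE : E0 < 2 * K * (R2 / 16).
  have -> : 2 * K * (R2 / 16) = `|E0| + R2 / 8 by rewrite /K; field; rewrite gt_eqF.
  have := ler_norm E0; move: R20; clear; lra.
have K12 : 0 < (2 * K)^-1 by rewrite invr_gt0 mulr_gt0.
have sc : {for z, continuous s} by exact: (@quad_continuous _ _ _ _ _ z).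
have /near_dotP[r3 r30 hr3] : \forall x \near z, `|s x| < (2 * K)^-1.
  by have /continuous_epsP/(_ _ K12) := sc; rewrite sz; apply: filterS => x; rewrite subr0.
pose rho := Num.min (R2 / 16) (r3 / 2).
have rho0 : 0 < rho by rewrite lt_min !divr_gt0.
have rhoR : rho <= R2 / 16 by rewrite ge_min lexx.
have rhor3 : rho < r3.
  by apply: le_lt_trans (_ : r3 / 2 < _); [rewrite ge_min lexx orbT|move: r30; clear; lra].
pose B := [set x : V | dot (x - z) (x - z) <= rho].
have zr : dot (z - p0) (z - p0) <= r / 4 by [].
have Br x : B x -> dot (x - p0) (x - p0) < r.
  move=> /= Bx; rewrite -(subrKA z); apply: le_lt_trans (dotD_le _ _) _.
  have Bx' : dot (x - z) (x - z) <= rho := Bx.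
  by move: Bx' rhoR R2r zr r0; clear; lra.
have rr1 : r <= r1 by rewrite ge_min lexx.
have rr2 : r <= r2 by rewrite ge_min lexx orbT.
have sB x : B x -> `|s x| * K < 2^-1.
  move=> /= Bx; have := hr3 _ (le_lt_trans Bx rhor3).
  rewrite -(ltr_pM2r K1) => h; apply: lt_le_trans h _.
  by rewrite invfM -mulrA mulVf ?mulr1// gt_eqF.
have BH : B `<=` @halfspace R m.
  by move=> x /Br xr; have [_ /(lt_trans eta0)] := hr2 _ (lt_le_trans xr rr2).
have cSB : compact (S `&` B) by apply: pS => //; exact: compact_ball.
(* on the part of the sphere around z where the barrier is nonnegative, q is
   bounded away from zero *)
pose T := (S `&` B) `&` ([set x | 0 <= s x] `&` [set x | rho <= dot (x - z) (x - z)]).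
have cT : compact T.
  apply: compact_closedI => //; apply: closedI.
    by apply: closed_ge_cst; exact: quad_continuous.
  by apply: closed_ge_cst; exact: continuous_sqdist.
have sR x : s x <= R2 / 2.
  rewrite /s barrierE -/R2; have := dot_ge0 (x - y); have := dot_ge0 (x - z); clear; lra.
have qT : exists2 d : R, 0 < d & forall x, T x -> d <= q x.
  have [->|T0] := eqVneq T set0; first by exists 1.
  have /set0P T1 := T0.
  have [c Tc cmin] := compact_min T1 cT (@quad_continuous _ _ al b ga).
  exists (q c) => //; have [[Sc Bc] [/= sc0 rc]] := Tc.
  apply: far => //; move: sc0; rewrite /s barrierE -/R2.
  by move: rc rho0; clear; lra.
have [d d0 dT] := qT.
pose e := Num.min 1 (Num.min (d / (2 * R2)) (kappa / (4 * (1 + 5 * R2)))).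
have R51 : 0 < 1 + 5 * R2 by move: R20; clear; lra.
have e0 : 0 < e.
  by rewrite !lt_min ltr01/=; apply/andP; split; apply: divr_gt0; rewrite // mulr_gt0.
have e1 : e <= 1 by rewrite ge_min lexx.
have ed : e * (2 * R2) <= d by rewrite -ler_pdivlMr ?mulr_gt0// !ge_min lexx ?orbT.
have ek : e * (4 * (1 + 5 * R2)) <= kappa.
  by rewrite -ler_pdivlMr ?mulr_gt0// !ge_min lexx ?orbT.
pose Phi x := q x - e * (s x + K * s x ^+ 2).
have Phic : continuous Phi.
  move=> x; have qc := @quad_continuous R m al b ga x.
  have sc' : s y @[y --> x] --> s x by exact: (@quad_continuous R m _ _ _ x).
  apply: (@cvgB _ _ _ _ (nbhs_filter x)); first exact: qc.
  apply: (@cvgM _ _ _ (nbhs_filter x)); first exact: cvg_cst.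
  apply: (@cvgD _ _ _ _ (nbhs_filter x)); first exact: sc'.
  apply: (@cvgM _ _ _ (nbhs_filter x)); first exact: cvg_cst.
  by apply: (@cvgM _ _ _ (nbhs_filter x)); exact: sc'.
have SBz : (S `&` B) z by split=> //; rewrite /B/= subrr dot0l ltW.
have [w [Sw Bw] wmin] := compact_min (ex_intro _ z SBz) cSB Phic.
have Phiw : Phi w <= 0.
  by apply: le_trans (wmin _ SBz) _; rewrite /Phi qz sz expr0n !mulr0 addr0 mulr0 subr0.
have qw0 := qS _ Sw.
have sKw := sB _ Bw.
have phi_pos : 0 <= s w + K * s w ^+ 2.
  by rewrite -(pmulr_rge0 _ e0); move: Phiw qw0; rewrite /Phi; clear; lra.
have sw0 : 0 <= s w.
  rewrite leNgt; apply/negP => sn.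
  have h1 : s w * (1 + s w * K) < 0.
    rewrite nmulr_rlt0//; move: sKw; rewrite ltr0_norm//; clear; lra.
  by move: phi_pos; rewrite leNgt => /negP; apply; apply: le_lt_trans h1; rewrite le_eqVlt; apply/orP; left; apply/eqP; ring.
have Ksw : K * s w <= 2^-1 by rewrite mulrC; move: sKw; rewrite ger0_norm// => /ltW.
have wz : dot (w - z) (w - z) < rho.
  rewrite ltNge; apply/negP => rw.
  have dq : d <= q w by apply: dT; split.
  have : K * s w ^+ 2 <= 2^-1 * s w by rewrite expr2 mulrA ler_wpM2r.
  have h2 := sR w => h3.
  have : e * (s w + K * s w ^+ 2) <= e * R2.
    by rewrite ler_pM2l//; move: h2 h3 sw0 R20; clear; lra.
  have : 0 < e * R2 by rewrite mulr_gt0.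
  by move: Phiw dq ed; rewrite /Phi; clear; lra.
have wr := Br _ Bw.
have [Nw hw] := hr2 _ (lt_le_trans wr rr2).
have zr1 : dot (z - p0) (z - p0) < r1.
  by apply: lt_le_trans rr1; apply: le_lt_trans zr _; move: r0; clear; lra.
have yr1 : dot (y - p0) (y - p0) < r1.
  by apply: lt_le_trans rr1; apply: lt_trans yr _; move: r0; clear; lra.
have wr1 := lt_le_trans wr rr1.
apply: (@barrier_minimum S nu al b ga H0 y z w K e kappa eta) => //.
- by rewrite e0.
- by apply: ltW; apply: lt_le_trans rhoR.
- exact: flat.
- exact: flat.
- by rewrite eta0 ltW.
- exact: ltW (Nw Sw).
- rewrite -/R2; have := mulr_gt0 e0 R51; move: ek kap0; clear; lra.
- by move: Phiw; rewrite /Phi subr_le0.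
- have near_w : \forall x \near w, dot (x - z) (x - z) < rho.
    exact: (continuous_near_lt (@continuous_sqdist _ _ z w) wz).
  by apply: filterS near_w => x xz Sx; apply: wmin; split=> //; exact: ltW.
Qed.

End StrongMaximum.

(** * Orientation and separation *)

Section LocallyConstant.

Lemma connected_locally_constant (T : topologicalType) (A P : set T) :
  connected A -> (forall x, A x -> \forall z \near x, A z -> (P z <-> P x)) ->
  forall x y, A x -> A y -> P x -> P y.
Proof.
move=> cA lP x y Ax Ay Px.
have E : A `&` P = A.
  apply: cA; first by exists x.
    exists (interior [set z | A z -> P z]); first exact: open_interior.
    apply/seteqP; split=> z [Az H]; split=> //.
      by apply: filterS (lP _ Az) => w Hw Aw; apply/Hw.
    exact: (interior_subset H Az).
  exists (~` interior [set z | A z -> ~ P z]).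
    by apply: open_closedC; exact: open_interior.
  apply/seteqP; split=> z [Az H]; split=> //.
    by move=> /interior_subset/(_ Az); apply.
  apply: contrapT => nPz; apply: H.
  by apply: filterS (lP _ Az) => w Hw Aw /(Hw Aw)/nPz.
by have : (A `&` P) y by [rewrite E]; case.
Qed.

Lemma segment_locally_constant (R : realType) (h : R -> bool) :
  (forall t : R, 0 <= t <= 1 -> exists c, \forall s \near t, h s = c) -> h 0 = h 1.
Proof.
move=> hl.
have cl : connected `[(0 : R), 1]%classic.
  by apply/connected_intervalP; exact: interval_is_interval.
have lP (x : R) : `[(0 : R), 1]%classic x -> \forall z \near x,
    `[(0 : R), 1]%classic z -> ([set t | h t = h 0] z <-> [set t | h t = h 0] x).
  rewrite /= in_itv/= => /hl[c hc]; have hx := nbhs_singleton hc.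
  by apply: filterS hc => s hs _; rewrite /= hs hx.
have i0 : `[(0 : R), 1]%classic 0 by rewrite /= in_itv/= lexx ler01.
have i1 : `[(0 : R), 1]%classic 1 by rewrite /= in_itv/= lexx ler01.
exact: esym (connected_locally_constant cl lP i0 i1 erefl).
Qed.

End LocallyConstant.

Section Monodromy.
Context {R : realType} {m : nat}.
Notation V := 'rV[R]_m.+1.
Implicit Types (x y z p u v w : V) (A B H : set V) (G : V -> bool).

Definition convex_set A := forall x y (t : R), A x -> A y -> 0 <= t <= 1 ->
  A (x + t *: (y - x)).

Variable g : V -> V -> bool.

(** [g x] is a two-valued function near [x], which matters only up to the exchange
    of its values. *)
Definition agrees_at G x := exists c, \forall z \near x, G z = g x z (+) c.

Lemma agrees_unique A B G1 G2 w : convex_set A -> convex_set B ->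
  (forall x, A x -> agrees_at G1 x) -> (forall x, B x -> agrees_at G2 x) ->
  A w -> B w -> G1 w = G2 w -> forall x, A x -> B x -> G1 x = G2 x.
Proof.
move=> cA cB gA gB Aw Bw Gw x Ax Bx.
pose h (t : R) := G1 (w + t *: (x - w)) (+) G2 (w + t *: (x - w)).
suff : h 0 = h 1.
  rewrite /h scale0r addr0 Gw addbb scale1r subrKC => /esym.
  by case: (G1 x) (G2 x) => -[].
apply: segment_locally_constant => t t01.
have [c1 h1] := gA _ (cA _ _ _ Aw Ax t01).
have [c2 h2] := gB _ (cB _ _ _ Bw Bx t01).
exists (c1 (+) c2).
have lc : {for t, continuous (fun s : R => w + s *: (x - w))}.
  apply: (@is_derive_continuous R _ _ _ (x - w)).
  apply: is_derive_coordP => i.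
  have -> : (fun s : R => (w + s *: (x - w)) 0 i) = (fun s : R => w 0 i + (x - w) 0 i * s).
    by apply/funext => s; rewrite !mxE; ring.
  by apply: is_derive_eq; rewrite /GRing.scale/=; ring.
have n1 : \forall s \near t, G1 (w + s *: (x - w)) =
    g (w + t *: (x - w)) (w + s *: (x - w)) (+) c1 := lc _ h1.
have n2 : \forall s \near t, G2 (w + s *: (x - w)) =
    g (w + t *: (x - w)) (w + s *: (x - w)) (+) c2 := lc _ h2.
move: n1 n2; apply: filterS2 => s e1 e2.
by rewrite /h e1 e2; case: (g _ _) c1 c2 {h1 h2 e1 e2} => -[] [].
Qed.

Lemma agrees_xorb G x c : agrees_at G x -> agrees_at (fun z => G z (+) c) x.
Proof. by move=> [d hd]; exists (d (+) c); apply: filterS hd => z ->; rewrite addbA. Qed.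

Lemma agrees_glue A B G1 G2 w : convex_set A -> convex_set B -> open A -> open B ->
  (forall x, A x -> agrees_at G1 x) -> (forall x, B x -> agrees_at G2 x) ->
  A w -> B w -> exists G, forall x, A x \/ B x -> agrees_at G x.
Proof.
move=> cA cB oA oB gA gB Aw Bw.
pose G3 z := G2 z (+) (G1 w (+) G2 w).
have gB3 x : B x -> agrees_at G3 x by move=> /gB; exact: agrees_xorb.
have G3w : G1 w = G3 w by rewrite /G3; case: (G1 w) (G2 w) => -[].
have AB := agrees_unique cA cB gA gB3 Aw Bw G3w.
exists (fun z => if asbool (A z) then G1 z else G3 z) => x [Ax|Bx].
  have [c hc] := gA _ Ax; exists c.
  move: hc (open_nbhs_nbhs (conj oA Ax)); apply: filterS2 => z hz Az.
  by case: asboolP.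
have [c hc] := gB3 _ Bx; exists c.
move: hc (open_nbhs_nbhs (conj oB Bx)); apply: filterS2 => z hz Bz.
by case: asboolP => // Az; rewrite AB.
Qed.

(** Finite unions of balls are not convex; neighborhoods of segments are. *)
Definition tube (x0 v : V) (t d : R) : set V :=
  [set z | exists2 s : R, 0 <= s <= t &
     dot (z - (x0 + s *: v)) (z - (x0 + s *: v)) < d].

Lemma tube_convex x0 v t d : convex_set (tube x0 v t d).
Proof.
move=> x y a [s1 /andP[s10 s1t] h1] [s2 /andP[s20 s2t] h2] a01.
have /andP[a0 a1] := a01.
exists (s1 + a * (s2 - s1)).
  have -> : s1 + a * (s2 - s1) = (1 - a) * s1 + a * s2 by ring.
  have b1 : 0 <= 1 - a by rewrite subr_ge0.
  rewrite addr_ge0 ?mulr_ge0//=.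
  have -> : t = (1 - a) * t + a * t by ring.
  by rewrite lerD// ler_wpM2l.
rewrite -[X in dot (X - _)]addr0 -[X in dot _ (X - _)]addr0.
have := @ball_segment R m 0 (x - (x0 + s1 *: v)) (y - (x0 + s2 *: v)) d a a01.
rewrite !subr0 => /(_ h1 h2).
suff -> : x - (x0 + s1 *: v) + a *: (y - (x0 + s2 *: v) - (x - (x0 + s1 *: v))) =
  x + a *: (y - x) + 0 - (x0 + (s1 + a * (s2 - s1)) *: v) by [].
by apply/rowP => i; rewrite !mxE; ring.
Qed.

Lemma tube_open x0 v t d : open (tube x0 v t d).
Proof.
apply/open_dotP => z [s st hz].
have /near_dotP[r r0 hr] := continuous_near_lt (@continuous_sqdist R m (x0 + s *: v) z) hz.
by exists r => // x /hr; exists s.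
Qed.

Lemma convex_setI A B : convex_set A -> convex_set B -> convex_set (A `&` B).
Proof. by move=> cA cB x y t [Ax Bx] [Ay By] t01; split; [exact: cA|exact: cB]. Qed.

(** Local determinations extend along segments from a base point, through chains
    of balls; two extensions agree wherever both are defined, because the
    intersections of convex sets are connected. This replaces the simple
    connectedness of [H] by its convexity. *)
Lemma monodromy H x0 : convex_set H -> open H -> H x0 ->
  (forall x, H x -> exists2 r : R, 0 < r & forall y, H y -> dot (y - x) (y - x) < r ->
     agrees_at (g x) y) ->
  exists G, forall x, H x -> agrees_at G x.
Proof.
move=> cH oH Hx0 coh.
have ext x : H x -> exists A G, [/\ convex_set A, open A, A x0, A x &
    (forall y, A y -> agrees_at G y) /\ G x0 = false].
  move=> Hx; pose v := x - x0.
  pose E := [set t : R | 0 <= t <= 1 /\ exists2 d : R, 0 < d &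
     exists G, forall y, (tube x0 v t d `&` H) y -> agrees_at G y].
  have Hseg t : 0 <= t <= 1 -> H (x0 + t *: v) by exact: cH.
  have E0 : E 0.
    split; first by rewrite lexx ler01.
    have [r r0 hr] := coh _ Hx0; exists r => //; exists (g x0) => y [[s]].
    move=> /andP[s0 s1]; have -> : s = 0 by apply/eqP; rewrite eq_le s0 s1.
    by rewrite scale0r addr0 => yr Hy; exact: hr.
  have supE : has_sup E by split; [exists 0|exists 1 => t [/andP[]]].
  pose t1 := sup E.
  have t10 : 0 <= t1 by apply: sup_upper_bound.
  have t11 : t1 <= 1 by apply: sup_le_ub; [exists 0|move=> t [/andP[]]].
  have [r r0 hr] := coh _ (Hseg t1 (introT andP (conj t10 t11))).
  pose n := dot v v + 1.
  have n0 : 0 < n by rewrite ltr_wpDl// dot_ge0.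
  pose e := Num.min 1 (r / (16 * n)).
  have e0 : 0 < e by rewrite lt_min ltr01 divr_gt0// mulr_gt0.
  have e1 : e <= 1 by rewrite ge_min lexx.
  have en : e * (16 * n) <= r by rewrite -ler_pdivlMr ?mulr_gt0// ge_min lexx orbT.
  have [t [t01 [d d0 [G hG]]] te] := sup_adherent e0 supE.
  have tt1 : t <= t1 by apply: sup_upper_bound => //; split=> //; exists d => //; exists G.
  pose t2 := Num.min 1 (t1 + e).
  have t20 : 0 <= t2 by rewrite le_min ler01 addr_ge0// ltW.
  have E2 : E t2.
    split; first by rewrite t20 ge_min lexx.
    pose B := [set z : V | dot (z - (x0 + t1 *: v)) (z - (x0 + t1 *: v)) < r].
    have oB : open B.
      apply/open_dotP => z hz.
      exact/near_dotP/(continuous_near_lt (@continuous_sqdist R m (x0 + t1 *: v) z) hz).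
    have cB : convex_set B by move=> a b s Ba Bb s01; exact: ball_segment.
    have near_t1 (s : R) : t <= s <= t2 -> dot (x0 + s *: v - (x0 + t1 *: v)) (x0 + s *: v - (x0 + t1 *: v)) <= r / 16.
      move=> /andP[ts st2].
      have -> : x0 + s *: v - (x0 + t1 *: v) = (s - t1) *: v.
        by apply/rowP => i; rewrite !mxE; ring.
      have s1 : s <= t1 + e by apply: le_trans st2 _; rewrite ge_min lexx orbT.
      have s2 : t1 - e <= s by apply: le_trans ts; exact: ltW.
      have s3 : (s - t1) ^+ 2 <= e.
        rewrite -real_normK ?num_real// expr2.
        have : `|s - t1| <= e by rewrite ler_norml; move: s1 s2; clear; lra.
        by move=> h; apply: le_trans (_ : e * e <= _); [exact: ler_pM|rewrite ler_piMl// ltW].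
      rewrite dotZl dotZr mulrA -expr2.
      have : (s - t1) ^+ 2 * dot v v <= e * n.
        by rewrite ler_pM ?sqr_ge0 ?dot_ge0// /n; clear; lra.
      by move: en; clear; lra.
    have Bt : B (x0 + t *: v).
      apply: le_lt_trans (near_t1 t _) _; last by move: r0; clear; lra.
      rewrite lexx le_min; case/andP: t01 => _ ->.
      by rewrite (le_trans tt1)// lerDl ltW.
    have At : tube x0 v t d (x0 + t *: v).
      by exists t; [rewrite lexx andbT; case/andP: t01|rewrite subrr dot0l].
    have Ht : H (x0 + t *: v) by exact: Hseg.
    have gB : forall y, (B `&` H) y -> agrees_at (g (x0 + t1 *: v)) y.
      by move=> y [By Hy]; exact: hr.
    have [G' hG'] := agrees_glue (convex_setI (@tube_convex x0 v t d) cH)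
      (convex_setI cB cH) (openI (@tube_open x0 v t d) oH) (openI oB oH)
      hG gB (conj At Ht) (conj Bt Ht).
    have d20 : 0 < Num.min d (r / 4) by rewrite lt_min d0 divr_gt0.
    exists (Num.min d (r / 4)) => //; exists G' => y [[s /andP[s0 st2] ys] Hy].
    apply: hG'; move: ys; rewrite lt_min => /andP[yd yr].
    have [st|ts] := leP s t; [left|right]; split=> //; first by exists s => //; rewrite s0.
    rewrite /B/= -(subrKA (x0 + s *: v)); apply: le_lt_trans (dotD_le _ _) _.
    have := near_t1 s; rewrite (ltW ts) st2 => /(_ isT).
    by move: yr r0; clear; lra.
  have t2t1 : t2 <= t1 by apply: sup_upper_bound.
  have {}t11 : t1 = 1.
    apply/eqP; rewrite eq_le t11 /=; move: t2t1; rewrite ge_min => /orP[//|].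
    by move: e0; clear; lra.
  have [_ [d2 d20 [G2 hG2]]] : E 1.
    suff <- : t2 = 1 by [].
    by apply/eqP; rewrite eq_le ge_min lexx /= le_min lexx t11 lerDl ltW.
  exists (tube x0 v 1 d2 `&` H), (fun z => G2 z (+) G2 x0); split.
  - exact: convex_setI (@tube_convex x0 v 1 d2) cH.
  - exact: openI (@tube_open x0 v 1 d2) oH.
  - split=> //; exists 0; first by rewrite lexx ler01.
    by rewrite scale0r addr0 subrr dot0l.
  - split=> //; exists 1; first by rewrite lexx ler01.
    by rewrite scale1r subrKC subrr dot0l.
  - by split=> [y /hG2|]; [exact: agrees_xorb|rewrite addbb].
pose Aof x := xget setT [set A : set V | exists G, [/\ convex_set A, open A, A x0, A x &
    (forall y, A y -> agrees_at G y) /\ G x0 = false]].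
have AofP x : H x -> exists G, [/\ convex_set (Aof x), open (Aof x), Aof x x0, Aof x x &
    (forall y, Aof x y -> agrees_at G y) /\ G x0 = false].
  move=> /ext [A [G hA]].
  by apply: (@xgetPex _ setT [set A : set V | exists G, [/\ convex_set A, open A, A x0, A x &
    (forall y, A y -> agrees_at G y) /\ G x0 = false]]); exists A, G.
pose Gof x := xget (fun=> false) [set G : V -> bool | (forall y, Aof x y -> agrees_at G y) /\ G x0 = false].
have GofP x : H x -> (forall y, Aof x y -> agrees_at (Gof x) y) /\ Gof x x0 = false.
  move=> /AofP [G [_ _ _ _ hG]].
  by apply: (@xgetPex _ (fun=> false) [set G : V -> bool | (forall y, Aof x y -> agrees_at G y) /\ G x0 = false]); exists G.
exists (fun x => Gof x x) => x Hx.
have [_ [cA oA A0 Ax _]] := AofP _ Hx; have [gA g0] := GofP _ Hx.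
have [c hc] := gA _ Ax; exists c.
move: hc (open_nbhs_nbhs (conj oA Ax)) (open_nbhs_nbhs (conj oH Hx)).
apply: filterS3 => z hz Az Hz; rewrite -hz.
have [_ [cA' _ A0' Az' _]] := AofP _ Hz; have [gA' g0'] := GofP _ Hz.
by apply: (agrees_unique cA' cA gA' gA A0' A0); rewrite ?g0 ?g0'.
Qed.

End Monodromy.

Section Orientation.
Context {R : realType} {m : nat}.
Notation V := 'rV[R]_m.+1.
Implicit Types (x y z p u v w : V) (S U : set V) (nu : V -> V) (f : V -> R).

Lemma halfspace_open : open (@halfspace R m).
Proof.
apply/open_dotP => p hp; apply/near_dotP.
exact: (continuous_near_gt (@continuous_height R m p) hp).
Qed.

Lemma halfspace_convex : convex_set (@halfspace R m).
Proof.
move=> x y t; rewrite /halfspace /height /= => hx hy /andP[t0 t1]; rewrite !mxE.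
have -> : x 0 ord_max + t * (y 0 ord_max - x 0 ord_max) =
  (1 - t) * x 0 ord_max + t * y 0 ord_max by ring.
move: t0; rewrite le_eqVlt => /orP[/eqP <-|t0]; first by rewrite subr0 mul1r mul0r addr0.
by rewrite ltr_wpDl ?mulr_ge0 ?subr_ge0 ?(ltW hx)// mulr_gt0.
Qed.

Lemma proper_complement S x : properly_embedded S -> halfspace x -> ~ S x ->
  \forall z \near x, ~ S z.
Proof.
move=> pS hx nSx.
have /near_dotP[r r0 hr] : \forall z \near x, halfspace z.
  exact: (open_nbhs_nbhs (conj halfspace_open hx)).
pose K := [set z : V | dot (z - x) (z - x) <= r / 2].
have KH : K `<=` @halfspace R m.
  by move=> z zK; apply: hr; apply: le_lt_trans zK _; move: r0; clear; lra.
have cl : closed (S `&` K).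
  apply: compact_closed; first exact: norm_hausdorff.
  by apply: pS => //; exact: compact_ball.
have nx : (~` (S `&` K)) x by move=> [].
have r2 : 0 < r / 2 by rewrite divr_gt0.
move: (open_nbhs_nbhs (conj (closed_openC cl) nx)) (near_dot_lt x r2).
by apply: filterS2 => z nz zK Sz; apply: nz; split=> //; exact: ltW.
Qed.

Definition oriented_level S nu U f : Prop :=
  level_eq S U f /\ forall y, S y -> U y -> 0 < dot (enormal nu y) (grad f y).

Lemma oriented_levelP S nu p : C2_hypersurface S -> unit_normal S nu -> S p ->
  exists U f, oriented_level S nu U f /\ U p.
Proof.
move=> hS hnu Sp; have [SH _] := hS.
have [U [f [lS Up]]] := C2_hypersurface_level hS Sp.
suff main h : level_eq S U h -> 0 < dot (enormal nu p) (grad h p) ->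
    exists U0 f0, oriented_level S nu U0 f0 /\ U0 p.
  have [_] := grad_enormal lS Up Sp (SH _ Sp) hnu.
  rewrite neq_lt dotC => /orP[gn|gp]; last exact: main gp.
  apply: (main (fun x => - f x)); first exact: level_eq_opp.
  by rewrite (grad_opp (level_eq_C1 lS) Up) dotNr oppr_gt0.
move=> lh hp; have [oU _ _ _] := lh.
have gc := C1_grad_continuous (level_eq_C1 lh) Up.
have /near_dotP[r r0 hr] : \forall x \near p, U x /\
    (S x -> dot (enormal nu x) (- grad h x) < 0).
  apply: filterI; first exact: open_nbhs_nbhs.
  apply: (enormal_dot_near_lt hnu Sp (SH _ Sp) (g := fun x => - grad h x)).
    exact: (@cvgN _ _ _ (nbhs p) _ _ _ gc).
  by rewrite dotNr oppr_lt0.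
pose W := [set x : V | dot (x - p) (x - p) < r].
exists W, h; split; last by rewrite /W/= subrr dot0l.
split; last by move=> y Sy /hr[_ /(_ Sy)]; rewrite dotNr oppr_lt0.
apply: (level_eq_sub lh); last by move=> x /hr[].
apply/open_dotP => x xr.
exact/near_dotP/(continuous_near_lt (@continuous_sqdist R m p x) xr).
Qed.

Lemma oriented_level_same S nu U1 f1 U2 f2 p : oriented_level S nu U1 f1 ->
  oriented_level S nu U2 f2 -> U1 p -> U2 p -> S p ->
  \forall z \near p, (0 < f1 z) = (0 < f2 z).
Proof.
move=> [l1 o1] [l2 o2] U1p U2p Sp.
have [oU1 _ _ _] := l1; have [oU2 _ _ _] := l2.
have l1' := level_eq_sub l1 (openI oU1 oU2) (@subIsetl _ U1 U2).
have l2' := level_eq_sub l2 (openI oU1 oU2) (@subIsetr _ U1 U2).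
have [_ _ _ S1] := l1'; have [_ _ _ S2] := l2'.
have Up : (U1 `&` U2) p by [].
have nU := open_nbhs_nbhs (conj (openI oU1 oU2) Up).
have n1 := o1 _ Sp U1p; have n2 := o2 _ Sp U2p; rewrite dotC in n1; rewrite dotC in n2.
have f1p := (S1 _ Up).1 Sp; have f2p := (S2 _ Up).1 Sp.
have := sides (openI oU1 oU2) (level_eq_C1 l1') (level_eq_C1 l2') Up f1p n1 n2.
have := sides (openI oU1 oU2) (level_eq_C1 l2') (level_eq_C1 l1') Up f2p n2 n1.
have H2 : \forall z \near p, f2 z = 0 -> 0 <= f1 z.
  by apply: filterS nU => z Uz /(S2 _ Uz)/(S1 _ Uz) ->.
have H1 : \forall z \near p, f1 z = 0 -> 0 <= f2 z.
  by apply: filterS nU => z Uz /(S1 _ Uz)/(S2 _ Uz) ->.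
move=> /(_ H2) + /(_ H1); apply: filterS2 => z [_ h1] [_ h2].
by rewrite !ltNge; congr (~~ _); apply/idP/idP.
Qed.

(** A properly embedded oriented hypersurface of the halfspace has two sides: the
    locally defined functions [0 < f], where [f] increases along the normal, fit
    together into a function on the whole halfspace, which is simply connected. *)
Lemma side_function S nu (x0 : V) : C2_hypersurface S -> properly_embedded S ->
  unit_normal S nu -> halfspace x0 ->
  exists G : V -> bool,
    (forall x, halfspace x -> ~ S x -> exists c, \forall z \near x, G z = c) /\
    (forall x U f, S x -> oriented_level S nu U f -> U x ->
       \forall z \near x, G z = (0 < f z) (+) G x).
Proof.
move=> hS pS hnu Hx0; have [SH _] := hS.
pose P x (Uf : set V * (V -> R)) := oriented_level S nu Uf.1 Uf.2 /\ Uf.1 x.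
pose fx x := xget (setT, fun=> 0) (P x).
have fxP x : S x -> P x (fx x).
  by move=> /(oriented_levelP hS hnu)[U [f [h Ux]]]; apply: xgetPex; exists (U, f).
pose g x z : bool := if asbool (S x) then 0 < (fx x).2 z else false.
have [|G GP] := monodromy (g := g) halfspace_convex halfspace_open Hx0.
  move=> x Hx; have [Sx|nSx] := pselect (S x); last first.
    have /near_dotP[r r0 hr] := proper_complement pS Hx nSx.
    exists r => // y Hy /hr nSy; exists false.
    apply/near_dotP; exists 1 => // z _.
    by rewrite /g; case: asboolP => // _; case: asboolP.
  have [[lx ox] Ux] := fxP _ Sx; have [oU _ _ SU] := lx.
  have /near_dotP[r r0 hr] := open_nbhs_nbhs (conj oU Ux).
  exists r => // y Hy /hr Uy; have [Sy|nSy] := pselect (S y).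
    have [[ly oy] Uy'] := fxP _ Sy; exists false.
    have := oriented_level_same (conj lx ox) (conj ly oy) Uy Uy' Sy.
    by apply: filterS => z; rewrite /g; case: asboolP => // _; case: asboolP => // _ ->; rewrite addbF.
  have fc : {for y, continuous (fx x).2} by exact: (C1_continuous oU (level_eq_C1 lx)).
  have : (fx x).2 y != 0 by apply/eqP => /(SU _ Uy).
  rewrite neq_lt => /orP[fy|fy].
    exists false; apply: filterS (continuous_near_lt fc fy) => z fz.
    rewrite /g; case: asboolP => // _; case: asboolP => // _.
    by rewrite ltNge (ltW fz).
  exists true; apply: filterS (continuous_near_gt fc fy) => z fz.
  by rewrite /g; case: asboolP => // _; case: asboolP.
exists G; split=> [x Hx nSx|x U f Sx of' Ux].
  have [c] := GP _ Hx; rewrite /g; case: asboolP => // _ hc.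
  by exists c; apply: filterS hc => z ->.
have [c hc] := GP _ (SH _ Sx); have [ox Uxx] := fxP _ Sx.
have Gx := nbhs_singleton hc; move: hc Gx; rewrite /g; case: asboolP => // _ hc.
have [[_ _ _ SU] _] := ox; rewrite ((SU _ Uxx).1 Sx) ltxx addFb => ->.
move: hc (oriented_level_same ox of' Uxx Ux Sx).
by apply: filterS2 => z -> ->.
Qed.

(** Near a point of [S] where [S] lies in [{phi >= 0}], the points with
    [phi < 0] are all on the same side of [S], determined by the direction of the
    normal. *)
Lemma side_quad S nu G x (al : R) (b : V) (ga : R) (phi := quad al b ga) :
  C2_hypersurface S -> unit_normal S nu ->
  (forall x U f, S x -> oriented_level S nu U f -> U x ->
       \forall z \near x, G z = (0 < f z) (+) G x) ->
  S x -> (\forall z \near x, S z -> 0 <= phi z) ->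
  (dot (enormal nu x) (grad phi x) < 0 ->
     \forall z \near x, phi z < 0 -> G z = ~~ G x) /\
  (0 < dot (enormal nu x) (grad phi x) ->
     \forall z \near x, phi z < 0 -> G z = G x).
Proof.
move=> hS hnu GP Sx Sphi.
have [U [f [[lf of'] Ux]]] := oriented_levelP hS hnu Sx.
have [oU fC gn SU] := lf; have f1 := level_eq_C1 lf.
have p1 : Ck 1 U phi by exact: (C2_C1 oU (quad_C2 _ _ _ oU)).
have nU := open_nbhs_nbhs (conj oU Ux).
have Gx := GP _ _ _ Sx (conj lf of') Ux.
have fx := (SU _ Ux).1 Sx; have fN := of' _ Sx Ux.
split=> pN.
  have l2 := level_eq_opp lf; have fx' : - f x = 0 by rewrite fx oppr0.
  have fN' : 0 < dot (grad (fun x => - f x) x) (- enormal nu x).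
    by rewrite (grad_opp f1 Ux) dotNl dotNr opprK dotC.
  have pN' : 0 < dot (grad phi x) (- enormal nu x) by rewrite dotNr oppr_gt0 dotC.
  have H0 : \forall z \near x, - f z = 0 -> 0 <= phi z.
    move: nU Sphi; apply: filterS2 => z Uz Sz /eqP; rewrite oppr_eq0 => /eqP fz.
    by apply: Sz; apply/SU.
  move: Gx (sides oU (level_eq_C1 l2) p1 Ux fx' fN' pN' H0).
  by apply: filterS2 => z -> [h _] /h; rewrite oppr_lt0 => ->.
have H0 : \forall z \near x, f z = 0 -> 0 <= phi z.
  by move: nU Sphi; apply: filterS2 => z Uz Sz fz; apply: Sz; apply/SU.
rewrite dotC in fN; rewrite dotC in pN.
move: Gx (sides oU f1 p1 Ux fx fN pN H0).
by apply: filterS2 => z -> [h _] /h fz; rewrite ltNge (ltW fz).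
Qed.

(** The side function is constant along a path which avoids [S], and near each
    point of the connected hypersurface it is positive on the side of the normal.
    So a path from [x] to [y] cannot leave against the normal and arrive along it.
    It consists of the segments from [x] to [e1] and from [e2] to [y], and of a
    connected set between them. *)
Lemma orientation_transport S nu x y e1 e2 (a1 : R) (b1 : V) (g1 a2 : R) (b2 : V) (g2 : R)
    (phi1 := quad a1 b1 g1) (phi2 := quad a2 b2 g2) :
  C2_hypersurface S -> properly_embedded S -> connected S -> unit_normal S nu ->
  S x -> S y -> (\forall z \near x, S z -> 0 <= phi1 z) ->
  (\forall z \near y, S z -> 0 <= phi2 z) ->
  (forall t : R, 0 < t <= 1 -> let z := x + t *: (e1 - x) in
     [/\ halfspace z, ~ S z & phi1 z < 0]) ->
  (forall t : R, 0 < t <= 1 -> let z := y + t *: (e2 - y) in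
     [/\ halfspace z, ~ S z & phi2 z < 0]) ->
  (exists C, [/\ connected C, C e1, C e2 & forall z, C z -> halfspace z /\ ~ S z]) ->
  dot (enormal nu x) (grad phi1 x) < 0 -> ~ 0 < dot (enormal nu y) (grad phi2 y).
Proof.
move=> hS pS cS hnu Sx Sy S1 S2 P1 P2 [C [cC Ce1 Ce2 CS]] N1 N2; have [SH _] := hS.
have [G [GC GS]] := side_function hS pS hnu (SH _ Sx).
have GSc : G x = G y.
  suff : [set z | G z = G x] y by move=> /= ->.
  apply: (connected_locally_constant cS _ Sx Sy) => //= z Sz.
  have [U [f [of' Uz]]] := oriented_levelP hS hnu Sz.
  have [[oU _ _ SU] _] := of'.
  move: (GS _ _ _ Sz of' Uz) (open_nbhs_nbhs (conj oU Uz)).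
  by apply: filterS2 => w -> Uw Sw; rewrite ((SU _ Uw).1 Sw) ltxx addFb.
have linec z w (t : R) : {for t, continuous (fun s : R => z + s *: (w - z))}.
  apply: (@is_derive_continuous R _ _ _ (w - z)).
  apply: is_derive_coordP => i.
  have -> : (fun s : R => (z + s *: (w - z)) 0 i) = (fun s : R => z 0 i + (w - z) 0 i * s).
    by apply/funext => s; rewrite !mxE; ring.
  by apply: is_derive_eq; rewrite /GRing.scale/=; ring.
have seg z w : (forall t : R, 0 <= t <= 1 -> halfspace (z + t *: (w - z)) /\ ~ S (z + t *: (w - z))) ->
    G z = G w.
  move=> H; have := @segment_locally_constant R (fun t => G (z + t *: (w - z))).
  rewrite scale0r addr0 scale1r subrKC; apply=> t /H[Hz nz].
  have [c hc] := GC _ Hz nz; exists c.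
  exact: (linec z w t _ hc).
have start z w (al : R) (b : V) (ga : R) (v : bool) :
    (forall t : R, 0 < t <= 1 -> let y := z + t *: (w - z) in
     [/\ halfspace y, ~ S y & quad al b ga y < 0]) ->
    (\forall y \near z, quad al b ga y < 0 -> G y = v) -> G w = v.
  move=> H nz.
  have : \forall t \near (0 : R), quad al b ga (z + t *: (w - z)) < 0 ->
      G (z + t *: (w - z)) = v.
    have nz' : \forall y \near z + (0 : R) *: (w - z), quad al b ga y < 0 -> G y = v.
      by rewrite scale0r addr0.
    exact: (linec z w 0 _ nz').
  move=> /near0P[s s0 hs].
  pose t := Num.min 1 (s / 2).
  have t0 : 0 < t by rewrite lt_min ltr01 divr_gt0.
  have t1 : t <= 1 by rewrite ge_min lexx.
  have ts : t < s.
    by apply: le_lt_trans (_ : s / 2 < s); [rewrite ge_min lexx orbT|move: s0; clear; lra].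
  have [_ _ q0] := H t (introT andP (conj t0 t1)).
  rewrite -(hs t _ q0) ?gtr0_norm//; apply/esym/seg => k /andP[k0 k1].
  have -> : z + t *: (w - z) + k *: (w - (z + t *: (w - z))) =
     z + (t + k * (1 - t)) *: (w - z) by apply/rowP => i; rewrite !mxE; ring.
  have at0 : 0 <= k * (1 - t) by rewrite mulr_ge0// subr_ge0.
  have at1 : k * (1 - t) <= 1 - t by rewrite ler_piMl// subr_ge0.
  have [|] := H (t + k * (1 - t)) => //.
  by apply/andP; move: t0 at0 at1; clear; lra.
have G1 : G e1 = ~~ G x.
  by apply: (start x e1 a1 b1 g1 _ P1); apply: (side_quad hS hnu GS Sx S1).1.
have G2 : G e2 = G y.
  by apply: (start y e2 a2 b2 g2 _ P2); apply: (side_quad hS hnu GS Sy S2).2.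
have : [set z | G z = G e1] e2.
  apply: (connected_locally_constant cC _ Ce1 Ce2) => //= z Cz.
  have [Hz nSz] := CS _ Cz; have [d hd] := GC _ Hz nSz.
  have hz := nbhs_singleton hd.
  by apply: filterS hd => w -> _; rewrite hz.
by rewrite /= G1 G2 GSc; case: (G y).
Qed.

End Orientation.

(** * Rigidity of a quadric under the path hypothesis *)

Section Rigidity.
Context {R : realType} {m : nat}.
Notation V := 'rV[R]_m.+1.
Implicit Types (x y z p u v w : V) (S U M : set V) (nu : V -> V) (f : V -> R).

Lemma heightZ (a : R) (u : V) : height (a *: u) = a * height u.
Proof. by rewrite /height mxE. Qed.

Lemma heightD (u v : V) : height (u + v) = height u + height v.
Proof. by rewrite /height mxE. Qed.

Lemma height_en : height (en : V) = 1.
Proof. by rewrite /height /en mxE !eqxx. Qed.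

(** The level sets of quadrics are umbilic, with mean curvature read off from the
    last coefficient of the linear part. *)
Lemma mean_curvature_quadric S U f nu p (h al : R) (b : V) (ga : R)
    (q := quad al b ga) (mu := dot (grad q p) (enormal nu p)) : (0 < m)%N ->
  level_eq S U f -> U p -> S p -> 0 < height p -> unit_normal S nu ->
  is_mean_curvature S nu p h -> (\forall x \near p, S x -> q x = 0) ->
  mu * h = height b /\ mu ^+ 2 = dot b b - 4 * al * ga.
Proof.
move=> m0 lS Up Sp hp hnu hh Sq.
have qp : q p = 0 by exact: (nbhs_singleton Sq Sp).
have mn1 : \forall x \near p, S x -> q p <= q x.
  by apply: filterS Sq => x H /H ->; rewrite qp.
have mn2 : \forall x \near p, S x -> quad (- al) (- b) (- ga) p <= quad (- al) (- b) (- ga) x.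
  by apply: filterS Sq => x H /H; rewrite !quad_opp -/q qp => ->.
have [GN T1] := touching m0 lS Up Sp hp hnu hh (quad_taylor al b ga p) mn1.
have [_ T2] := touching m0 lS Up Sp hp hnu hh (quad_taylor (- al) (- b) (- ga) p) mn2.
have N1 := enormal_unit hnu Sp hp.
have gq' : grad (quad (- al) (- b) (- ga)) p = - grad q p.
  by rewrite !grad_quad mulrN scaleNr opprD.
move: T1 T2; rewrite !ptrace_scalar// gq' dotNl -/q -/mu => T1 T2.
have m1 : 0 < m%:R :> R by rewrite ltr0n.
have E : mu * (height (enormal nu p) - h) = 2 * al * height p.
  have e1 : mu * (height (enormal nu p) - h) <= 2 * al * height p.
    by move: T1; rewrite ler_pdivrMr// -!mulrA ler_pM2l// !mulrA.
  have e2 : - mu * (height (enormal nu p) - h) <= 2 * (- al) * height p.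
    by move: T2; rewrite ler_pdivrMr// -!mulrA ler_pM2l// !mulrA.
  by apply/eqP; rewrite eq_le e1 /=; move: e2; clear; lra.
have hG : mu * height (enormal nu p) = 2 * al * height p + height b.
  have : height (grad q p) = height (mu *: enormal nu p) by rewrite -GN.
  by rewrite heightZ grad_quad heightD heightZ => <-.
split; first by rewrite mulrBr hG in E; move: E; clear; lra.
have <- : dot (grad q p) (grad q p) = mu ^+ 2.
  by rewrite {1}GN dotZl (dotC (enormal _ _)) -expr2.
by rewrite sqr_grad_quad -/q qp mulr0 add0r.
Qed.

Lemma quadric_level_eq M (al : R) (b : V) (ga : R) (q := quad al b ga) :
  M = [set x | halfspace x /\ q x = 0] ->
  level_eq M [set x | halfspace x /\ 0 < dot (grad q x) (grad q x)] q.
Proof.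
move=> ME.
have gc x : {for x, continuous (grad q)}.
  exact: (C1_grad_continuous (C2_C1 openT (quad_C2 al b ga openT)) I).
have oU : open [set x | halfspace x /\ 0 < dot (grad q x) (grad q x)].
  apply: openI; first exact: halfspace_open.
  apply/open_dotP => x gx.
  exact/near_dotP/(continuous_near_gt (continuous_dot (gc x) (gc x)) gx).
split=> //; first exact: quad_C2.
  by move=> x [_]; rewrite dot_gt0.
by move=> x [Hx _]; rewrite ME; split=> [[]|].
Qed.

Lemma touching_normal S nu p (al : R) (b : V) (ga : R) (q := quad al b ga) (h : R) :
  (0 < m)%N -> C2_hypersurface S -> unit_normal S nu -> S p ->
  is_mean_curvature S nu p h -> q p = 0 -> (forall x, S x -> 0 <= q x) ->
  0 < dot b b - 4 * al * ga -> dot (enormal nu p) (grad q p) != 0.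
Proof.
move=> m0 hS hnu Sp hh qp qS D0; have [SH _] := hS.
have [U [f [lS Up]]] := C2_hypersurface_level hS Sp.
have mn : \forall x \near p, S x -> q p <= q x.
  by apply/near_dotP; exists 1 => // x _ /qS; rewrite qp.
have [GN _] := touching m0 lS Up Sp (SH _ Sp) hnu hh (quad_taylor al b ga p) mn.
apply: contraTneq D0 => g0.
have := sqr_grad_quad al b ga p; rewrite -/q qp mulr0 add0r => <-.
by rewrite {1}GN -/q (dotC (grad q p)) g0 scale0r dot0l ltxx.
Qed.

(** The touching set is open by the strong maximum principle, and closed since the
    normal at a touching point is one of two opposite unit vectors. *)
Lemma touching_everywhere S nu (al : R) (b : V) (ga H0 : R) (x0 : V)
    (q := quad al b ga) (D := dot b b - 4 * al * ga) :
  (0 < m)%N -> C2_hypersurface S -> properly_embedded S -> connected S ->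
  unit_normal S nu ->
  (forall p, S p -> exists2 h, is_mean_curvature S nu p h & H0 <= h) ->
  0 <= H0 -> 0 < D -> - height b <= H0 * Num.sqrt D ->
  (forall x, S x -> 0 <= q x) -> S x0 -> q x0 = 0 ->
  dot (enormal nu x0) (grad q x0) < 0 ->
  forall x, S x -> q x = 0.
Proof.
move=> m0 hS pS cS hnu hH H00 D0 bH qS Sx0 qx0 Nx0 x Sx; have [SH _] := hS.
have gc z : {for z, continuous (grad q)}.
  exact: (C1_grad_continuous (C2_C1 openT (quad_C2 al b ga openT)) I).
pose P := [set z | q z = 0 /\ dot (enormal nu z) (grad q z) < 0].
suff [] : P x by [].
apply: (connected_locally_constant cS _ Sx0 Sx) => // z Sz.
have qc : {for z, continuous q} by exact: (@quad_continuous _ _ al b ga z).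
have [[qz Nz]|nP] := pselect (P z).
  have h1 := strong_touching m0 hS pS hnu hH H00 D0 bH qS Sz qz Nz.
  have h2 := enormal_dot_near_lt hnu Sz (SH _ Sz) (gc z) Nz.
  move: h1 h2; apply: filterS2 => w h1 h2 Sw; split=> _; split=> //.
  - exact: h1.
  - exact: h2.
have [qz|qz] := eqVneq (q z) 0; last first.
  have qz0 : 0 < q z by rewrite lt_def qz qS.
  apply: filterS (continuous_near_gt qc qz0) => w qw Sw.
  by split=> [[qw0]|/nP//]; move: qw; rewrite qw0 ltxx.
have [h hh _] := hH _ Sz.
have Nz0 := touching_normal m0 hS hnu Sz hh qz qS D0.
have Nz1 : dot (enormal nu z) (- grad q z) < 0.
  rewrite dotNr oppr_lt0; move: Nz0; rewrite -/q neq_lt => /orP[Nn|//].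
  by case: nP.
have gc' : {for z, continuous (fun x => - grad q x)}.
  exact: (@cvgN _ _ _ (nbhs z) _ _ _ (gc z)).
have h2 := enormal_dot_near_lt hnu Sz (SH _ Sz) gc' Nz1.
apply: filterS h2 => w h2 Sw; split=> [[_ Nw]|/nP//].
by have := h2 Sw; rewrite dotNr oppr_lt0 => /(lt_trans Nw); rewrite ltxx.
Qed.

(** Two applications of [sides], to the equations of both sets and to their
    opposites, show that the two zero sets coincide near [p]. *)
Lemma level_set_open S U f p (al : R) (b : V) (ga : R) (q := quad al b ga) :
  level_eq S U f -> U p -> S p ->
  (\forall x \near p, S x -> q x = 0) -> dot (grad f p) (grad q p) != 0 ->
  \forall z \near p, q z = 0 -> S z.
Proof.
move=> lf Up Sp.
suff main (a' : R) (b' : V) (g' : R) (q' := quad a' b' g') :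
    (\forall x \near p, S x -> q' x = 0) -> 0 < dot (grad f p) (grad q' p) ->
    \forall z \near p, q' z = 0 -> S z.
  move=> Sq; rewrite neq_lt => /orP[Nn|Np]; last exact: main.
  have := main (- al) (- b) (- ga); cbv zeta.
  have -> : grad (quad (- al) (- b) (- ga)) p = - grad q p.
    by rewrite !grad_quad mulrN scaleNr opprD.
  rewrite dotNr oppr_gt0 => /(_ _ Nn) H.
  have {}H : \forall z \near p, quad (- al) (- b) (- ga) z = 0 -> S z.
    by apply: H; apply: filterS Sq => z Sz /Sz; rewrite quad_opp -/q => ->; rewrite oppr0.
  by apply: filterS H => z Sz qz; apply: Sz; rewrite quad_opp -/q qz oppr0.
move=> Sq qN.
have [oU fC gn SU] := lf; have f1 := level_eq_C1 lf.
have q1 : Ck 1 U q' by exact: (C2_C1 oU (quad_C2 _ _ _ oU)).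
have nU := open_nbhs_nbhs (conj oU Up).
have fp := (SU _ Up).1 Sp.
have fN : 0 < dot (grad f p) (grad f p) by rewrite dot_gt0 gn.
have z1 : \forall z \near p, f z = 0 -> 0 <= q' z.
  by move: nU Sq; apply: filterS2 => z Uz Sz /(SU _ Uz)/Sz ->.
have z2 : \forall z \near p, - f z = 0 -> 0 <= - q' z.
  move: nU Sq; apply: filterS2 => z Uz Sz /eqP; rewrite oppr_eq0 => /eqP /(SU _ Uz)/Sz ->.
  by rewrite oppr0.
rewrite dotC in qN.
have fp' : - f p = 0 by rewrite fp oppr0.
have fN' : 0 < dot (grad (fun x => - f x) p) (- grad f p).
  by rewrite (grad_opp f1 Up) dotNl dotNr opprK.
have qN' : 0 < dot (grad (fun x => - q' x) p) (- grad f p).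
  by rewrite (grad_opp q1 Up) dotNl dotNr opprK.
have f1' := level_eq_C1 (level_eq_opp lf).
have q1' : Ck 1 U (fun x => - q' x) by exact: Ck_opp.
have := sides oU f1 q1 Up fp fN qN z1.
have := sides oU f1' q1' Up fp' fN' qN' z2.
move: nU; apply: filterS3 => z Uz [_ h1] [_ h2] qz; apply/SU => //.
apply/eqP; rewrite eq_le h2 ?qz//= -oppr_le0; apply: h1.
by rewrite qz oppr0.
Qed.

Lemma quad_shift (al : R) (b : V) (ga d : R) x :
  quad al (b - d *: en) ga x = quad al b ga x - d * height x.
Proof. by rewrite /quad dotBl dotZl (dotC en) dot_en; ring. Qed.

Lemma sqr_shift (b : V) (d : R) : dot (b - d *: en) (b - d *: en) =
  dot b b - height b ^+ 2 + (height b - d) ^+ 2.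
Proof.
by rewrite !dotE !(dotC en) !dot_en height_en; ring.
Qed.

(** The equidistant quadrics have mean curvature [c / sqrt (disc + c^2)], which is
    nondecreasing in [c]. *)
Lemma mean_curvature_monotone (c c0 disc : R) : 0 <= c -> c0 <= c -> 0 <= disc ->
  0 < disc + c ^+ 2 -> c0 <= c / Num.sqrt (disc + c ^+ 2) * Num.sqrt (disc + c0 ^+ 2).
Proof.
move=> c_0 cc0 d0 D0.
have r0 : 0 < Num.sqrt (disc + c ^+ 2) by rewrite sqrtr_gt0.
have r1 : 0 <= Num.sqrt (disc + c0 ^+ 2) by exact: sqrtr_ge0.
have [c00|c00] := lerP c0 0.
  by apply: le_trans c00 _; rewrite mulr_ge0// divr_ge0// ltW.
rewrite mulrAC ler_pdivlMr// -(@ler_pXn2r _ 2)// ?nnegrE ?mulr_ge0 ?(ltW r0) ?(ltW c00)//.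
rewrite !exprMn !sqr_sqrtr//; last exact: ltW.
  rewrite !mulrDr [c0 ^+ 2 * c ^+ 2]mulrC lerD2r ler_wpM2r//.
  by rewrite ler_pXn2r ?nnegrE// ltW.
by rewrite addr_ge0// sqr_ge0.
Qed.

(** From the point [q0] of the quadric [q = 0] one can reach, inside [{q < 0}]
    and avoiding [K], the sublevel set bounded by the equidistant quadric through
    any point [p] of [K], and then [p] itself. *)
Definition escapes (al : R) (b : V) (ga : R) (K : set V) (q0 : V) : Prop :=
  forall p, halfspace p -> K p -> quad al b ga p < 0 ->
    let d := quad al b ga p / height p in
    let q' := quad al (b - d *: en) ga in
    0 < dot b b - 4 * al * ga - height b ^+ 2 + (- height b + d) ^+ 2 /\
    exists e1 e2 C,
     [/\ forall t : R, 0 < t <= 1 -> let z := q0 + t *: (e1 - q0) in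
           [/\ halfspace z, ~ K z & quad al b ga z < 0],
         forall t : R, 0 < t <= 1 -> let z := p + t *: (e2 - p) in
           halfspace z /\ q' z < 0,
         connected C, C e1 /\ C e2 & forall z, C z -> halfspace z /\ q' z < 0].

(** If the hypersurface went strictly beyond the quadric [q = 0], the extremal
    member of the family of equidistant quadrics touching it would contradict the
    strong maximum principle; otherwise the principle applies to [q = 0] itself,
    at the points outside [K]. *)
Lemma quadric_rigidity M S nu (al : R) (b : V) (ga : R) (K : set V) (q0 : V)
    (q := quad al b ga) (D := dot b b - 4 * al * ga) (c := - height b)
    (H0 := c / Num.sqrt D) (disc := D - height b ^+ 2) :
  (0 < m)%N -> M = [set x | halfspace x /\ q x = 0] -> connected M ->
  0 <= c -> 0 < D -> 0 <= disc ->
  C2_hypersurface S -> properly_embedded S -> connected S -> unit_normal S nu ->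
  (forall p, S p -> exists2 h, is_mean_curvature S nu p h & H0 <= h) ->
  K `<=` @halfspace R m -> compact K -> S `\` K = M `\` K ->
  M q0 -> ~ K q0 -> dot (enormal nu q0) (grad q q0) < 0 ->
  escapes al b ga K q0 ->
  S = M.
Proof.
move=> m0 ME cM c0 D0 d0 hS pS cS hnu hH KH cK SM Mq0 nKq0 Nq0 paths.
have [SH _] := hS.
have H00 : 0 <= H0 by rewrite divr_ge0// sqrtr_ge0.
have Dd : D = disc + c ^+ 2 by rewrite /disc /c sqrrN subrK.
have out x : ~ K x -> (S x <-> M x).
  move=> nK; split=> H.
    by have [] : (M `\` K) x by rewrite -SM.
  by have [] : (S `\` K) x by rewrite SM.
have Sq0 : S q0 by apply/out.
have Hq0 := SH _ Sq0.
have qq0 : q q0 = 0 by move: Mq0; rewrite ME => -[].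
have clK : closed K by apply: compact_closed => //; exact: norm_hausdorff.
have nKq : \forall x \near q0, ~ K x by exact: (open_nbhs_nbhs (conj (closed_openC clK) nKq0)).
have Sq : \forall x \near q0, S x -> q x = 0.
  by apply: filterS nKq => x /out H /H; rewrite ME => -[].
have qS : forall x, S x -> 0 <= q x.
  apply: contrapT => /existsNP[x1 /not_implyP[Sx1 /negP]]; rewrite -ltNge => qx1.
  have Kx1 : K x1.
    apply: contrapT => /out H; have := H.1 Sx1; rewrite ME => -[_ qx].
    by move: qx1; rewrite qx ltxx.
  have cSK : compact (S `&` K) by exact: pS.
  have gc : {within (S `&` K), continuous (fun x => q x / height x)}.
    apply: continuous_in_subspaceT => x; rewrite inE => -[/SH hx _].
    apply: (@cvgM _ _ _ (nbhs_filter x)); first exact: (@quad_continuous _ _ al b ga x).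
    apply: (@cvgV _ _ _ (nbhs_filter x)); last exact: continuous_height.
    by rewrite gt_eqF.
  have [p] := EVT_min_rV (ex_intro _ x1 (conj Sx1 Kx1)) cSK gc.
  rewrite inE => -[Sp Kp] pmin.
  have hp : 0 < height p := SH _ Sp.
  pose d := q p / height p.
  have d1 : d < 0.
    have hx1 : 0 < height x1 := SH _ Sx1.
    apply: le_lt_trans (pmin x1 _) _; first by rewrite inE.
    by rewrite pmulr_llt0// invr_gt0.
  have qp0 : q p < 0 by move: d1; rewrite /d pmulr_llt0// invr_gt0.
  pose q' := quad al (b - d *: en) ga.
  have q'E x : q' x = q x - d * height x by exact: quad_shift.
  have [D'0 [e1 [e2 [C [P1 P2 cC [Ce1 Ce2] P3]]]]] := paths _ (SH _ Sp) Kp qp0.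
  rewrite -/d -/c in D'0 P2 P3.
  have q'S x : S x -> 0 <= q' x.
    move=> Sx; have hx : 0 < height x := SH _ Sx; rewrite q'E subr_ge0.
    have [Kx|nK] := pselect (K x).
      by rewrite -ler_pdivlMr//; apply: pmin; rewrite inE.
    have := (out _ nK).1 Sx; rewrite ME => -[_ ->].
    by rewrite pmulr_lle0// ltW.
  have q'p : q' p = 0 by rewrite q'E /d divfK ?subrr// gt_eqF.
  have D'E : dot (b - d *: en) (b - d *: en) - 4 * al * ga = disc + (c + d) ^+ 2.
    by rewrite sqr_shift /disc /D /c; ring.
  have D'1 : 0 < dot (b - d *: en) (b - d *: en) - 4 * al * ga by rewrite D'E.
  have [h hh _] := hH _ Sp.
  have Np0 := touching_normal m0 hS hnu Sp hh q'p q'S D'1.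
  have notS z : halfspace z -> q' z < 0 -> ~ S z.
    by move=> _ qz /q'S; rewrite leNgt qz.
  have Np1 : ~ 0 < dot (enormal nu p) (grad q' p).
    apply: (orientation_transport (S := S) (x := q0) (e1 := e1) (e2 := e2)
      (a1 := al) (b1 := b) (g1 := ga) hS pS cS hnu Sq0 Sp) => //.
    - by apply: filterS Sq => x H /H qx; rewrite -/(q x) qx.
    - by apply/near_dotP; exists 1 => // x _; exact: q'S.
    - move=> t /P1[Hz nKz qz]; split=> // /(out _ nKz); rewrite ME => -[_ qz0].
      by move: qz; rewrite -/(q _) qz0 ltxx.
    - by move=> t /P2[Hz qz]; split=> //; exact: notS.
    - exists C; split=> // z /P3[Hz qz]; split=> //; exact: notS.
  have Np : dot (enormal nu p) (grad q' p) < 0.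
    by move: Np0; rewrite neq_lt => /orP[].
  have bH : - height (b - d *: en) <= H0 * Num.sqrt (dot (b - d *: en) (b - d *: en) - 4 * al * ga).
    have -> : height (b - d *: en) = - (c + d).
      by rewrite -scaleNr heightD heightZ height_en /c; ring.
    rewrite opprK D'E /H0 Dd; apply: mean_curvature_monotone => //.
      by move: d1; clear; lra.
    by rewrite -Dd.
  have := touching_everywhere m0 hS pS cS hnu hH H00 D'1 bH q'S Sp q'p Np Sq0.
  rewrite -/q' q'E qq0 sub0r => /eqP; rewrite oppr_eq0 mulf_eq0.
  have hq0 : 0 < height q0 := Hq0.
  by rewrite (gt_eqF hq0) (lt_eqF d1).
have bH : - height b <= H0 * Num.sqrt D.
  by rewrite /H0 divfK// gt_eqF// sqrtr_gt0.
have Sq1 := touching_everywhere m0 hS pS cS hnu hH H00 D0 bH qS Sq0 qq0 Nq0.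
have SM1 x : S x -> M x by move=> Sx; rewrite ME; split; [exact: SH|exact: Sq1].
apply/seteqP; split=> [|x Mx]; first exact: SM1.
apply: (connected_locally_constant (P := S) cM _ Mq0 Mx Sq0) => z Mz.
have [Sz|nSz] := pselect (S z); last first.
  have Hz : halfspace z by move: Mz; rewrite ME => -[].
  by apply: filterS (proper_complement pS Hz nSz) => w nw _; split.
have [h hh _] := hH _ Sz.
have Nz := touching_normal m0 hS hnu Sz hh (Sq1 _ Sz) qS D0.
have Snear : \forall w \near z, S w -> q w = 0.
  by apply/near_dotP; exists 1 => // w _; exact: Sq1.
have [U [f [lS Uz]]] := C2_hypersurface_level hS Sz.
have [fE k0] := grad_enormal lS Uz Sz (SH _ Sz) hnu.
have Nz' : dot (grad f z) (grad q z) != 0 by rewrite fE dotZl mulf_neq0.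
apply: filterS (level_set_open lS Uz Sz Snear Nz') => w qS' Mw; split=> // _.
by apply: qS'; move: Mw; rewrite ME => -[].
Qed.

End Rigidity.

(** * Paths to the touching point *)

Section Paths.
Context {R : realType} {m : nat}.
Notation V := 'rV[R]_m.+1.
Implicit Types (x y z p u v w : V) (K : set V) (al ga : R) (b : V).

Lemma quad_line al b ga x w (t : R) : quad al b ga (x + t *: w) =
  quad al b ga x + t * dot (grad (quad al b ga) x) w + al * t ^+ 2 * dot w w.
Proof. by rewrite grad_quad /quad !dotE (dotC w x); ring. Qed.

Lemma quad_segment al b ga x y (t : R) : quad al b ga (x + t *: (y - x)) =
  (1 - t) * quad al b ga x + t * quad al b ga y
  - al * t * (1 - t) * dot (y - x) (y - x).
Proof. by rewrite /quad !dotE (dotC y x); ring. Qed.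

Lemma quad_segment_lt0 al b ga x y (t : R) : 0 <= al -> quad al b ga x <= 0 ->
  quad al b ga y < 0 -> 0 < t <= 1 -> quad al b ga (x + t *: (y - x)) < 0.
Proof.
move=> a0 qx qy /andP[t0 t1]; rewrite quad_segment.
have h1 : (1 - t) * quad al b ga x <= 0 by rewrite mulr_ge0_le0// subr_ge0.
have h2 : t * quad al b ga y < 0 by rewrite pmulr_rlt0.
have h3 : 0 <= al * t * (1 - t) * dot (y - x) (y - x).
  by rewrite !mulr_ge0 ?dot_ge0 ?subr_ge0// ltW.
by move: h1 h2 h3; clear; lra.
Qed.

Lemma continuous_line z w : continuous (fun s : R => z + s *: w).
Proof.
by move=> t; exact: is_derive_continuous (is_derive_affine z w t).
Qed.

Lemma convex_connected (A : set V) : convex_set A -> connected A.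
Proof.
move=> cA; have [->|/set0P[x0 Ax0]] := eqVneq A set0; first exact: connected0.
pose I x := (fun s : R => x0 + s *: (x - x0)) @` `[0, 1]%classic.
have -> : A = \bigcup_(x in A) I x.
  apply/seteqP; split=> [x Ax|x [y Ay [t]]].
    exists x => //; exists 1; first by rewrite /= in_itv/= lexx ler01.
    by rewrite scale1r subrKC.
  by rewrite /= in_itv/= => t01 <-; exact: cA.
apply: bigcup_connected.
  exists x0 => x Ax; exists 0; first by rewrite /= in_itv/= lexx ler01.
  by rewrite scale0r addr0.
move=> x Ax; apply: connected_continuous_connected.
  by apply/connected_intervalP; exact: interval_is_interval.
by apply: continuous_subspaceT; exact: continuous_line.
Qed.

Definition eta0 : V := delta_mx 0 ord0.

Lemma eta0_height : (0 < m)%N -> height eta0 = 0.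
Proof.
move=> m0; rewrite /height /eta0 mxE /=.
by rewrite -val_eqE /= eqn0Ngt m0.
Qed.

Lemma eta0_unit : dot eta0 eta0 = 1.
Proof. by rewrite /eta0 dot_delta mxE !eqxx. Qed.

Lemma halfspace_line x w (t : R) : halfspace x -> height w = 0 ->
  halfspace (x + t *: w).
Proof. by rewrite /halfspace /= heightD heightZ => hx ->; rewrite mulr0 addr0. Qed.

Lemma heightB u v : height (u - v) = height u - height v.
Proof. by rewrite -scaleN1r heightD heightZ mulN1r. Qed.

Lemma convex_halfspace_ge u (T : R) : convex_set [set z : V | halfspace z /\ T <= dot z u].
Proof.
move=> x y t [Hx Tx] [Hy Ty] t01; split; first exact: halfspace_convex.
have /andP[t0 t1] := t01; rewrite dotDl dotZl dotBl.
have -> : dot x u + t * (dot y u - dot x u) = (1 - t) * dot x u + t * dot y u by ring.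
have -> : T = (1 - t) * T + t * T by ring.
by rewrite lerD// ler_wpM2l// subr_ge0.
Qed.

(** When the leading coefficient is negative, [{q' < 0}] contains every point far
    from the origin. From [q0] and from [p] one escapes horizontally, in the
    direction in which the quadric decreases, to half-spaces which are connected
    through a third one, high above. *)
Lemma escapes_neg al b ga K (q0 : V) : (0 < m)%N -> al < 0 ->
  (forall p, halfspace p -> K p -> quad al b ga p < 0 ->
     0 < dot b b - 4 * al * ga - height b ^+ 2
       + (- height b + quad al b ga p / height p) ^+ 2) ->
  halfspace q0 -> quad al b ga q0 = 0 -> (forall z, K z -> height q0 < height z) ->
  escapes al b ga K q0.
Proof.
move=> m0 a0 D' Hq0 qq0 Kh p Hp Kp qp d q'; split; first exact: D'.
have hp : 0 < height p := Hp.
have na0 : 0 < - al by rewrite oppr_gt0.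
have q'E x : q' x = quad al b ga x - d * height x by exact: quad_shift.
have q'p : q' p = 0 by rewrite q'E /d divfK ?subrr// gt_eqF.
(* where the term [al |x|^2] dominates *)
pose b' := b - d *: (en : V).
pose B := dot b' b' / (2 * - al) + `|ga|.
have B0 : 0 <= B by rewrite addr_ge0// divr_ge0 ?dot_ge0// mulr_ge0// ltW.
pose T := 1 + B * 2 / - al.
have T1 : 1 <= T by rewrite lerDl divr_ge0 ?mulr_ge0// ltW.
have T0 : 0 < T by exact: lt_le_trans T1.
have far x : T <= dot x x -> q' x < 0.
  move=> h2.
  have h1 : dot b' x <= - al / 2 * dot x x + dot b' b' / (2 * - al).
    have := dot_ge0 (b' + al *: x).
    have -> (u : V) : dot (u + al *: x) (u + al *: x) =
        dot u u + 2 * al * dot u x + al ^+ 2 * dot x x.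
      by rewrite !dotE (dotC x u); ring.
    move=> h; rewrite -(ler_pM2l (_ : 0 < 2 * - al)) ?mulr_gt0//.
    have -> : 2 * - al * (- al / 2 * dot x x + dot b' b' / (2 * - al)) =
       al ^+ 2 * dot x x + dot b' b' by field; rewrite ?oppr_eq0 lt_eqF.
    by move: h; clear; lra.
  have h3 : - al / 2 * T <= - al / 2 * dot x x by rewrite ler_pM2l// divr_gt0.
  have h4 : - al / 2 * T = - al / 2 + B by rewrite /T; field; rewrite ?oppr_eq0 lt_eqF.
  have := ler_norm ga; rewrite /q' /quad -/q' -/b'.
  by move: h1 h3 h4 na0; rewrite /B; clear; lra.
pose A u := [set z : V | halfspace z /\ T <= dot z u].
have q'A u z : dot u u = 1 -> A u z -> halfspace z /\ q' z < 0.
  move=> u1 [Hz Tz]; split=> //; apply: far.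
  have := cauchy_schwarz z u; rewrite u1 mulr1; apply: le_trans.
  have : T ^+ 2 <= dot z u ^+ 2 by rewrite ler_pXn2r ?nnegrE ?(ltW T0)// (le_trans (ltW T0)).
  by apply: le_trans; rewrite expr2 ler_peMl// ltW.
have uE u : u = eta0 \/ u = - eta0 -> [/\ dot u u = 1, height u = 0 &
    forall z, `|dot z u| = `|dot z eta0|].
  move=> [->|->]; split=> [||z]; rewrite ?dotNl ?dotNr ?opprK ?normrN ?eta0_unit ?eta0_height//.
  by rewrite -scaleN1r heightZ eta0_height// mulr0.
have dir (g : V) : exists2 u, u = eta0 \/ u = - eta0 & dot g u <= 0.
  have [h|h] := lerP (dot g eta0) 0; first by exists eta0; [left|].
  by exists (- eta0); [right|rewrite dotNr oppr_le0 ltW].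
have [u1 /[dup] uE1 /uE[u11 hu1 nu1] gu1] := dir (grad (quad al b ga) q0).
have [u2 /[dup] uE2 /uE[u21 hu2 nu2] gu2] := dir (grad q' p).
have en1 : dot (en : V) en = 1 by rewrite dot_en height_en.
have AT u : dot u u = 1 -> height u = 0 -> (A u `&` A en) (T *: (u + en)).
  move=> uu hu; have hh : height (T *: (u + en)) = T.
    by rewrite heightZ heightD hu height_en add0r mulr1.
  split; split; rewrite /halfspace /= ?dot_en ?hh// dotZl dotDl uu.
  by rewrite (dotC en) dot_en hu addr0 mulr1.
pose L := T + `|dot q0 eta0| + `|dot p eta0|.
have L0 : 0 < L by rewrite /L -addrA ltr_wpDr// addr_ge0.
have AL z u : halfspace z -> dot u u = 1 -> height u = 0 -> T <= L - `|dot z u| ->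
    A u (z + L *: u).
  move=> Hz uu hu h; split; first exact: halfspace_line.
  rewrite dotDl dotZl uu mulr1; have := ler_norm (- dot z u); rewrite normrN.
  by move: h; clear; lra.
have line al' (b0 : V) ga' z u (t : R) : al' < 0 -> quad al' b0 ga' z = 0 ->
    dot (grad (quad al' b0 ga') z) u <= 0 -> dot u u = 1 -> 0 < t ->
    quad al' b0 ga' (z + t *: u) < 0.
  move=> al'0 qz gu uu t0; rewrite quad_line qz add0r uu mulr1.
  have : t * dot (grad (quad al' b0 ga') z) u <= 0 by rewrite mulr_ge0_le0// ltW.
  have : al' * t ^+ 2 < 0 by rewrite nmulr_rlt0// exprn_gt0.
  by clear; lra.
have seg z u (t : R) : z + t *: (z + L *: u - z) = z + (t * L) *: u.
  by rewrite (addrC z (_ *: u)) addrK scalerA.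
exists (q0 + L *: u1), (p + L *: u2), (A u1 `|` A en `|` A u2); split.
- move=> t /andP[t0 t1]; rewrite seg => z.
  have hz : height z = height q0 by rewrite /z heightD heightZ hu1 mulr0 addr0.
  split; [exact: halfspace_line|by move=> /Kh; rewrite hz ltxx|].
  by apply: line => //; rewrite mulr_gt0.
- move=> t /andP[t0 t1]; rewrite seg => z; split; first exact: halfspace_line.
  by apply: line => //; rewrite mulr_gt0.
- have cA u : connected (A u) by apply: convex_connected; exact: convex_halfspace_ge.
  apply: connectedU => //.
    by exists (T *: (u2 + en)); have [? ?] := AT _ u21 hu2; split=> //; right.
  by apply: connectedU => //; exists (T *: (u1 + en)); exact: AT.
- split; [left; left|right]; apply: AL => //.
    by rewrite nu1 /L; have := normr_ge0 (dot p eta0); clear; lra.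
  by rewrite nu2 /L; have := normr_ge0 (dot q0 eta0); clear; lra.
- by move=> z [[]|]; exact: q'A.
Qed.

(** For a nonnegative leading coefficient the sublevel sets are convex, and a
    single intermediate point suffices. *)
Lemma escapes_convex al b ga K (q0 : V) : 0 <= al -> halfspace q0 ->
  quad al b ga q0 = 0 ->
  (forall p, halfspace p -> K p -> quad al b ga p < 0 ->
     0 < dot b b - 4 * al * ga - height b ^+ 2
       + (- height b + quad al b ga p / height p) ^+ 2 /\
     exists e, [/\ halfspace e, forall t : R, 0 < t <= 1 -> ~ K (q0 + t *: (e - q0)),
        quad al b ga e < 0 &
        quad al (b - (quad al b ga p / height p) *: en) ga e < 0]) ->
  escapes al b ga K q0.
Proof.
move=> a0 Hq0 qq0 H p Hp Kp qp d q'; have [D' [e [He nK qe q'e]]] := H p Hp Kp qp.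
split=> //; exists e, e, [set e]; split=> //.
- move=> t t01 z; split; last by apply: quad_segment_lt0; rewrite ?qq0.
    by apply: halfspace_convex => //; case/andP: t01 => t0 ->; rewrite ltW.
  exact: nK.
- move=> t t01 z; split.
    by apply: halfspace_convex => //; case/andP: t01 => t0 ->; rewrite ltW.
  apply: quad_segment_lt0 => //; rewrite quad_shift divfK ?subrr//.
  by rewrite gt_eqF.
- exact: connected1.
- by move=> z ->.
Qed.

Lemma compact_height K : K `<=` @halfspace R m -> compact K ->
  exists2 h : R, 0 < h & forall z, K z -> h <= height z.
Proof.
move=> KH cK; have [->|/set0P K0] := eqVneq K set0; first by exists 1.
have [z Kz zmin] := compact_min K0 cK (@continuous_height R m).
by exists (height z) => //; exact: KH.
Qed.

Definition horizontal b : V := b - height b *: en.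

Lemma horizontal_height b : height (horizontal b) = 0.
Proof. by rewrite heightB heightZ height_en mulr1 subrr. Qed.

Lemma dot_horizontal b x : dot b x = dot (horizontal b) x + height b * height x.
Proof. by rewrite /horizontal dotDl dotNl dotZl (dotC en) dot_en subrK. Qed.

Lemma sqr_horizontal b : dot (horizontal b) (horizontal b) = dot b b - height b ^+ 2.
Proof.
rewrite {1}/horizontal dotDl dotNl dotZl (dotC en) dot_en horizontal_height.
by rewrite mulr0 subr0 /horizontal dotBr dotZr dot_en -expr2.
Qed.

Lemma quad_center al b ga x : al != 0 ->
  let u := x + (2 * al)^-1 *: horizontal b in
  quad al b ga x = al * dot u u - (dot b b - 4 * al * ga - height b ^+ 2) / (4 * al)
    + height b * height x.
Proof.
move=> al0 u; have := sqr_horizontal b.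
rewrite /u /quad (dot_horizontal b x).
move: (horizontal b) => B HB.
have -> : dot b b - 4 * al * ga - height b ^+ 2 = dot B B - 4 * al * ga.
  by rewrite HB; ring.
by rewrite !dotE (dotC B x); field.
Qed.

Lemma sqr_height_le u : height u ^+ 2 <= dot u u.
Proof. exact: sqr_coord_le_dot. Qed.

(** A low point of the quadric lies below [K], and so does any horizontal path
    which leaves it. When [al > 0], the point [e] is the center of the horizontal
    slice of the sphere, where [q] and [q'] are smallest at that height. *)
Lemma escapes_low al b ga K : (0 < m)%N -> K `<=` @halfspace R m -> compact K ->
  height b <= 0 ->
  let disc := dot b b - 4 * al * ga - height b ^+ 2 in
  0 < disc \/ [/\ disc = 0, 0 < al & height b < 0] ->
  exists2 h : R, 0 < h & forall q0, halfspace q0 -> quad al b ga q0 = 0 ->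
    height q0 < h -> ~ K q0 /\ escapes al b ga K q0.
Proof.
move=> m0 KH cK c0 disc dP; have [hK hK0 Kh] := compact_height KH cK.
have nK q0 : height q0 < hK -> ~ K q0.
  by move=> h /Kh; rewrite leNgt h.
have [a0|a0|a0] := ltrgt0P al; last first.
- have d0 : 0 < disc by case: dP => // -[_]; rewrite a0 ltxx.
  exists hK => // q0 Hq0 qq0 q0h; split; first exact: nK.
  apply: escapes_convex => //; first by rewrite a0.
  move=> p Hp Kp qp; split; first by rewrite ltr_wpDr// sqr_ge0.
  have hq0 : 0 < height q0 := Hq0; have hp : 0 < height p := Hp.
  set d := quad al b ga p / height p.
  have d1 : d < 0 by rewrite /d pmulr_llt0// invr_gt0.
  have discE : disc = dot (horizontal b) (horizontal b).
    by rewrite sqr_horizontal /disc a0; ring.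
  pose s := (1 - d * height q0) / disc.
  have dh : d * height q0 < 0 by rewrite pmulr_llt0.
  have s0 : 0 < s by rewrite divr_gt0//; move: dh; clear; lra.
  have Eh : height (q0 + (- s) *: horizontal b) = height q0.
    by rewrite heightD heightZ horizontal_height mulr0 addr0.
  have qE : quad al b ga (q0 + (- s) *: horizontal b) = - (s * disc).
    rewrite quad_line qq0 grad_quad a0 !(mulr0, mul0r, scale0r, add0r, addr0).
    by rewrite (dot_horizontal b (horizontal b)) -discE horizontal_height; ring.
  have sd : s * disc = 1 - d * height q0 by rewrite divfK// gt_eqF.
  exists (q0 + (- s) *: horizontal b); split.
  + by rewrite /halfspace /= Eh.
  + move=> t _; apply: nK; rewrite addrAC subrr add0r.
    by rewrite heightD !heightZ horizontal_height !mulr0 addr0.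
  + by rewrite qE; move: dh; rewrite sd; clear; lra.
  + by rewrite quad_shift qE Eh sd; clear; lra.
- have d0 : 0 < disc by case: dP => // -[_ /lt_trans/(_ a0)]; rewrite ltxx.
  exists hK => // q0 Hq0 qq0 q0h; split; first exact: nK.
  apply: escapes_neg => //.
    by move=> p Hp Kp qp; rewrite ltr_wpDr// sqr_ge0.
  by move=> z /Kh; exact: lt_le_trans.
have d0 : 0 <= disc by case: dP => [/ltW//|[->]].
have [h1 h10 h1P] : exists2 h1 : R, 0 < h1 & forall h, 0 < h < h1 ->
    al * h ^+ 2 - disc / (4 * al) + height b * h < 0.
  have [d1|[_ _ b1]] := dP.
    exists (Num.sqrt disc / (2 * al)); first by rewrite divr_gt0 ?sqrtr_gt0// mulr_gt0.
    move=> h /andP[hp hh].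
    have : h ^+ 2 < (Num.sqrt disc / (2 * al)) ^+ 2.
      by rewrite ltr_pXn2r ?nnegrE//; [exact: ltW|apply: ltW; apply: lt_trans hh].
    rewrite expr_div_n sqr_sqrtr// -(ltr_pM2l a0).
    have -> : al * (disc / (2 * al) ^+ 2) = disc / (4 * al) by field; rewrite gt_eqF.
    have : height b * h <= 0 by rewrite mulr_le0_ge0// ltW.
    by clear; lra.
  exists (- height b / al); first by rewrite divr_gt0// oppr_gt0.
  move=> h /andP[hp]; rewrite ltr_pdivlMr// => hh.
  have : h * (h * al + height b) < 0 by rewrite pmulr_rlt0//; move: hh; clear; lra.
  have : 0 <= disc / (4 * al) by rewrite divr_ge0// mulr_ge0// ltW.
  by clear; lra.
exists (Num.min hK h1); first by rewrite lt_min hK0.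
move=> q0 Hq0 qq0; rewrite lt_min => /andP[q0h q0h1]; split; first exact: nK.
apply: escapes_convex => //; first exact: ltW.
have hq0 : 0 < height q0 := Hq0.
move=> p Hp Kp qp; have hp : 0 < height p := Hp.
set d := quad al b ga p / height p.
have aneq : al != 0 by rewrite gt_eqF.
have q0p : height q0 < height p by apply: lt_le_trans (Kh _ Kp).
have c0p : al * height p - disc / (4 * al) / height p <= - height b + d.
  rewrite /d (quad_center b ga p aneq) -/disc.
  set u := p + _.
  have hu : height u = height p.
    by rewrite /u heightD heightZ horizontal_height mulr0 addr0.
  have := sqr_height_le u; rewrite hu -(ler_pM2l a0) => hh.
  have -> : - height b + (al * dot u u - disc / (4 * al) + height b * height p) / height p
    = (al * dot u u - disc / (4 * al)) / height p by field; rewrite aneq gt_eqF.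
  have -> : al * height p - disc / (4 * al) / height p =
    (al * height p ^+ 2 - disc / (4 * al)) / height p by field; rewrite aneq gt_eqF.
  by rewrite ler_pM2r ?invr_gt0// lerB.
split.
  have [d1|[d1 _ _]] := dP; first by rewrite ltr_wpDr// sqr_ge0.
  rewrite -/disc d1 add0r exprn_gt0//; apply: lt_le_trans c0p.
  by rewrite d1 !mul0r subr0 mulr_gt0.
pose e := - ((2 * al)^-1 *: horizontal b) + height q0 *: en.
have eh : height e = height q0.
  by rewrite /e heightD -scaleNr !heightZ horizontal_height height_en mulr0 add0r mulr1.
have qe : quad al b ga e = al * height q0 ^+ 2 - disc / (4 * al) + height b * height q0.
  rewrite (quad_center b ga e aneq) -/disc eh.
  have -> : e + (2 * al)^-1 *: horizontal b = height q0 *: en by rewrite /e addrAC addNr add0r.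
  by rewrite dotZl dotZr dot_en height_en; ring.
exists e; split.
- by rewrite /halfspace /= eh.
- by move=> t _; apply: nK; rewrite heightD heightZ heightB eh subrr mulr0 addr0.
- by rewrite qe h1P// hq0.
- rewrite quad_shift qe eh.
  have h2 : (al * height p - disc / (4 * al) / height p) * height q0 <= (- height b + d) * height q0.
    by rewrite ler_pM2r.
  have h3 : 0 < al * height q0 * (height p - height q0).
    by rewrite !mulr_gt0// subr_gt0.
  have h4 : disc / (4 * al) / height p * height q0 <= disc / (4 * al).
    rewrite -mulrA ler_piMr//; first by rewrite divr_ge0// mulr_ge0// ltW.
    by rewrite mulrC ler_pdivrMr// mul1r ltW.
  by move: h2 h3 h4; clear; lra.
Qed.

(** The quadric has points of arbitrarily small height because the nonnegativity
    of [disc] means that it reaches the boundary [{x_n = 0}]. *)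
Lemma low_points al b ga (h0 : R) : (0 < m)%N -> height b <= 0 ->
  let disc := dot b b - 4 * al * ga - height b ^+ 2 in
  0 < disc \/ [/\ disc = 0, 0 < al & height b < 0] -> 0 < h0 ->
  exists q0, [/\ halfspace q0, quad al b ga q0 = 0 & height q0 < h0].
Proof.
move=> m0 c0 disc dP h00; have [a0|a0] := eqVneq al 0.
  have d0 : 0 < disc by case: dP => // -[_]; rewrite a0 ltxx.
  have discE : disc = dot (horizontal b) (horizontal b).
    by rewrite sqr_horizontal /disc a0; ring.
  pose q0 := ((- height b * (h0 / 2) - ga) / disc) *: horizontal b + (h0 / 2) *: en.
  have q0h : height q0 = h0 / 2.
    by rewrite heightD !heightZ horizontal_height height_en mulr0 add0r mulr1.
  exists q0; split; rewrite ?/halfspace /= ?q0h; first by rewrite divr_gt0.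
    rewrite /quad a0 mul0r add0r (dot_horizontal b q0) q0h /q0 dotDr !dotZr -discE dot_en horizontal_height.
    by rewrite divfK ?gt_eqF//; ring.
  by move: h00; clear; lra.
have [h [hp hh hr]] : exists h : R, [/\ 0 < h, h < h0 &
    0 <= disc / (4 * al ^+ 2) - h ^+ 2 - height b * h / al].
  have [d1|[d1 a1 b1]] := dP.
    pose A := disc / (4 * al ^+ 2).
    have A0 : 0 < A by rewrite divr_gt0// mulr_gt0// exprn_even_gt0.
    pose B := 1 + `|height b / al|.
    have B0 : 0 < B by rewrite ltr_wpDr// normr_ge0.
    exists (Num.min (Num.min 1 (h0 / 2)) (A / B)).
    set h := Num.min _ _.
    have [h1 [h2 h3]] : h <= 1 /\ h <= h0 / 2 /\ h <= A / B.
      by rewrite /h !ge_min !lexx !orbT.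
    have hp : 0 < h by rewrite /h !lt_min ltr01 (divr_gt0 A0 B0) (divr_gt0 h00).
    split=> //; first by move: h2 h00; clear; lra.
    have : h * B <= A by rewrite -ler_pdivlMr.
    have : h ^+ 2 <= h by rewrite expr2 ger_pMr.
    have : h * (height b / al) <= h * `|height b / al| by rewrite ler_pM2l// ler_norm.
    by rewrite -/A /B; clear; lra.
  exists (Num.min (h0 / 2) (- height b / al)).
  set h := Num.min _ _.
  have b2 : 0 < - height b / al by rewrite divr_gt0// oppr_gt0.
  have [h2 h3] : h <= h0 / 2 /\ h <= - height b / al.
    by rewrite /h !ge_min !lexx !orbT.
  have hp : 0 < h by rewrite /h !lt_min !divr_gt0//= oppr_gt0.
  split=> //; first by move: h2 h00; clear; lra.
  have : h ^+ 2 <= h * (- height b / al) by rewrite expr2 ler_pM2l.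
  by rewrite d1; clear; lra.
set r2 := _ - _ - _ in hr.
pose q0 := - ((2 * al)^-1 *: horizontal b) + (Num.sqrt r2 *: eta0 + h *: en).
have q0h : height q0 = h.
  rewrite !heightD -scaleNr !heightZ horizontal_height height_en eta0_height//.
  by rewrite !mulr0 !add0r mulr1.
exists q0; split; rewrite ?/halfspace /= ?q0h//.
rewrite (quad_center b ga q0 a0) -/disc q0h.
have -> : q0 + (2 * al)^-1 *: horizontal b = Num.sqrt r2 *: eta0 + h *: en.
  by rewrite /q0 addrAC addNr add0r.
rewrite !dotDl !dotDr !dotZl !dotZr eta0_unit (dotC en) !dot_en height_en.
rewrite eta0_height// !mulr0 addr0 add0r !mulr1 -!expr2 sqr_sqrtr// /r2.
by field.
Qed.

(** A horizontal hyperplane has no low points. It is left upwards, from a point so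
    far away that its vertical line avoids [K]. *)
Lemma escapes_horizontal b ga K : (0 < m)%N -> K `<=` @halfspace R m -> compact K ->
  dot b b = height b ^+ 2 -> height b < 0 -> 0 < ga ->
  exists q0, [/\ halfspace q0, quad 0 b ga q0 = 0, ~ K q0 & escapes 0 b ga K q0].
Proof.
move=> m0 KH cK bb b0 ga0.
have hb : horizontal b = 0.
  by apply/eqP; rewrite -dot_eq0 sqr_horizontal bb subrr.
have qE x : quad 0 b ga x = height b * height x + ga.
  by rewrite /quad (dot_horizontal b x) hb dot0l mul0r !add0r.
have [L LP] : exists L : R, forall z, K z -> dot z eta0 < L.
  have [->|/set0P K0] := eqVneq K set0; first by exists 0.
  have fc : continuous (fun z : V => dot z (- eta0)).
    by move=> z; exact: (@cvg_dot _ _ _ _ (nbhs_filter z) id (fun=> - eta0) _ _ cvg_id (cvg_cst _)).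
  have [z Kz zmin] := compact_min K0 cK fc.
  exists (dot z eta0 + 1) => y /zmin; rewrite !dotNr lerN2 => h; apply: le_lt_trans h _.
  by rewrite ltrDl.
pose q0 := L *: eta0 + (- (ga / height b)) *: (en : V).
have q0h : height q0 = - (ga / height b).
  by rewrite heightD !heightZ height_en eta0_height// mulr0 add0r mulr1.
have hq0 : 0 < height q0 by rewrite q0h oppr_gt0 pmulr_rlt0// invr_lt0.
have q00 : dot q0 eta0 = L.
  rewrite dotDl !dotZl eta0_unit (dotC en) dot_en eta0_height//.
  by rewrite mulr0 addr0 mulr1.
have qq0 : quad 0 b ga q0 = 0.
  by rewrite qE q0h mulrN mulrC divfK ?addNr// lt_eqF.
have nK z : dot z eta0 = L -> ~ K z by move=> zL /LP; rewrite zL ltxx.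
exists q0; split=> //; first exact: nK.
apply: escapes_convex => // p Hp Kp; have hp : 0 < height p := Hp => qp.
have dE : - height b + quad 0 b ga p / height p = ga / height p.
  by rewrite qE; field; rewrite gt_eqF.
rewrite dE; split.
  by rewrite bb mulr0 mul0r subr0 subrr add0r exprn_gt0// divr_gt0.
exists (q0 + height p *: en); split.
- by rewrite /halfspace /= heightD heightZ height_en mulr1 addr_gt0.
- move=> t _; apply: nK; rewrite (addrC q0 (_ *: en)) addrK.
  by rewrite dotDl q00 !dotZl (dotC en) dot_en eta0_height// !mulr0 addr0.
- rewrite qE heightD heightZ height_en mulr1 mulrDr -addrA addrCA -qE qq0 addr0.
  by rewrite pmulr_llt0.
- rewrite quad_shift qE heightD heightZ height_en mulr1.
  have -> : quad 0 b ga p / height p = ga / height p + height b by rewrite -dE; ring.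
  have : 0 < ga / height p * height q0 by rewrite mulr_gt0// divr_gt0.
  have -> : height b * (height q0 + height p) + ga - (ga / height p + height b) * (height q0 + height p)
   = - (ga / height p * height q0) by field; rewrite gt_eqF.
  by clear; lra.
Qed.

End Paths.

(** * Rigidity of quadrics *)

Section QuadricRigidity.
Context {R : realType} {m : nat}.
Notation V := 'rV[R]_m.+1.
Implicit Types (x y z p u v w : V) (K S M : set V) (nu : V -> V).

Lemma mean_curvature_quadric_value M nuM (HM al : R) (b : V) (ga : R) :
  (0 < m)%N -> M = [set x | halfspace x /\ quad al b ga x = 0] -> M !=set0 ->
  height b <= 0 -> 0 < dot b b - 4 * al * ga ->
  unit_normal M nuM -> (forall p, M p -> is_mean_curvature M nuM p HM) ->
  0 <= HM -> HM = - height b / Num.sqrt (dot b b - 4 * al * ga).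
Proof.
move=> m0 ME [z Mz] c0 D0 hnu hH H0.
have [Hz qz] : halfspace z /\ quad al b ga z = 0 by move: Mz; rewrite ME.
have Uz : [set x | halfspace x /\ 0 < dot (grad (quad al b ga) x) (grad (quad al b ga) x)] z.
  by split=> //; rewrite sqr_grad_quad qz mulr0 add0r.
have Mq : \forall x \near z, M x -> quad al b ga x = 0.
  by apply/near_dotP; exists 1 => // x _; rewrite ME => -[].
have [] := mean_curvature_quadric m0 (quadric_level_eq ME) Uz Mz Hz hnu (hH _ Mz) Mq.
set mu := dot _ _ => e1 e2.
have mu0 : mu != 0.
  by apply: contraTneq D0 => m1; rewrite -e2 m1 expr0n ltxx.
have sq : Num.sqrt (dot b b - 4 * al * ga) = `|mu| by rewrite -e2 sqrtr_sqr.
rewrite sq; have [b0|b0] := eqVneq (height b) 0.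
  by move: e1; rewrite b0 oppr0 mul0r => /eqP; rewrite mulf_eq0 (negbTE mu0) => /eqP.
have mu1 : mu < 0.
  rewrite ltNge; apply/negP => mu1.
  have := mulr_ge0 mu1 H0; rewrite e1 => b1.
  by move: b0; rewrite eq_le c0 b1.
by rewrite ltr0_norm// -e1; field; rewrite mu0.
Qed.

(** The second escape condition is for the opposite equation of [M]: both signs of
    the normal are possible when the mean curvature of [M] vanishes. A low enough
    point serves for the two of them. *)
Lemma escaping_point M (K : set V) (al : R) (b : V) (ga : R) :
  (0 < m)%N -> M = [set x | halfspace x /\ quad al b ga x = 0] -> M !=set0 ->
  height b <= 0 -> 0 < dot b b - 4 * al * ga ->
  0 <= dot b b - 4 * al * ga - height b ^+ 2 ->
  K `<=` @halfspace R m -> compact K ->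
  exists q0, [/\ M q0, ~ K q0, escapes al b ga K q0 &
    height b = 0 -> escapes (- al) (- b) (- ga) K q0].
Proof.
move=> m0 ME [z]; rewrite ME => -[Hz qz] c0 D0 d0 KH cK.
have hz : 0 < height z := Hz.
have [/eqP de|dn] := boolP (dot b b - 4 * al * ga - height b ^+ 2 == 0); last first.
  have dp : 0 < dot b b - 4 * al * ga - height b ^+ 2 by rewrite lt_neqAle eq_sym dn.
  have [h1 h10 P1] := escapes_low m0 KH cK c0 (or_introl dp).
  have [b0|b0] := eqVneq (height b) 0.
    have hb : height (- b) = 0 by rewrite -scaleN1r heightZ b0 mulr0.
    have dp' : 0 < dot (- b) (- b) - 4 * - al * - ga - height (- b) ^+ 2.
      move: dp; rewrite dotNl dotNr opprK hb b0.
      by have -> : 4 * - al * - ga = 4 * al * ga by ring.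
    have [|h2 h20 P2] := escapes_low m0 KH cK _ (or_introl dp'); first by rewrite hb.
    have [|q0 [Hq0 qq0]] := low_points (h0 := Num.min h1 h2) m0 c0 (or_introl dp) _.
      by rewrite lt_min h10.
    rewrite lt_min => /andP[l1 l2]; have [nK e1] := P1 _ Hq0 qq0 l1.
    exists q0; split=> // _; apply: (P2 _ Hq0 _ l2).2.
    by rewrite quad_opp qq0 oppr0.
  have [q0 [Hq0 qq0 l1]] := low_points m0 c0 (or_introl dp) h10.
  by have [nK e1] := P1 _ Hq0 qq0 l1; exists q0; split=> // /eqP; rewrite (negbTE b0).
have b1 : height b < 0.
  rewrite lt_neqAle c0 andbT; apply: contraTneq D0 => b0.
  by move/eqP: de; rewrite b0 expr0n subr0 => /eqP ->; rewrite ltxx.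
have [a0|a0|a0] := ltrgt0P al; last first.
- have bb : dot b b = height b ^+ 2.
    by move: de; rewrite a0 mulr0 mul0r subr0 => /eqP; rewrite subr_eq0 => /eqP.
  have hb : horizontal b = 0 by apply/eqP; rewrite -dot_eq0 sqr_horizontal bb subrr.
  have ga0 : 0 < ga.
    move: qz; rewrite /quad a0 mul0r add0r (dot_horizontal b z) hb dot0l add0r.
    move/eqP; rewrite addr_eq0 => /eqP E.
    by rewrite -oppr_lt0 -E nmulr_rlt0.
  have [q0 [Hq0 qq0 nK eq0]] := escapes_horizontal m0 KH cK bb b1 ga0.
  exists q0; rewrite a0; split=> // b0.
  by move: b1; rewrite b0 ltxx.
- move: qz; rewrite (quad_center b ga z) ?lt_eqF// de mul0r subr0 => qz.
  have : height b * height z < 0 by rewrite nmulr_rlt0.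
  have := dot_ge0 (z + (2 * al)^-1 *: horizontal b).
  rewrite -(ler_nM2l a0) mulr0 => h1 h2.
  by have := ler_ltD h1 h2; rewrite qz addr0 ltxx.
have [h1 h10 P1] := escapes_low m0 KH cK c0 (or_intror (And3 de a0 b1)).
have [q0 [Hq0 qq0 l1]] := low_points m0 c0 (or_intror (And3 de a0 b1)) h10.
have [nK e1] := P1 _ Hq0 qq0 l1; exists q0; split=> // b0.
by move: b1; rewrite b0 ltxx.
Qed.

(** The orientation of [S] agrees with that of [M] at the points outside [K]: when
    [height b < 0] by the sign of the mean curvature, and otherwise after a change
    of sign of the equation. *)
Lemma quadric_uniqueness M S nuM nu (HM al : R) (b : V) (ga : R) (K : set V) :
  (0 < m)%N -> M = [set x | halfspace x /\ quad al b ga x = 0] -> M !=set0 ->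
  connected M -> height b <= 0 -> 0 < dot b b - 4 * al * ga ->
  0 <= dot b b - 4 * al * ga - height b ^+ 2 ->
  unit_normal M nuM -> (forall p, M p -> is_mean_curvature M nuM p HM) ->
  0 <= HM ->
  C2_hypersurface S -> connected S -> properly_embedded S -> unit_normal S nu ->
  (forall p, S p -> exists2 h, is_mean_curvature S nu p h & HM <= h) ->
  K `<=` @halfspace R m -> compact K -> S `\` K = M `\` K ->
  S = M.
Proof.
move=> m0 ME M0 cM c0 D0 d0 hnuM hHM HM0 hS cS pS hnu hH KH cK SM.
have HME := mean_curvature_quadric_value m0 ME M0 c0 D0 hnuM hHM HM0.
have [q0 [Mq0 nKq0 e1 e2]] := escaping_point m0 ME M0 c0 D0 d0 KH cK.
have Sq0 : S q0.
  by have [] : (S `\` K) q0 by rewrite SM.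
have clK : closed K by apply: compact_closed => //; exact: norm_hausdorff.
have nKq : \forall x \near q0, ~ K x by exact: (open_nbhs_nbhs (conj (closed_openC clK) nKq0)).
have Sq : \forall x \near q0, S x -> quad al b ga x = 0.
  apply: filterS nKq => x nK Sx; have [] : (M `\` K) x by rewrite -SM.
  by rewrite ME => -[].
have [U [f [lS Uq0]]] := C2_hypersurface_level hS Sq0.
have [h hh hge] := hH _ Sq0.
have Hq0 : halfspace q0 := hS.1 _ Sq0.
have [] := mean_curvature_quadric m0 lS Uq0 Sq0 Hq0 hnu hh Sq.
set mu := dot _ _ => E1 E2.
have h0 : 0 <= h by exact: le_trans hge.
have cM0 : 0 <= - height b by rewrite oppr_ge0.
have muE : dot (enormal nu q0) (grad (quad al b ga) q0) = mu by rewrite dotC.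
have [mu0|mu0] := ltrP mu 0.
  apply: (@quadric_rigidity R m M S nu al b ga K q0) => //.
  - by move=> p /hH; rewrite HME.
  - by rewrite muE.
have hb : height b = 0 by apply/eqP; rewrite eq_le c0 -E1 mulr_ge0.
have hNb : height (- b) = 0 by rewrite -scaleN1r heightZ hb mulr0.
have DE : dot (- b) (- b) - 4 * - al * - ga = dot b b - 4 * al * ga.
  by rewrite dotNl dotNr; ring.
apply: (@quadric_rigidity R m M S nu (- al) (- b) (- ga) K q0) => //.
- rewrite ME; apply/seteqP; split=> x /= [Hx]; rewrite quad_opp.
    by move=> ->; rewrite oppr0.
  by move/eqP; rewrite oppr_eq0 => /eqP.
- by rewrite hNb oppr0.
- by rewrite DE.
- by rewrite DE hNb; move: d0; rewrite hb.
- by move=> p /hH; rewrite HME hNb hb oppr0 !mul0r.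
- rewrite grad_quad mulrN scaleNr -opprD -(grad_quad al b ga) dotNr muE oppr_lt0.
  rewrite lt_neqAle mu0 andbT eq_sym; apply: contraTneq D0 => m1.
  by rewrite -E2 m1 expr0n ltxx.
- exact: e2.
Qed.

End QuadricRigidity.

(** * A lower bound for lengths *)

Section Asinh.
Context {R : realType}.
Implicit Types (x t : R).

Definition cosh t := (expR t + expR (- t)) / 2.
Definition sinh t := (expR t - expR (- t)) / 2.
Definition asinh x := ln (x + Num.sqrt (1 + x ^+ 2)).

Lemma cosh_sqr t : cosh t ^+ 2 = 1 + sinh t ^+ 2.
Proof.
rewrite /cosh /sinh expRN; field.
by rewrite gt_eqF// expR_gt0.
Qed.

Lemma cosh_gt0 t : 0 < cosh t.
Proof. by rewrite divr_gt0// addr_gt0// expR_gt0. Qed.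

Lemma sinhN t : sinh (- t) = - sinh t.
Proof. by rewrite /sinh opprK; field. Qed.

Lemma coshN t : cosh (- t) = cosh t.
Proof. by rewrite /cosh opprK addrC. Qed.

Lemma sinh0 : sinh 0 = 0.
Proof. by rewrite /sinh oppr0 subrr mul0r. Qed.

Lemma cosh0 : cosh 0 = 1.
Proof. by rewrite /cosh oppr0 expR0; field. Qed.

Lemma is_derive_sinh t : is_derive t 1 sinh (cosh t).
Proof.
by apply: is_derive_eq; rewrite /cosh /GRing.scale/=; ring.
Qed.

Lemma is_derive_cosh t : is_derive t 1 cosh (sinh t).
Proof.
by apply: is_derive_eq; rewrite /sinh /GRing.scale/=; ring.
Qed.

Lemma sqrt1_gt0 x : 0 < Num.sqrt (1 + x ^+ 2).
Proof. by rewrite sqrtr_gt0 ltr_wpDr// sqr_ge0. Qed.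

Lemma asinh_arg_gt0 x : 0 < x + Num.sqrt (1 + x ^+ 2).
Proof.
have [x0|x0] := lerP 0 x; first by rewrite ltr_wpDl// sqrt1_gt0.
rewrite -ltrBlDl sub0r -[ltLHS]gtr0_norm ?oppr_gt0// -sqrtr_sqr sqrrN.
by rewrite ltr_sqrt ?ltrDr// ltr_wpDr// sqr_ge0.
Qed.

Lemma asinh_sinh t : asinh (sinh t) = t.
Proof.
rewrite /asinh -cosh_sqr sqrtr_sqr gtr0_norm ?cosh_gt0//.
have -> : sinh t + cosh t = expR t by rewrite /sinh /cosh; field.
by rewrite expRK.
Qed.

Lemma sinh_asinh x : sinh (asinh x) = x.
Proof.
rewrite /sinh expRN lnK ?posrE ?asinh_arg_gt0//.
have := asinh_arg_gt0 x; set s := Num.sqrt _ => xs.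
have s2 : s ^+ 2 = 1 + x ^+ 2 by rewrite sqr_sqrtr// addr_ge0// sqr_ge0.
have -> : (x + s)^-1 = s - x.
  have xs0 : x + s != 0 by rewrite gt_eqF.
  apply: (mulfI xs0); rewrite divff//.
  have -> : (x + s) * (s - x) = s ^+ 2 - x ^+ 2 by ring.
  by rewrite s2 addrK.
by field.
Qed.

Lemma asinhN x : asinh (- x) = - asinh x.
Proof. by rewrite -{1}(sinh_asinh x) -sinhN asinh_sinh. Qed.

Lemma asinh0 : asinh 0 = 0.
Proof. by rewrite -[in LHS]sinh0 asinh_sinh. Qed.

Lemma asinh_gt0 x : 0 < x -> 0 < asinh x.
Proof.
move=> x0; rewrite ln_gt0// -[ltLHS]add0r ltr_leD//.
by rewrite -[leLHS]sqrtr1 ler_wsqrtr// lerDl sqr_ge0.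
Qed.

Lemma sinh_gt0 t : 0 < t -> 0 < sinh t.
Proof. by move=> t0; rewrite divr_gt0// subr_gt0 ltr_expR; move: t0; clear; lra. Qed.

Lemma asinh_inj : injective asinh.
Proof. exact: can_inj sinh_asinh. Qed.

Lemma is_derive_asinh x : is_derive x 1 asinh (Num.sqrt (1 + x ^+ 2))^-1.
Proof.
have p1 : 0 < 1 + x ^+ 2 by rewrite ltr_wpDr// sqr_ge0.
have d1 : is_derive x 1 (fun y : R => 1 + y ^+ 2) (2 * x).
  by apply: is_derive_eq; rewrite /GRing.scale/=; ring.
have d2 := is_derive1_comp (g := fun y : R => 1 + y ^+ 2) (is_derive1_sqrt p1) d1.
have d3 := is_deriveD (is_derive_id x (1 : R)) d2.
have d4 := is_derive1_comp (g := fun y : R => y + Num.sqrt (1 + y ^+ 2))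
  (is_derive1_ln (asinh_arg_gt0 x)) d3.
apply: (is_derive_eq d4).
have := asinh_arg_gt0 x; have := sqrt1_gt0 x; rewrite /GRing.scale/=.
set s := Num.sqrt _ => s0 xs; field.
by rewrite !gt_eqF// addrC.
Qed.

End Asinh.

Section LowerBound.
Context {R : realType} {m : nat}.
Notation V := 'rV[R]_m.+1.
Implicit Types (x y z p u v w : V) (S : set V) (c : R -> V).
Notation mu := (@lebesgue_measure R).

Lemma integral_ge_increment (g g' v : R -> R)
  (I := (\int[mu]_(t in `[0%R : R, 1%R]) (v t)%:E)%E) :
  (forall t : R, 0 <= t <= 1 -> is_derive t 1 g (g' t)) ->
  (forall t : R, 0 <= t <= 1 -> {for t, continuous g'}) ->
  (forall t : R, 0 <= t <= 1 -> {for t, continuous v}) ->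
  (forall t : R, 0 <= t <= 1 -> g' t <= v t) ->
  ((g 1 - g 0)%:E <= I)%E.
Proof.
move=> gd gc vc gv.
have in01 (t : R) : t \in `[0, 1]%classic -> 0 <= t <= 1 by rewrite inE/= in_itv.
have gc' : {within `[0, 1]%classic, continuous g'}.
  by apply: continuous_in_subspaceT => t /in01; exact: gc.
have vc' : {within `[0, 1]%classic, continuous v}.
  by apply: continuous_in_subspaceT => t /in01; exact: vc.
have gct (t : R) : 0 <= t <= 1 -> {for t, continuous g}.
  by move=> /gd; exact: is_derive_continuous.
rewrite EFinB -(continuous_FTC2 (@ltr01 R) gc').
- apply: le_integral => //.
  + by apply: continuous_compact_integrable => //; exact: segment_compact.
  + by apply: continuous_compact_integrable => //; exact: segment_compact.
  + by move=> t /in01 t01; rewrite lee_fin gv.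
- split.
  + move=> t; rewrite in_itv/= => /andP[t0 t1].
    by have [] : is_derive t 1 g (g' t) by apply: gd; rewrite !ltW.
  + by apply: cvg_at_right_filter; apply: gct; rewrite lexx ler01.
  + by apply: cvg_at_left_filter; apply: gct; rewrite lexx ler01.
- move=> t; rewrite in_itv/= => /andP[t0 t1]; rewrite derive1E.
  by have [_ ->] : is_derive t 1 g (g' t) by apply: gd; rewrite !ltW.
Qed.

Lemma is_derive_C1_curve c (t : R) : Ck 1 [set: R] c -> is_derive t 1 c (derive1 c t).
Proof. by move=> [cd _]; apply: DeriveDef; [exact: cd|rewrite derive1E]. Qed.

Lemma C1_curve_continuous c (t : R) : Ck 1 [set: R] c -> {for t, continuous (derive1 c)}.
Proof.
move=> [_ /(_ 1)/= cc].
have -> : derive1 c = (fun x : R => 'D_1 c x) by apply/funext => s; rewrite derive1E.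
exact: cc.
Qed.

(** The functions [q / height] with [height b = 0] and discriminant 1 are the
    hyperbolic sines of the signed distances to the hyperplanes [q = 0]; they are
    1-Lipschitz after composing with [asinh]. *)
Lemma curve_length_ge (al : R) (b : V) (ga : R) c
  (F := fun x => quad al b ga x / height x) : height b = 0 ->
  dot b b - 4 * al * ga = 1 -> Ck 1 [set: R] c ->
  (forall t : R, 0 <= t <= 1 -> halfspace (c t)) ->
  ((asinh (F (c 1)) - asinh (F (c 0)))%:E <= curve_length c)%E.
Proof.
move=> b0 D1 cC cH.
have cd (t : R) := is_derive_C1_curve t cC.
have cc (t : R) : {for t, continuous c} by exact: is_derive_continuous (cd t).
have cc' (t : R) := C1_curve_continuous (t := t) cC.
pose q := quad al b ga; pose hh (t : R) := height (c t).
pose q' (t : R) := dot (grad q (c t)) (derive1 c t).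
pose F' (t : R) := (q' t * hh t - q (c t) * height (derive1 c t)) / hh t ^+ 2.
pose G (t : R) := Num.sqrt (1 + F (c t) ^+ 2).
have hc (t : R) : {for t, continuous hh}.
  by apply: (@continuous_comp _ _ _ c (@height R m)); [exact: cc|exact: continuous_height].
have qc (t : R) : {for t, continuous (fun s => q (c s))}.
  by apply: (@continuous_comp _ _ _ c q); [exact: cc|exact: quad_continuous].
have qC : Ck 1 setT q := C2_C1 openT (quad_C2 al b ga openT).
have gc (t : R) : {for t, continuous (fun s => grad q (c s))}.
  apply: (@continuous_comp _ _ _ c (grad q)); first exact: cc.
  exact: (C1_grad_continuous qC I).
have hc' (t : R) : {for t, continuous (fun s => height (derive1 c s))}.
  apply: (@continuous_comp _ _ _ (derive1 c) (@height R m)); first exact: cc'.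
  exact: continuous_height.
have qc' (t : R) : {for t, continuous q'} by apply: continuous_dot; [exact: gc|exact: cc'].
have hn (t : R) : 0 <= t <= 1 -> hh t != 0 by move=> /cH ct; rewrite gt_eqF.
have Fc (t : R) : 0 <= t <= 1 -> {for t, continuous (fun s => F (c s))}.
  move=> t01; apply: (@cvgM _ _ _ (nbhs_filter t)); first exact: qc.
  by apply: (@cvgV _ _ _ (nbhs_filter t)); [exact: hn|exact: hc].
have Gc (t : R) : 0 <= t <= 1 -> {for t, continuous G}.
  move=> t01; apply: (@continuous_comp _ _ _ (fun s => 1 + F (c s) ^+ 2) Num.sqrt).
    apply: (@cvgD _ _ _ _ (nbhs_filter t)); first exact: cvg_cst.
    by rewrite expr2; apply: (@cvgM _ _ _ (nbhs_filter t)); exact: Fc.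
  exact: sqrt_continuous.
have dF (t : R) : 0 <= t <= 1 -> is_derive t 1 (fun s => F (c s)) (F' t).
  move=> t01; have dq := is_derive_C1_comp openT qC I (cd t).
  have dh : is_derive t 1 hh (height (derive1 c t)) := is_derive_coord ord_max (cd t).
  have dV := is_deriveV (hn t t01) dh.
  have dM := is_deriveM dq dV.
  apply: (is_derive_eq dM).
  rewrite /F' /q' /GRing.scale/= -exprVn -/q -/(hh t).
  by field; exact: hn.
apply: (@integral_ge_increment (fun t => asinh (F (c t))) (fun t => (G t)^-1 * F' t)).
- by move=> t t01; exact: (is_derive1_comp (is_derive_asinh _) (dF t t01)).
- move=> t t01; apply: (@cvgM _ _ _ (nbhs_filter t)).
    apply: (@cvgV _ _ _ (nbhs_filter t)); last exact: Gc.
    by rewrite gt_eqF// sqrt1_gt0.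
  apply: (@cvgM _ _ _ (nbhs_filter t)); last first.
    apply: (@cvgV _ _ _ (nbhs_filter t)); first by rewrite expf_neq0// hn.
    by rewrite expr2; apply: (@cvgM _ _ _ (nbhs_filter t)); exact: hc.
  by apply: (@cvgB _ _ _ _ (nbhs_filter t)); apply: (@cvgM _ _ _ (nbhs_filter t));
    [exact: qc'|exact: hc|exact: qc|exact: hc'].
- move=> t t01; apply: (@continuous_comp _ _ _ (fun s => hmetric (c s) (derive1 c s) (derive1 c s)) Num.sqrt); last exact: sqrt_continuous.
  apply: (@cvgM _ _ _ (nbhs_filter t)); first by apply: continuous_dot; exact: cc'.
  apply: (@cvgV _ _ _ (nbhs_filter t)); first by rewrite expf_neq0// hn.
  by rewrite expr2; apply: (@cvgM _ _ _ (nbhs_filter t)); exact: hc.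
- move=> t t01; have hp : 0 < height (c t) := cH t t01.
  set u := derive1 c t.
  have G0 : 0 < G t by exact: sqrt1_gt0.
  pose n := grad q (c t) - F (c t) *: en.
  have F'E : F' t = dot n u / hh t.
    rewrite /F' /q' dotBl dotZl (dotC en) dot_en -/u /F -/q -/(hh t).
    by field; exact: hn.
  have nn : dot n n = G t ^+ 2.
    rewrite /G sqr_sqrtr ?addr_ge0 ?sqr_ge0// -D1 /n sqr_shift.
    rewrite sqr_grad_quad -/q grad_quad heightD heightZ b0 addr0.
    have -> : q (c t) = F (c t) * height (c t) by rewrite /F divfK// gt_eqF.
    by ring.
  rewrite -ler_pdivlMl ?invr_gt0// invrK F'E hmetricE.
  apply: le_trans (ler_norm _) _; rewrite -sqrtr_sqr -[G t]gtr0_norm// -sqrtr_sqr -sqrtrM ?sqr_ge0//.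
  rewrite ler_wsqrtr// expr_div_n mulrA ler_pM2r ?invr_gt0 ?exprn_gt0//.
  by rewrite -nn; exact: cauchy_schwarz.
Qed.

Lemma rdist_ge S (al : R) (b : V) (ga : R) x y
  (F := fun x => quad al b ga x / height x) : S `<=` @halfspace R m ->
  height b = 0 -> dot b b - 4 * al * ga = 1 ->
  (`|asinh (F y) - asinh (F x)|%:E <= rdist S x y)%E.
Proof.
move=> SH b0 D1; apply: le_ereal_inf_tmp => _ [c [cC <- <- cS] <-].
have cH (t : R) : 0 <= t <= 1 -> halfspace (c t) by move=> /cS /SH.
have [h|h] := lerP 0 (asinh (F (c 1)) - asinh (F (c 0))); first by rewrite ger0_norm//; exact: curve_length_ge.
have bN : height (- b) = 0 by rewrite -scaleN1r heightZ b0 mulr0.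
have DN : dot (- b) (- b) - 4 * - al * - ga = 1 by rewrite dotNl dotNr -[RHS]D1; ring.
have := curve_length_ge bN DN cC cH.
have E (z : V) : quad (- al) (- b) (- ga) z / height z = - F z.
  by rewrite quad_opp mulNr.
by rewrite !E !asinhN opprK addrC ltr0_norm// opprB.
Qed.

End LowerBound.

(** * Geodesics *)

Section Geodesics.
Context {R : realType} {m : nat}.
Notation V := 'rV[R]_m.+1.
Implicit Types (x y z p u v w N : V) (S : set V) (c : R -> V).
Notation mu := (@lebesgue_measure R).

Lemma C1_curveP c (c' : R -> V) : (forall t : R, is_derive t 1 c (c' t)) ->
  continuous c' -> Ck 1 [set: R] c.
Proof.
move=> cd cc.
have dv (t v : R) : derivable c t v /\ 'D_v c t = v *: c' t.
  have dc : differentiable c t by have [/derivable1_diffP] := cd t.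
  split; first exact: diff_derivable.
  rewrite deriveE// -[v in LHS]mulr1 -[v * 1]/(v *: (1 : R^o)) linearZ/= -deriveE//.
  by have [_ ->] := cd t.
split=> [t v _|v t _]; first exact: (dv t v).1.
have -> : (fun s : R => 'D_v c s) = (fun s : R => v *: c' s).
  by apply/funext => s; exact: (dv s v).2.
by apply: (@cvgZr _ _ _ _ (nbhs_filter t)); exact: cc.
Qed.

(** Affine reparametrization over [[0, 1]] gives a competitor in the definition of
    the distance; it is defined on the whole line, as required there. *)
Lemma rdist_unit_speed S c (c' : R -> V) (s1 s2 : R) :
  (forall t : R, is_derive t 1 c (c' t)) -> continuous c' ->
  (forall t : R, hmetric (c t) (c' t) (c' t) = 1) ->
  (forall t : R, 0 <= t <= 1 -> S (c (s1 + t * (s2 - s1)))) ->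
  (rdist S (c s1) (c s2) <= `|s2 - s1|%:E)%E.
Proof.
move=> cd cc c1 cS.
pose d (t : R) := c (s1 + t * (s2 - s1)).
pose d' (t : R) := (s2 - s1) *: c' (s1 + t * (s2 - s1)).
have la (t : R) : is_derive t 1 (fun u : R => s1 + u * (s2 - s1)) (s2 - s1).
  by apply: is_derive_eq; rewrite /GRing.scale/=; ring.
have dd (t : R) : is_derive t 1 d (d' t).
  apply: is_derive_coordP => i; rewrite /d' mxE mulrC.
  exact: (is_derive1_comp (f := fun s => c s 0 i) (is_derive_coord i (cd _)) (la t)).
have dc : continuous d'.
  move=> t; apply: (@cvgZr _ _ _ _ (nbhs_filter t)).
  apply: (@continuous_comp _ _ _ (fun u : R => s1 + u * (s2 - s1)) c'); last exact: cc.
  exact: is_derive_continuous (la t).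
apply: ereal_inf_lbound; exists d.
  split; last by move=> t /cS.
  - exact: C1_curveP dd dc.
  - by rewrite /d mul0r addr0.
  - by rewrite /d mul1r subrKC.
rewrite /curve_length.
under eq_integral => t _.
  have -> : hmetric (d t) (derive1 d t) (derive1 d t) = (s2 - s1) ^+ 2.
    rewrite derive1E; have [_ ->] := dd t.
    rewrite hmetricE dotZl dotZr mulrA -mulrA -hmetricE c1 mulr1.
    by rewrite expr2.
  rewrite sqrtr_sqr.
  over.
by rewrite integral_cst//= lebesgue_measure_itv/= lte01 oppr0 adde0 mule1.
Qed.

(** The geodesic of unit speed leaving [y] with velocity [height y *: N]; its
    trace is a half-circle or a half-line orthogonal to the boundary. *)
Definition geo_den N (t : R) := cosh t - sinh t * height N.
Definition geo y N (t : R) : V :=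
  y + (height y / geo_den N t) *: (sinh t *: N + (1 - cosh t) *: en).
Definition geo' y N (t : R) : V := (height y / geo_den N t ^+ 2) *:
  (N + (height N * (cosh t - 1) - sinh t) *: en).

Lemma geo_den_gt0 N (t : R) : dot N N = 1 -> 0 < geo_den N t.
Proof.
move=> N1; rewrite subr_gt0; have := sqr_height_le N; rewrite N1 => n1.
apply: le_lt_trans (ler_norm _) _.
rewrite -(@ltr_pXn2r _ 2) ?nnegrE//; last exact/ltW/cosh_gt0.
rewrite -normrX ger0_norm ?sqr_ge0// exprMn cosh_sqr.
apply: (@le_lt_trans _ _ (sinh t ^+ 2)); first by rewrite ler_piMr// sqr_ge0.
by rewrite ltrDr.
Qed.

Lemma geo0 y N : geo y N 0 = y.
Proof. by rewrite /geo sinh0 cosh0 subrr !scale0r addr0 scaler0 addr0. Qed.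

Lemma height_geo y N (t : R) : dot N N = 1 ->
  height (geo y N t) = height y / geo_den N t.
Proof.
move=> /(geo_den_gt0 t) E0; rewrite /geo !(heightD, heightZ) height_en.
by move: E0; rewrite /geo_den => E0; field; rewrite gt_eqF.
Qed.

Lemma halfspace_geo y N (t : R) : dot N N = 1 -> halfspace y -> halfspace (geo y N t).
Proof.
by move=> N1 Hy; rewrite /halfspace /= height_geo// divr_gt0// geo_den_gt0.
Qed.

Lemma is_derive_geo_den N (t : R) :
  is_derive t 1 (geo_den N) (sinh t - cosh t * height N).
Proof.
have d1 := is_derive_cosh t; have d2 := is_derive_sinh t.
by apply: is_derive_eq; rewrite /GRing.scale/=; ring.
Qed.

Lemma is_derive_geo y N (t : R) : dot N N = 1 -> is_derive t 1 (geo y N) (geo' y N t).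
Proof.
move=> N1; have E0 : geo_den N t != 0 by rewrite gt_eqF// geo_den_gt0.
have dV := is_deriveV E0 (is_derive_geo_den N t).
apply: is_derive_coordP => i.
have -> : (fun s => geo y N s 0 i) =
  (fun s : R => y 0 i + height y * (sinh s * N 0 i + (1 - cosh s) * en 0 i) * (geo_den N s)^-1).
  by apply/funext => s; rewrite /geo !mxE; ring.
have d1 := is_derive_cosh t; have d2 := is_derive_sinh t.
apply: is_derive_eq; rewrite /geo' !mxE /GRing.scale/=.
have := cosh_sqr t; move: E0; rewrite /geo_den -[_ * height N]/(_ * height N).
move: (i == ord_max)%:R (height N) (height y) (N 0 i) (cosh t) (sinh t).
move=> e n h Ni C S E0 CS.
have Z : h * (Ni - n * e) * (C ^+ 2 - (1 + S ^+ 2)) / (C - S * n) ^+ 2 = 0.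
  by rewrite CS subrr mulr0 mul0r.
by apply/eqP; rewrite -subr_eq0 -[X in _ == X]Z; apply/eqP; field.
Qed.

Lemma geo'_continuous y N : dot N N = 1 -> continuous (geo' y N).
Proof.
move=> N1 t; have E0 : geo_den N t != 0 by rewrite gt_eqF// geo_den_gt0.
have cE := is_derive_continuous (is_derive_geo_den N t).
have cc := is_derive_continuous (is_derive_cosh t).
have cs := is_derive_continuous (is_derive_sinh t).
have F := nbhs_filter t.
apply: (@cvgZ _ _ _ _ F).
  apply: (@cvgM _ _ _ F); first exact: cvg_cst.
  apply: (@cvgV _ _ _ F); first by rewrite expf_neq0.
  by rewrite expr2; apply: (@cvgM _ _ _ F).
apply: (@cvgD _ _ _ _ F); first exact: cvg_cst.
apply: (@cvgZl _ _ _ _ F).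
apply: (@cvgB _ _ _ _ F); last exact: cs.
apply: (@cvgM _ _ _ F); first exact: cvg_cst.
by apply: (@cvgB _ _ _ _ F); [exact: cc|exact: cvg_cst].
Qed.

Lemma geo_unit_speed y N (t : R) : dot N N = 1 -> halfspace y ->
  hmetric (geo y N t) (geo' y N t) (geo' y N t) = 1.
Proof.
move=> N1 Hy; have hy : 0 < height y := Hy; have E0 := geo_den_gt0 t N1.
rewrite hmetricE height_geo// dotZl dotZr.
have -> : dot (N + (height N * (cosh t - 1) - sinh t) *: en)
              (N + (height N * (cosh t - 1) - sinh t) *: en) = geo_den N t ^+ 2.
  rewrite !dotDl !dotDr !dotZl !dotZr N1 !(dotC en) !dot_en height_en /geo_den.
  have := cosh_sqr t; move: (height N) (cosh t) (sinh t) => n C S CS.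
  have Z : (1 - n ^+ 2) * ((1 + S ^+ 2) - C ^+ 2) = 0 by rewrite CS subrr mulr0.
  by apply/eqP; rewrite -subr_eq0 -[X in _ == X]Z; apply/eqP; ring.
by field; rewrite !gt_eqF.
Qed.

Lemma rdist_geo S y N (s1 s2 : R) : dot N N = 1 -> halfspace y ->
  (forall t : R, 0 <= t <= 1 -> S (geo y N (s1 + t * (s2 - s1)))) ->
  (rdist S (geo y N s1) (geo y N s2) <= `|s2 - s1|%:E)%E.
Proof.
move=> N1 Hy; apply: (@rdist_unit_speed _ _ (geo' y N)).
- by move=> t; exact: is_derive_geo.
- exact: geo'_continuous.
- by move=> t; exact: geo_unit_speed.
Qed.

(** Along a geodesic, [q / height] solves [F'' = F]. *)
Lemma quotient_geo (al : R) (b : V) (ga : R) y N (t : R)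
  (F := fun x => quad al b ga x / height x) : height b = 0 -> dot N N = 1 ->
  halfspace y ->
  F (geo y N t) = cosh t * F y + sinh t * dot (grad (quad al b ga) y - F y *: en) N.
Proof.
move=> b0 N1 Hy; have hy : 0 < height y := Hy; have E0 := geo_den_gt0 t N1.
rewrite /F height_geo// /geo quad_line.
set g := grad _ y; set w := sinh t *: N + _.
have gw : dot g w = sinh t * dot g N + (1 - cosh t) * (2 * al * height y).
  by rewrite dotDr !dotZr dot_en /g grad_quad heightD heightZ b0 addr0.
have ww : dot w w = 2 * (cosh t - 1) * geo_den N t.
  rewrite /w !(dotDr, dotDl) !(dotZl, dotZr) N1 (dotC en) !dot_en height_en /geo_den.
  have := cosh_sqr t; move: (height N) (cosh t) (sinh t) => n C S CS.
  have Z : (1 + S ^+ 2) - C ^+ 2 = 0 by rewrite CS subrr.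
  by apply/eqP; rewrite -subr_eq0 -[X in _ == X]Z; apply/eqP; ring.
rewrite gw ww dotBl dotZl (dotC en) dot_en.
have E1 : cosh t = geo_den N t + sinh t * height N by rewrite /geo_den subrK.
by rewrite -/g [in RHS]E1 /=; field; rewrite !gt_eqF.
Qed.

End Geodesics.

(** * Totally geodesic hypersurfaces are quadrics *)

Section LevelPaths.
Context {R : realType} {m : nat}.
Notation V := 'rV[R]_m.+1.
Implicit Types (x y z p u v w e : V) (f : V -> R) (S U : set V).

Lemma near_gradient U f p : open U -> Ck 1 U f -> U p -> grad f p != 0 ->
  exists2 r, 0 < r & forall x, dot (x - p) (x - p) < r ->
    [/\ U x, dot (grad f p) (grad f p) < 2 * dot (grad f x) (grad f p) &
      dot (grad f x) (grad f x) < 4 * dot (grad f p) (grad f p)].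
Proof.
move=> oU fC Up g0; have gp : 0 < dot (grad f p) (grad f p) by rewrite dot_gt0.
have gc := C1_grad_continuous fC Up.
have h1 : \forall x \near p, 2^-1 * dot (grad f p) (grad f p) < dot (grad f x) (grad f p).
  apply: (continuous_near_gt (f := fun x => dot (grad f x) (grad f p))).
    exact: (continuous_dot gc (@cst_continuous _ _ (grad f p) p)).
  by move: gp; clear; lra.
have h2 : \forall x \near p, dot (grad f x) (grad f x) < 4 * dot (grad f p) (grad f p).
  apply: (continuous_near_lt (f := fun x => dot (grad f x) (grad f x))).
    exact: (continuous_dot gc gc).
  by move: gp; clear; lra.
have nU := open_nbhs_nbhs (conj oU Up).
have : \forall x \near p, [/\ U x, dot (grad f p) (grad f p) < 2 * dot (grad f x) (grad f p) &
      dot (grad f x) (grad f x) < 4 * dot (grad f p) (grad f p)].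
  by move: nU h1 h2; apply: filterS3 => x Ux a1 a2; split=> //; move: a1; clear; lra.
by move=> /near_dotP.
Qed.

(** The hypersurface being locally a graph in the direction [e] of the gradient,
    the curve is [c t = p + t (x - p) + s t e]. The intermediate value theorem gives
    [s t], the monotony of [f] along [e] its uniqueness, hence [s 0 = s 1 = 0], and
    the mean value theorem its derivative. *)
Lemma level_path S U f p : level_eq S U f -> U p -> S p ->
  \forall x \near p, S x -> exists c c' : R -> V, [/\ c 0 = p, c 1 = x &
    forall t : R, 0 <= t <= 1 ->
      [/\ (\forall s \near t, S (c s)), U (c t) & is_derive t 1 c (c' t)]].
Proof.
move=> lS Up Sp; have [oU fC2 gn SU] := lS; have fC := level_eq_C1 lS.
have fp : f p = 0 by apply/SU.
set e := grad f p; pose E := dot e e.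
have E0 : 0 < E by rewrite dot_gt0 gn.
have [r r0 hr] := near_gradient oU fC Up (gn _ Up); rewrite -/e -/E in hr.
pose B x := dot (x - p) (x - p) < r.
have mv z z' : B z -> B z' -> exists2 xi, B xi /\ dot (xi - z) (xi - z) <= dot (z' - z) (z' - z) &
    f z' - f z = dot (grad f xi) (z' - z).
  move=> Bz Bz'.
  have zU (t : R) : 0 <= t <= 1 -> U (z + t *: (z' - z)).
    by move=> t01; have [] := hr _ (ball_segment t01 Bz Bz').
  have [t /andP[t0 t1] tE] := C1_mvt oU fC zU.
  exists (z + t *: (z' - z)); last by rewrite -tE subrKC.
  split; first by apply: ball_segment => //; rewrite !ltW.
  rewrite addrAC subrr add0r dotZl dotZr mulrA -expr2 ler_piMl ?dot_ge0//.
  by rewrite expr_le1// ltW.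
pose sg := Num.sqrt (r / (8 * E)).
have sg0 : 0 < sg by rewrite sqrtr_gt0 divr_gt0// mulr_gt0.
have sgE : sg ^+ 2 * E = r / 8.
  by rewrite /sg sqr_sqrtr ?divr_ge0 ?mulr_ge0 ?ltW//; field; rewrite gt_eqF.
pose rho := r / 8 / 16 / 2.
have rho0 : 0 < rho by rewrite /rho !divr_gt0.
have inB v (s : R) : dot v v < rho -> `|s| <= sg -> B (p + v + s *: e).
  move=> hv hs; rewrite /B addrAC addrAC -(addrA p) (addrC p) addrK.
  apply: le_lt_trans (dotD_le _ _) _.
  have -> : dot (s *: e) (s *: e) = s ^+ 2 * E by rewrite dotZl dotZr /E; ring.
  have : s ^+ 2 <= sg ^+ 2.
    by rewrite -real_normK ?num_real// ler_pXn2r ?nnegrE// ltW.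
  rewrite -(ler_pM2r E0) sgE; move: hv r0; rewrite /rho; clear; lra.
have ex v : dot v v < rho -> exists s : R, `|s| <= sg /\ f (p + v + s *: e) = 0.
  move=> hv.
  have B0 : B (p + v + 0 *: e) by apply: inB => //; rewrite normr0 ltW.
  have Bp : B p by rewrite /B subrr dot0l.
  have small : f (p + v + 0 *: e) ^+ 2 < (sg * E / 2) ^+ 2.
    have [xi [Bxi _]] := mv _ _ Bp B0; rewrite fp subr0 scale0r addr0 addrAC subrr add0r => ->.
    have [_ _ h] := hr _ Bxi.
    apply: le_lt_trans (cauchy_schwarz _ _) _.
    have -> : (sg * E / 2) ^+ 2 = 4 * E * (sg ^+ 2 * E / 16) by field.
    rewrite sgE; apply: (@le_lt_trans _ _ (4 * E * dot v v)).
      by rewrite ler_wpM2r ?dot_ge0// ltW.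
    rewrite ltr_pM2l ?mulr_gt0//; apply: lt_le_trans hv _.
    by rewrite /rho; move: r0; clear; lra.
  have {}small : `|f (p + v + 0 *: e)| < sg * E / 2.
    rewrite -(@ltr_pXn2r _ 2) ?nnegrE ?real_normK ?num_real//.
    by rewrite ltW// divr_gt0// mulr_gt0.
  have up (s : R) : `|s| <= sg -> exists2 a, E < 2 * a &
      f (p + v + s *: e) - f (p + v + 0 *: e) = s * a.
    move=> hs; have [xi [Bxi _] ->] := mv _ _ B0 (inB _ _ hv hs).
    exists (dot (grad f xi) e); first by have [] := hr _ Bxi.
    by rewrite scale0r addr0 addrAC subrr add0r dotZr.
  pose phi (s : R) := f (p + v + s *: e).
  have phic : {within `[- sg, sg]%classic, continuous phi}.
    apply: continuous_in_subspaceT => s; rewrite inE/= in_itv/= -ler_norml => hs.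
    apply: (@continuous_comp _ _ _ (fun s : R => p + v + s *: e) f).
      exact: continuous_line.
    by apply: (C1_continuous oU fC); have [] := hr _ (inB _ _ hv hs).
  have sgn : `|sg| <= sg by rewrite gtr0_norm.
  have sgn' : `|- sg| <= sg by rewrite normrN gtr0_norm.
  have [a1 a1E h1] := up _ sgn; have [a2 a2E h2] := up _ sgn'.
  have p1 : 0 < phi sg.
    have : sg * E < sg * (2 * a1) by rewrite ltr_pM2l.
    move: h1 small; rewrite /phi ltr_norml.
    by clear; lra.
  have p2 : phi (- sg) < 0.
    have : sg * E < sg * (2 * a2) by rewrite ltr_pM2l.
    move: h2 small; rewrite /phi ltr_norml.
    by clear; lra.
  have [||s] := IVT (a := - sg) (b := sg) (v := 0) _ phic; first by rewrite ge0_cp// ltW.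
    by rewrite ge_min le_max (ltW p1) (ltW p2) orbT.
  by rewrite in_itv/= -ler_norml => hs fs; exists s.
apply/near_dotP; exists (rho / 4); first by rewrite divr_gt0.
move=> x; set w := x - p => hw Sx.
have tw (t : R) : `|t| <= 2 -> dot (t *: w) (t *: w) < rho.
  move=> t2; rewrite dotZl dotZr mulrA -expr2.
  have h4 : t ^+ 2 <= 4.
    have -> : (4 : R) = 2 ^+ 2 by ring.
    by rewrite -real_normK ?num_real// ler_pXn2r ?nnegrE.
  have := ler_wpM2r (dot_ge0 w) h4; move: hw; clear; lra.
pose A (t : R) : set R := [set s | `|s| <= sg /\ f (p + t *: w + s *: e) = 0].
pose s t := xget 0 (A t).
have sP (t : R) : `|t| <= 2 -> `|s t| <= sg /\ f (p + t *: w + s t *: e) = 0.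
  by move=> /tw/ex H; have : A t (s t) by apply: xgetPex.
pose c t := p + t *: w + s t *: e.
have cB (t : R) : `|t| <= 2 -> B (c t).
  by move=> t2; apply: inB; [exact: tw|exact: (sP t t2).1].
have cS (t : R) : `|t| <= 2 -> S (c t).
  move=> t2; have [Uc _ _] := hr _ (cB _ t2); apply/(SU _ Uc); exact: (sP t t2).2.
have uniq v (s1 s2 : R) : dot v v < rho -> `|s1| <= sg -> `|s2| <= sg ->
    f (p + v + s1 *: e) = 0 -> f (p + v + s2 *: e) = 0 -> s1 = s2.
  move=> hv h1 h2 f1 f2; have [xi [Bxi _]] := mv _ _ (inB _ _ hv h1) (inB _ _ hv h2).
  rewrite f1 f2 subrr; have -> : p + v + s2 *: e - (p + v + s1 *: e) = (s2 - s1) *: e.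
    by apply/rowP => i; rewrite !mxE; ring.
  have [_ a0 _] := hr _ Bxi.
  rewrite dotZr => /esym/eqP; rewrite mulf_eq0 subr_eq0 => /orP[/eqP//|/eqP a1].
  by move: a0 E0; rewrite a1; clear; lra.
have n0 : `|(0 : R)| <= 2 by rewrite normr0.
have n1 : `|(1 : R)| <= 2 by rewrite normr1; clear; lra.
have s0 : s 0 = 0.
  apply: (uniq (0 *: w)); [exact: tw|exact: (sP _ n0).1|by rewrite normr0 ltW|exact: (sP _ n0).2|].
  by rewrite !scale0r !addr0.
have Bx : B x by move: hw r0; rewrite /B /rho; clear; lra.
have s1 : s 1 = 0.
  apply: (uniq (1 *: w)); [exact: tw|exact: (sP _ n1).1|by rewrite normr0 ltW|exact: (sP _ n1).2|].
  rewrite scale0r addr0 scale1r subrKC; apply/SU => //.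
  by have [] := hr _ Bx.
pose G z := - (dot (grad f z) w / dot (grad f z) e).
have key (t t' : R) : `|t| <= 2 -> `|t'| <= 2 -> exists xi,
    [/\ dot (xi - c t) (xi - c t) <= (t' - t) ^+ 2 * (34 * dot w w) &
     s t' - s t = (t' - t) * G xi].
  move=> t2 t2'; have [xi [Bxi xic]] := mv _ _ (cB _ t2) (cB _ t2').
  rewrite (sP _ t2).2 (sP _ t2').2 subrr.
  have cE : c t' - c t = (t' - t) *: w + (s t' - s t) *: e.
    by apply/rowP => i; rewrite !mxE; ring.
  rewrite cE dotDr !dotZr => fE; have [_ a0 b0] := hr _ Bxi.
  set a := dot (grad f xi) e in fE a0; set b := dot (grad f xi) w in fE.
  have an : a != 0 by apply: contraTneq a0 => ->; rewrite mulr0 ltNge ltW.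
  have sE : s t' - s t = (t' - t) * G xi.
    rewrite /G -/a -/b; apply: (mulIf an); rewrite -mulrA mulNr divfK//.
    by move: fE; clear; lra.
  exists xi; split=> //.
  apply: le_trans xic _; rewrite cE; apply: le_trans (dotD_le _ _) _.
  have -> : dot ((s t' - s t) *: e) ((s t' - s t) *: e) = (s t' - s t) ^+ 2 * E.
    by rewrite dotZl dotZr /E; ring.
  have -> : dot ((t' - t) *: w) ((t' - t) *: w) = (t' - t) ^+ 2 * dot w w.
    by rewrite dotZl dotZr; ring.
  have : (s t' - s t) ^+ 2 * E <= (t' - t) ^+ 2 * (16 * dot w w).
    rewrite sE exprMn -mulrA ler_wpM2l ?sqr_ge0// /G sqrrN expr_div_n.
    have a2 : 0 < a ^+ 2 by rewrite exprn_even_gt0.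
    rewrite mulrAC ler_pdivrMr//.
    have h1 : b ^+ 2 <= 4 * E * dot w w.
      apply: le_trans (cauchy_schwarz _ _) _.
      by rewrite ler_wpM2r ?dot_ge0// ltW.
    have h2 : E ^+ 2 <= 4 * a ^+ 2.
      have -> : 4 * a ^+ 2 = (2 * a) ^+ 2 by ring.
      by rewrite ler_pXn2r ?nnegrE ?ltW//; apply: lt_trans E0 a0.
    have h3 := ler_wpM2r (ltW E0) h1.
    have h4 := ler_wpM2l (mulr_ge0 (ler0n R 4) (dot_ge0 w)) h2.
    by rewrite -/a -/b; move: h3 h4; clear; lra.
  by clear; lra.
pose c' t := w + G (c t) *: e.
exists c, c'; split.
- by rewrite /c s0 !scale0r !addr0.
- by rewrite /c s1 scale0r addr0 scale1r subrKC.
move=> t /andP[t0 t1].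
have t2 : `|t| <= 2 by rewrite ger0_norm//; move: t1; clear; lra.
have nt : \forall u \near t, `|u| <= 2.
  have h1 : \forall u \near t, `|t - u| < 1 by exact: (@nbhsx_ballx _ R^o).
  apply: filterS h1 => u; rewrite ltr_norml ler_norml; move: t0 t1; clear; lra.
split; first by apply: filterS nt => u; exact: cS.
  by have [] := hr _ (cB _ t2).
have Gc : {for (c t), continuous G}.
  have [Uc a0 _] := hr _ (cB _ t2).
  have gc := C1_grad_continuous fC Uc; have F := nbhs_filter (c t).
  apply: (@cvgN _ _ _ _ F); apply: (@cvgM _ _ _ F).
    exact: (continuous_dot gc (@cst_continuous _ _ w _)).
  apply: (@cvgV _ _ _ F); last exact: (continuous_dot gc (@cst_continuous _ _ e _)).
  by apply: contraTneq a0 => ->; rewrite mulr0 ltNge ltW.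
have ds : is_derive t 1 s (G (c t)).
  suff H : (fun h : R => h^-1 *: ((s \o shift t) (h *: 1) - s t)) @ 0^' --> (G (c t) : R).
    by apply: DeriveDef; [apply/cvg_ex; exists (G (c t))|exact/cvg_lim].
  apply/cvgrPdist_lt => eps eps0.
  have /continuous_epsP/(_ _ eps0)/near_dotP[r1 r10 hr1] := Gc.
  have K0 : 0 < 34 * dot w w + 1 by rewrite ltr_wpDl// mulr_ge0 ?dot_ge0.
  have nh : \forall h \near (0 : R), `|h| < Num.min 1 (r1 / (34 * dot w w + 1)).
    by apply: near0_norm_lt; rewrite lt_min ltr01 divr_gt0.
  near=> h.
  have h0 : h != 0 by near: h; exact: nbhs_dnbhs_neq.
  have : `|h| < Num.min 1 (r1 / (34 * dot w w + 1)) by near: h; exact: nbhs_dnbhs.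
  have : `|h + t| <= 2.
    near: h; apply: nbhs_dnbhs.
    have h1 : \forall h \near (0 : R), `|h| < 1 by exact: near0_norm_lt.
    by apply: filterS h1 => u; rewrite ltr_norml ler_norml; move: t0 t1; clear; lra.
  move=> ht2; rewrite lt_min => /andP[hh1 hh2].
  have [xi [xi1 xi2]] := key _ _ t2 ht2.
  rewrite /= [_%:A]mulr1 xi2 addrK /GRing.scale/= mulKf// distrC; apply: hr1.
  apply: le_lt_trans xi1 _; rewrite addrK.
  have hsq : h ^+ 2 <= `|h| by rewrite -real_normK ?num_real// expr2 ler_piMr// ltW.
  apply: (@le_lt_trans _ _ (`|h| * (34 * dot w w + 1))).
    apply: le_trans (_ : _ <= `|h| * (34 * dot w w)) _.
      by rewrite ler_wpM2r// mulr_ge0 ?dot_ge0.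
    by rewrite ler_wpM2l// lerDl.
  by rewrite -ltr_pdivlMr.
apply: is_derive_coordP => i.
have -> : (fun u : R => c u 0 i) = (fun u : R => p 0 i + u * w 0 i + s u * e 0 i).
  by apply/funext => u; rewrite !mxE.
by apply: is_derive_eq; rewrite !mxE /GRing.scale/=; ring.
Unshelve. all: by end_near. Qed.

End LevelPaths.

Section TotallyGeodesic.
Context {R : realType} {m : nat}.
Notation V := 'rV[R]_m.+1.
Implicit Types (x y z p u v w e N : V) (f : V -> R) (S U M : set V) (c : R -> V).

Lemma constant01 (h : R -> R) :
  (forall t : R, 0 <= t <= 1 -> is_derive t 1 h 0) ->
  forall t : R, 0 <= t <= 1 -> h t = h 0.
Proof.
move=> hd t /andP[]; rewrite le_eqVlt => /predU1P[<-//|t0] t1.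
have [||s _] := @MVT R h (fun=> 0) 0 t t0.
- move=> s; rewrite in_itv/= => /andP[s0 st]; apply: hd.
  by rewrite ltW//= ltW// (lt_le_trans st).
- apply: continuous_in_subspaceT => s; rewrite inE/= in_itv/= => /andP[s0 st].
  by apply: is_derive_continuous; apply: hd; rewrite s0 (le_trans st).
- by rewrite mul0r => /eqP; rewrite subr_eq0 => /eqP.
Qed.

Lemma is_derive_shift0 c (t : R) u : is_derive t 1 c u ->
  is_derive (0 : R) 1 (fun s : R => c (s + t)) u.
Proof.
move=> cd; apply: is_derive_coordP => i.
have dl : is_derive (0 : R) 1 (fun s : R => s + t) 1.
  by apply: is_derive_eq; rewrite addr0.
rewrite -[u 0 i]mulr1; apply: (is_derive1_comp (f := fun s => c s 0 i)) dl.
by rewrite add0r; exact: is_derive_coord.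
Qed.

Lemma near_shift0 (A : set R) (t : R) : (\forall s \near t, A s) ->
  \forall s \near (0 : R), A (s + t).
Proof.
move=> At; have h0 : (fun s : R => s + t) @ (0 : R) --> (0 + t : R).
  by apply: (@cvgD _ _ _ _ (nbhs_filter (0 : R))); [exact: cvg_id|exact: cvg_cst].
by rewrite add0r in h0; exact: (h0 _ At).
Qed.

Definition unit_grad f x : V := (Num.sqrt (dot (grad f x) (grad f x)))^-1 *: grad f x.

Lemma unit_grad_unit f x : grad f x != 0 -> dot (unit_grad f x) (unit_grad f x) = 1.
Proof.
move=> g0; have gp : 0 < dot (grad f x) (grad f x) by rewrite dot_gt0.
rewrite /unit_grad dotZl dotZr mulrA -expr2 exprVn sqr_sqrtr ?ltW// mulVf// gt_eqF//.
Qed.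

Lemma unit_grad_orth f x u : grad f x != 0 ->
  dot (unit_grad f x) u = 0 <-> dot (grad f x) u = 0.
Proof.
move=> g0; rewrite /unit_grad dotZl; split=> [/eqP|->]; last by rewrite mulr0.
by rewrite mulf_eq0 invr_eq0 gt_eqF ?sqrtr_gt0 ?dot_gt0//= => /eqP.
Qed.

Lemma level_eq_restrict S U f : level_eq S U f -> level_eq (S `&` U) U f.
Proof.
move=> [oU fC gn SU]; split=> // x Ux; split=> [[/SU -> //]|/SU H].
by split=> //; exact: H.
Qed.

Lemma unit_normal_grad S U f : level_eq S U f -> U `<=` @halfspace R m ->
  unit_normal (S `&` U) (fun x => height x *: unit_grad f x).
Proof.
move=> lS UH; have [oU fC gn SU] := lS; split.
  apply: continuous_in_subspaceT => x; rewrite inE => -[_ Ux].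
  have gc := C1_grad_continuous (level_eq_C1 lS) Ux; have F := nbhs_filter x.
  apply: (@cvgZ _ _ _ _ F); first exact: continuous_height.
  apply: (@cvgZ _ _ _ _ F) => //; apply: (@cvgV _ _ _ F).
    by rewrite gt_eqF// sqrtr_gt0 dot_gt0 gn.
  apply: (@continuous_comp _ _ _ (fun x => dot (grad f x) (grad f x)) Num.sqrt).
    exact: (continuous_dot gc gc).
  exact: sqrt_continuous.
move=> p [Sp Up]; have hp : 0 < height p := UH _ Up; split.
  rewrite hmetricE dotZl dotZr unit_grad_unit ?gn// mulr1 -expr2 divff//.
  by rewrite expf_neq0// gt_eqF.
move=> u /(tangent_levelP u (level_eq_restrict lS) Up (conj Sp Up)) gu.
by rewrite hmetricE dotZl (unit_grad_orth u (gn _ Up)).2// mulr0 mul0r.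
Qed.

Lemma is_derive_unit_grad U f c (t : R) u : open U -> Ck 2 U f -> U (c t) ->
  grad f (c t) != 0 -> is_derive t 1 c u ->
  exists dn, is_derive t 1 (fun s => height (c s) *: unit_grad f (c s)) dn.
Proof.
move=> oU fC Uc g0 cd.
pose dg : V := \row_i dot (grad ('D_(delta_mx 0 i) f) (c t)) u.
have gd : is_derive t 1 (fun s => grad f (c s)) dg.
  apply: is_derive_coordP => i; rewrite mxE.
  have -> : (fun s => grad f (c s) 0 i) = 'D_(delta_mx 0 i) f \o c.
    by apply/funext => s; rewrite mxE.
  exact: (is_derive_C1_comp oU (fC.2 (delta_mx 0 i)) Uc cd).
have gp : 0 < dot (grad f (c t)) (grad f (c t)) by rewrite dot_gt0.
have d1 := is_derive1_comp (g := fun s => dot (grad f (c s)) (grad f (c s)))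
   (is_derive1_sqrt gp) (is_derive_dot gd gd).
have sn : Num.sqrt (dot (grad f (c t)) (grad f (c t))) != 0.
  by rewrite gt_eqF// sqrtr_gt0.
have d2 := is_deriveV (f := fun s => Num.sqrt (dot (grad f (c s)) (grad f (c s)))) sn d1.
have dh := is_derive_coord ord_max cd.
pose k (s : R) := height (c s) * (Num.sqrt (dot (grad f (c s)) (grad f (c s))))^-1.
have [k' dk] : exists k', is_derive t 1 k k'.
  by eexists; exact: (is_deriveM dh d2).
exists (k t *: dg + k' *: grad f (c t)).
apply: is_derive_coordP => i.
have -> : (fun s => (height (c s) *: unit_grad f (c s)) 0 i) =
    (fun s => k s * grad f (c s) 0 i).
  by apply/funext => s; rewrite /unit_grad !mxE mulrA.
apply: (is_derive_eq (is_deriveM dk (is_derive_coord i gd))).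
by rewrite !mxE /GRing.scale/= (mulrC k').
Qed.

(** With these coefficients, [quad] has gradient [N] at its zero [x], and
    [height b = 0]: for a unit vector [N] it is the equation of the hyperbolic
    hyperplane through [x] orthogonal to [N]. *)
Definition geo_al x N : R := height N / (2 * height x).
Definition geo_b x N : V := N - (2 * geo_al x N) *: x.
Definition geo_ga x N : R := - (geo_al x N * dot x x + dot (geo_b x N) x).

(** The vanishing of the shape operator says that the Euclidean unit normal varies
    by [dN(u) = (N_n / x_n) u]. Hence the tangent hyperbolic hyperplane is constant
    along every curve. *)
Lemma totally_geodesic_curve M U f c (c' : R -> V) :
  level_eq M U f -> U `<=` @halfspace R m -> totally_geodesic M ->
  (forall t : R, 0 <= t <= 1 ->
     [/\ (\forall s \near t, M (c s)), U (c t) & is_derive t 1 c (c' t)]) ->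
  [/\ geo_al (c 1) (unit_grad f (c 1)) = geo_al (c 0) (unit_grad f (c 0)),
      geo_b (c 1) (unit_grad f (c 1)) = geo_b (c 0) (unit_grad f (c 0)) &
      geo_ga (c 1) (unit_grad f (c 1)) = geo_ga (c 0) (unit_grad f (c 0))].
Proof.
move=> lS UH tg cP; have [oU fC gn SU] := lS.
pose n (s : R) := height (c s) *: unit_grad f (c s).
have nu1 := unit_normal_grad lS UH.
have hc (t : R) : 0 <= t <= 1 -> 0 < height (c t) by move=> /cP[_ /UH].
have ort (t : R) : 0 <= t <= 1 -> dot (unit_grad f (c t)) (c' t) = 0.
  move=> t01; have [cM Uc cd] := cP t t01.
  apply/unit_grad_orth; first exact: gn.
  apply/(tangent_levelP (c' t) lS Uc (nbhs_singleton cM)).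
  exists (fun s => c (s + t)); split; first by rewrite add0r.
    exact: near_shift0 cM.
  exact: is_derive_shift0.
have dn (t : R) : 0 <= t <= 1 -> is_derive t 1 n ((height (c t))^-1 *:
    (height (c' t) *: n t + height (n t) *: c' t)).
  move=> t01; have [cM Uc cd] := cP t t01.
  have hn : height (c t) != 0 by rewrite gt_eqF ?hc.
  have [d nd] := is_derive_unit_grad oU fC Uc (gn _ Uc) cd.
  have Scs : curve_in (M `&` U) (c t) (c' t) (fun s => c (s + t)).
    split; first by rewrite add0r.
    - have cU : \forall s \near t, U (c s).
        by apply: (is_derive_continuous cd); exact: open_nbhs_nbhs.
      by apply: (near_shift0 (A := fun s => (M `&` U) (c s))); move: cM cU; apply: filterS2 => s ? ?; split.
    - exact: is_derive_shift0.
  have sh : is_shape (M `&` U) (fun x => height x *: unit_grad f x) (c t) (c' t)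
      (- (d + connection_form (c t) (c' t) (n t))).
    exists (fun s => c (s + t)), d; split=> //.
    exact: (is_derive_shift0 (c := n) nd).
  have /eqP := tg U _ oU nu1 _ _ _ sh; rewrite oppr_eq0 addr_eq0 => /eqP dE.
  apply: (is_derive_eq nd); rewrite dE connection_formE// scaleNr opprK.
  congr (_ *: _); rewrite [dot (c' t) _]dotC /n dotZl ort// mulr0 scale0r subr0.
  by [].
have dh (t : R) : 0 <= t <= 1 -> is_derive t 1 (fun s => height (c s)) (height (c' t)).
  by move=> t01; have [_ _ cd] := cP t t01; exact: (is_derive_coord ord_max cd).
have dhn (t : R) : 0 <= t <= 1 -> is_derive t 1 (fun s => height (n s))
    ((height (c t))^-1 * (2 * height (c' t) * height (n t))).
  move=> t01; apply: (is_derive_eq (is_derive_coord ord_max (dn t t01))).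
  by rewrite -/(height _) heightZ heightD !heightZ; ring.
have ugE (t : R) : 0 <= t <= 1 -> unit_grad f (c t) = (height (c t))^-1 *: n t.
  by move=> t01; rewrite /n scalerA mulVf ?scale1r// gt_eqF ?hc.
pose a (t : R) := 2^-1 * height (n t) * ((height (c t))^-1 * (height (c t))^-1).
have aE (t : R) : 0 <= t <= 1 -> geo_al (c t) (unit_grad f (c t)) = a t.
  move=> t01; rewrite /geo_al ugE// heightZ /a; field.
  by rewrite gt_eqF ?hc.
have da (t : R) : 0 <= t <= 1 -> is_derive t 1 a 0.
  move=> t01; have hn : height (c t) != 0 by rewrite gt_eqF ?hc.
  have dV := is_deriveV hn (dh t t01).
  have dVV : is_derive t 1 (fun s : R => (height (c s))^-1 * (height (c s))^-1) _ :=
    is_deriveM dV dV.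
  have dZ : is_derive t 1 (fun s : R => 2^-1 * height (n s)) _ :=
    is_deriveZ (2^-1) (dhn t t01).
  by apply: (is_derive_eq (is_deriveM dZ dVV)); rewrite /GRing.scale/=; field.
have ac (t : R) : 0 <= t <= 1 -> a t = a 0 by exact: constant01.
have in01 : (0 : R) <= 0 <= (1 : R) by rewrite lexx ler01.
have in11 : (0 : R) <= 1 <= (1 : R) by rewrite lexx ler01.
pose b (t : R) := (height (c t))^-1 *: n t - (2 * a 0) *: c t.
have bE (t : R) : 0 <= t <= 1 -> geo_b (c t) (unit_grad f (c t)) = b t.
  by move=> t01; rewrite /geo_b aE// ac// ugE.
have bc (t : R) : 0 <= t <= 1 -> b t = b 0.
  move=> t01; apply/rowP => i.
  have H : forall t : R, 0 <= t <= 1 -> is_derive t 1 (fun s => b s 0 i) 0; last first.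
    exact: (constant01 H t01).
  move=> {t01}t t01.
  have [_ _ cd] := cP t t01.
  have hn : height (c t) != 0 by rewrite gt_eqF ?hc.
  have dV := is_deriveV hn (dh t t01).
  have -> : (fun s => b s 0 i) = (fun s => (height (c s))^-1 * n s 0 i - (2 * a 0) * c s 0 i).
    by apply/funext => s; rewrite !mxE.
  have dM : is_derive t 1 (fun s : R => (height (c s))^-1 * n s 0 i) _ :=
    is_deriveM dV (is_derive_coord i (dn t t01)).
  have dB := is_deriveB dM (is_deriveZ (2 * a 0) (is_derive_coord i cd)).
  apply: (is_derive_eq dB); rewrite -(ac t t01) /a.
  by move: (n t) => nt; rewrite !mxE /GRing.scale/=; field.
have g01 : quad (a 0) (b 0) 0 (c 1) = quad (a 0) (b 0) 0 (c 0).
  have H : forall t : R, 0 <= t <= 1 -> is_derive t 1 (quad (a 0) (b 0) 0 \o c) 0; last first.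
    exact: (constant01 H in11).
  move=> t t01.
  have [_ _ cd] := cP t t01.
  have dq := is_derive_C1_comp openT (C2_C1 openT (quad_C2 (a 0) (b 0) 0 openT)) I cd.
  apply: (is_derive_eq dq); rewrite grad_quad -(bc t t01).
  by rewrite /b -ugE// addrCA subrr addr0 ort.
rewrite /geo_ga !aE// !bE// (ac 1 in11) (bc 1 in11); split=> //.
by congr (- _); move: g01; rewrite /quad !addr0.
Qed.

End TotallyGeodesic.

Section HyperplaneLocal.
Context {R : realType} {m : nat}.
Notation V := 'rV[R]_m.+1.
Implicit Types (x y z p u v w N : V) (f : V -> R) (S U M : set V).

Lemma geo_b_height x N : 0 < height x -> height (geo_b x N) = 0.
Proof.
by move=> hx; rewrite /geo_b heightB heightZ /geo_al; field; rewrite gt_eqF.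
Qed.

Lemma geo_quad_grad x N : grad (quad (geo_al x N) (geo_b x N) (geo_ga x N)) x = N.
Proof. by rewrite grad_quad /geo_b addrC subrK. Qed.

Lemma geo_quad0 x N : quad (geo_al x N) (geo_b x N) (geo_ga x N) x = 0.
Proof. by rewrite /quad /geo_ga; ring. Qed.

Lemma geo_disc x N : dot N N = 1 ->
  dot (geo_b x N) (geo_b x N) - 4 * geo_al x N * geo_ga x N = 1.
Proof.
move=> N1; rewrite -[RHS]N1; have := sqr_grad_quad (geo_al x N) (geo_b x N) (geo_ga x N) x.
by rewrite geo_quad_grad geo_quad0 mulr0 add0r => <-.
Qed.

Lemma totally_geodesic_local M z : C2_hypersurface M -> totally_geodesic M -> M z ->
  exists U f, [/\ level_eq M U f, U z, U `<=` @halfspace R m &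
   \forall x \near z, M x ->
   [/\ geo_al x (unit_grad f x) = geo_al z (unit_grad f z),
      geo_b x (unit_grad f x) = geo_b z (unit_grad f z) &
      geo_ga x (unit_grad f x) = geo_ga z (unit_grad f z)]].
Proof.
move=> hM tg Mz; have [MH _] := hM.
have [U0 [f [lS0 U0z]]] := C2_hypersurface_level hM Mz.
have [oU0 _ _ _] := lS0.
have lS : level_eq M (U0 `&` @halfspace R m) f.
  by apply: level_eq_sub lS0 _ _ => [|x []//]; apply: openI => //; exact: halfspace_open.
have Uz : (U0 `&` @halfspace R m) z by split=> //; exact: MH.
exists (U0 `&` @halfspace R m), f; split; [exact: lS|exact: Uz|by move=> x []|].
apply: filterS (level_path lS Uz Mz) => x H /H[c [c' [c0 c1 cP]]].
have := totally_geodesic_curve lS _ tg cP.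
by rewrite c0 c1; apply => y [].
Qed.

(** On the quadric the gradient has length 1, so it is [k N] with [k = 1] or
    [k = - 1]; as [b] is horizontal, its last coordinate gives [al], and then [b]
    and [ga] follow. *)
Lemma geo_quadP al (b : V) ga x N : 0 < height x -> height b = 0 ->
  dot b b - 4 * al * ga = 1 -> dot N N = 1 ->
  quad al b ga x = 0 -> (forall u, dot N u = 0 -> dot (grad (quad al b ga) x) u = 0) ->
  exists2 k : R, k ^+ 2 = 1 &
    [/\ al = k * geo_al x N, b = k *: geo_b x N & ga = k * geo_ga x N].
Proof.
move=> hx b0 D1 N1 qx par.
have := orth_parallel par; rewrite N1 scale1r.
set k := dot _ N => gE; exists k.
  have := sqr_grad_quad al b ga x.
  by rewrite qx mulr0 add0r D1 gE dotZl dotZr N1 mulr1 expr2.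
rewrite grad_quad in gE.
have alE : al = k * geo_al x N.
  have : height (2 * al *: x + b) = height (k *: N) by rewrite gE.
  rewrite heightD !heightZ b0 addr0 /geo_al => E.
  by rewrite mulrA -E; field; rewrite gt_eqF.
have bE : b = k *: geo_b x N.
  by rewrite /geo_b scalerBr -gE scalerA mulrCA -alE addrAC subrr add0r.
split=> //; move: qx; rewrite /quad /geo_ga {1}alE {1}bE dotZl => /eqP.
by rewrite addrC addr_eq0 => /eqP ->; ring.
Qed.

(** Being tangent to a fixed hyperbolic hyperplane is an open and closed condition
    on the points of [M], since the tangent hyperbolic hyperplane is locally
    constant. *)
Lemma hyperplane_local_quadric M : M !=set0 -> connected M -> C2_hypersurface M ->
  totally_geodesic M -> exists al b ga,
   [/\ height b = 0, dot b b - 4 * al * ga = 1,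
      forall z, M z -> quad al b ga z = 0 &
      forall z, M z -> \forall y \near z, quad al b ga y = 0 -> M y].
Proof.
move=> [x0 Mx0] cM hM tg; have [MH _] := hM.
have [U0 [f0 [lS0 U0x U0H _]]] := totally_geodesic_local hM tg Mx0.
have [_ _ gn0 _] := lS0.
pose N0 := unit_grad f0 x0.
have N01 : dot N0 N0 = 1 by apply: unit_grad_unit; exact: gn0.
have h0 : 0 < height x0 := MH _ Mx0.
set al := geo_al x0 N0; set b := geo_b x0 N0; set ga := geo_ga x0 N0.
have b0 : height b = 0 by exact: geo_b_height.
have D1 : dot b b - 4 * al * ga = 1 by exact: geo_disc.
pose P z := quad al b ga z = 0 /\
  forall u, tangent M z u -> dot (grad (quad al b ga) z) u = 0.
have tanP z U f u : level_eq M U f -> U z -> M z ->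
    tangent M z u <-> dot (unit_grad f z) u = 0.
  move=> lS Uz Mz; have [_ _ gn _] := lS.
  have h1 := tangent_levelP u lS Uz Mz; have h2 := unit_grad_orth u (gn _ Uz).
  by split=> [/h1 /h2|/h2 /h1].
have Pk z U f : level_eq M U f -> U z -> M z -> P z <->
    exists2 k : R, k ^+ 2 = 1 &
    [/\ al = k * geo_al z (unit_grad f z), b = k *: geo_b z (unit_grad f z) &
        ga = k * geo_ga z (unit_grad f z)].
  move=> lS Uz Mz; have [_ _ gn _] := lS.
  have hz : 0 < height z := MH _ Mz.
  split=> [[qz tz]|[k _ [alE bE gaE]]].
    apply: geo_quadP => //; first by apply: unit_grad_unit; exact: gn.
    by move=> u Nu; apply: tz; apply/(tanP _ _ _ _ lS).
  split; last first.
    move=> u /(tanP _ _ _ _ lS Uz Mz) Nu; rewrite grad_quad alE bE mulrCA -scalerA -scalerDr.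
    by rewrite -(grad_quad _ _ (geo_ga z (unit_grad f z))) geo_quad_grad dotZl Nu mulr0.
  rewrite alE bE gaE.
  have -> (a' g' : R) (b' : V) : quad (k * a') (k *: b') (k * g') z = k * quad a' b' g' z.
    by rewrite /quad dotZl; ring.
  by rewrite geo_quad0 mulr0.
have Px0 : P x0.
  apply/(Pk _ _ _ lS0 U0x Mx0); exists 1; first by rewrite expr1n.
  by rewrite !mul1r scale1r.
have allP z : M z -> P z.
  move=> Mz; apply: (connected_locally_constant (P := P) cM _ Mx0 Mz Px0) => x Mx.
  have [U [f [lS Ux UH H]]] := totally_geodesic_local hM tg Mx.
  have [oU _ _ _] := lS; have nU := open_nbhs_nbhs (conj oU Ux).
  move: H nU; apply: filterS2 => y H Uy My; have [e1 e2 e3] := H My.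
  split=> [/(Pk _ _ _ lS Uy My)|/(Pk _ _ _ lS Ux Mx)].
    by rewrite e1 e2 e3 => Q; apply/(Pk _ _ _ lS Ux Mx).
  by rewrite -e1 -e2 -e3 => Q; apply/(Pk _ _ _ lS Uy My).
exists al, b, ga; split=> //; first by move=> z /allP[].
move=> z Mz; have [U [f [lS Uz]]] := C2_hypersurface_level hM Mz.
have [qz tz] := allP _ Mz.
have [_ _ gn _] := lS.
apply: (level_set_open lS Uz Mz).
  by apply/near_dotP; exists 1 => // x _ /allP[].
have par : forall u, dot (grad f z) u = 0 -> dot (grad (quad al b ga) z) u = 0.
  by move=> u gu; apply: tz; apply/(tangent_levelP u lS Uz Mz).
have gg := orth_parallel par.
apply/negP => /eqP g0; move: gg; rewrite dotC g0 scale0r => /eqP.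
rewrite scaler_eq0 dot_eq0 (negbTE (gn _ Uz)) /= -dot_eq0 sqr_grad_quad qz mulr0 add0r D1.
by rewrite oner_eq0.
Qed.

End HyperplaneLocal.

Section HyperplaneGlobal.
Context {R : realType} {m : nat}.
Notation V := 'rV[R]_m.+1.
Implicit Types (x y z p u v w N : V) (S U M : set V).

(** Given [cosh t], the equation [geo x N t = y] is linear in [N]. *)
Lemma geo_exists x y : halfspace x -> halfspace y -> x != y ->
  exists N (t : R), [/\ dot N N = 1, 0 < t, geo x N t = y &
    cosh t = 1 + dot (y - x) (y - x) / (2 * height x * height y)].
Proof.
move=> Hx Hy xy; have hx : 0 < height x := Hx; have hy : 0 < height y := Hy.
have d0 : 0 < dot (y - x) (y - x) by rewrite dot_gt0 subr_eq0 eq_sym.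
pose k := dot (y - x) (y - x) / (2 * height x * height y).
have k0 : 0 < k by rewrite divr_gt0// !mulr_gt0.
pose S := Num.sqrt ((1 + k) ^+ 2 - 1).
have S0 : 0 < S by rewrite sqrtr_gt0; have : 0 < k ^+ 2 by [rewrite exprn_gt0]; move: k0; clear; nra.
have SS : S ^+ 2 = (1 + k) ^+ 2 - 1.
  by rewrite /S sqr_sqrtr//; have : 0 < k ^+ 2 by [rewrite exprn_gt0]; move: k0; clear; nra.
have sE : sinh (asinh S) = S by exact: sinh_asinh.
have cE : cosh (asinh S) = 1 + k.
  have := cosh_sqr (asinh S); rewrite sE SS addrCA subrr addr0 => /eqP.
  rewrite eqrXn2// ?ltW ?cosh_gt0//; last by rewrite addr_gt0.
  by move=> /eqP.
pose N : V := S^-1 *: ((height y)^-1 *: (y - x) + k *: en).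
have dE : dot (y - x) (y - x) = 2 * height x * height y * k.
  by rewrite /k; field; rewrite !gt_eqF.
have hN : height N = S^-1 * (1 + k - height x / height y).
  by rewrite /N heightZ heightD !heightZ heightB height_en; field; rewrite !gt_eqF.
exists N, (asinh S); split=> //.
- rewrite /N dotZl dotZr !dotDl !dotDr !dotZl !dotZr dE (dotC en) !dot_en height_en heightB.
  have -> : forall A : R, S^-1 * (S^-1 * A) = A / S ^+ 2 by move=> A; field; rewrite gt_eqF.
  have n0 : (1 + k) ^+ 2 - 1 != 0 by rewrite -SS expf_neq0// gt_eqF.
  by rewrite SS; field; rewrite n0 !gt_eqF.
- exact: asinh_gt0.
- rewrite /geo.
  have -> : geo_den N (asinh S) = height x / height y.
    by rewrite /geo_den sE cE hN; field; rewrite !gt_eqF.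
  rewrite sE cE /N scalerA divff ?gt_eqF// scale1r.
  apply/rowP => i; rewrite !mxE; field.
  by rewrite !gt_eqF.
Qed.

(** The functions [x_i / x_n] and [1 / x_n], signed distances to vertical
    hyperplanes after composition, separate points. *)
Lemma quadrics_separate x y : (0 < m)%N -> halfspace x -> halfspace y ->
  (forall al (b : V) ga, height b = 0 -> dot b b - 4 * al * ga = 1 ->
     quad al b ga x / height x = quad al b ga y / height y) -> x = y.
Proof.
move=> m0 Hx Hy H; have hx : 0 < height x := Hx; have hy : 0 < height y := Hy.
have E (i : 'I_m.+1) (a : R) : i != ord_max -> (x 0 i + a) / height x = (y 0 i + a) / height y.
  move=> im; have := H 0 (delta_mx 0 i) a.
  rewrite /quad !mul0r !add0r !(dotC (delta_mx 0 i)) !dot_delta; apply.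
    by rewrite /height mxE eqxx eq_sym (negbTE im).
  by rewrite mxE !eqxx mulr0 mul0r subr0.
have im0 : (ord0 : 'I_m.+1) != ord_max by rewrite -val_eqE /= eq_sym -lt0n.
have hE : height x = height y.
  have e0 := E ord0 0 im0; have e1 := E ord0 1 im0; rewrite !addr0 in e0.
  by move: e1; rewrite !mulrDl e0 !mul1r => /addrI/invr_inj.
apply/rowP => i; have [->|im] := eqVneq i ord_max; first exact: hE.
have := E i 0 im; rewrite !addr0 hE => /mulIf; apply.
by rewrite invr_eq0 gt_eqF.
Qed.

(** Every point [y] of the quadric is joined to a point of [M] by a geodesic of the
    quadric. It cannot leave [M]: [M] is open in the quadric, and its points before
    an exit time form Cauchy sequences for the distance of [M]. The limit given by
    completeness is the exit point, because the functions [asinh (q / height)] are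
    continuous for this distance and separate points. *)
Lemma hyperplane_quadric M : (0 < m)%N -> hyperplane M -> exists al b ga,
  [/\ height b = 0, dot b b - 4 * al * ga = 1 &
      M = [set x | halfspace x /\ quad al b ga x = 0]].
Proof.
move=> m0 [M0 cM hM compl tg]; have [MH _] := hM.
have [al [b [ga [b0 D1 Mq Mo]]]] := hyperplane_local_quadric M0 cM hM tg.
exists al, b, ga; split=> //; apply/seteqP; split=> [x Mx|y [Hy qy]].
  by split; [exact: MH|exact: Mq].
have [x Mx] := M0; have Hx := MH _ Mx.
have [yx|yx] := eqVneq x y; first by rewrite -yx.
have [N [t0 [N1 t00 gy _]]] := geo_exists Hx Hy yx.
pose g (t : R) := geo x N t.
have Hg (t : R) : halfspace (g t) by exact: halfspace_geo.
have gq (t : R) : quad al b ga (g t) = 0.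
  have hx : height (g t) != 0 by rewrite gt_eqF//; exact: Hg.
  have F0 : quad al b ga (g t) / height (g t) = 0; last first.
    by move/eqP: F0; rewrite mulf_eq0 invr_eq0 (negbTE hx) orbF => /eqP.
  have E (s : R) := quotient_geo al ga s b0 N1 Hx.
  have := E t0; rewrite gy qy (Mq _ Mx) !mul0r mulr0 add0r => /esym/eqP.
  rewrite mulf_eq0 gt_eqF ?sinh_gt0//= => /eqP k0.
  by rewrite E (Mq _ Mx) mul0r mulr0 add0r k0 mulr0.
have lip al' (b' : V) ga' (s t : R) : height b' = 0 -> dot b' b' - 4 * al' * ga' = 1 ->
    `|asinh (quad al' b' ga' (g t) / height (g t)) - asinh (quad al' b' ga' (g s) / height (g s))|
     <= `|t - s|.
  move=> hb' D'; rewrite -lee_fin.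
  apply: le_trans (rdist_ge (S := @halfspace R m) _ _ _ hb' D') _ => //.
  by apply: rdist_geo => // u _; exact: Hg.
have limit (t : R) : 0 < t -> (forall s : R, 0 <= s < t -> M (g s)) -> M (g t).
  move=> tp Ms; pose s (k : nat) : R := t * (1 - k.+1%:R^-1).
  have sk k : 0 <= s k < t.
    rewrite mulr_ge0 ?subr_ge0 ?invf_le1 ?ler1n ?ltW//=.
    by rewrite gtr_pMr// ltrBlDr ltrDl invr_gt0.
  have ts k : t - s k = t / k.+1%:R by rewrite /s; ring.
  have small (e : R) : 0 < e -> exists n : nat, forall k, (n <= k)%N -> t - s k < e.
    move=> e0; exists (Num.bound (t / e)) => k nk; rewrite ts ltr_pdivrMr//.
    rewrite mulrC -ltr_pdivrMr//; apply: lt_le_trans (archi_boundP _) _.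
      by rewrite divr_ge0 ?ltW.
    by rewrite ler_nat ltnW.
  have dist i j : (rdist M (g (s i)) (g (s j)) <= `|s j - s i|%:E)%E.
    apply: rdist_geo => // u u01; apply: Ms.
    have -> : s i + u * (s j - s i) = (1 - u) * s i + u * s j by ring.
    have /andP[i0 it] := sk i; have /andP[j0 jt] := sk j; have /andP[u0 u1] := u01.
    have u1' : 0 <= 1 - u by rewrite subr_ge0.
    apply/andP; split; first by rewrite addr_ge0// mulr_ge0.
    have [u1e|u1n] := eqVneq u 1; first by rewrite u1e subrr mul0r add0r mul1r.
    have : (1 - u) * s i < (1 - u) * t by rewrite ltr_pM2l// subr_gt0 lt_neqAle u1n.
    have : u * s j <= u * t by rewrite ler_wpM2l// ltW.
    by clear; lra.
  have [||p Mp pP] := compl (g \o s).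
  - by move=> i; exact: Ms.
  - move=> e e0; have [n nP] := small _ e0; exists n => i j ni nj.
    apply: le_lt_trans (dist i j) _; rewrite lte_fin ltr_norml.
    have := nP _ ni; have := nP _ nj; have /andP[_ h1] := sk i; have /andP[_ h2] := sk j.
    by move: h1 h2; clear; lra.
  suff -> : g t = p by [].
  apply: (quadrics_separate m0 (Hg t) (MH _ Mp)) => al' b' ga' hb' D'.
  apply: asinh_inj; apply/eqP; rewrite -subr_eq0 -normr_le0; apply/ler_addgt0Pl => e e0.
  rewrite addr0; have e2 : 0 < e / 2 by rewrite divr_gt0.
  have [n1 P1] := small _ e2; have [n2 P2] := pP _ e2.
  have := P1 _ (leq_maxl n1 n2); have := P2 _ (leq_maxr n1 n2).
  set k := maxn n1 n2 => h1 h2.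
  have h3 := le_lt_trans (rdist_ge (g (s k)) p MH hb' D') h1.
  have h4 := lip _ _ _ (s k) t hb' D'; have /andP[_ skt] := sk k.
  have tsk : 0 < t - s k by rewrite subr_gt0.
  rewrite (gtr0_norm tsk) in h4.
  rewrite lte_fin distrC in h3.
  apply: le_trans (ler_distD (asinh (quad al' b' ga' (g (s k)) / height (g (s k)))) _ _) _.
  by rewrite [leRHS]splitr lerD// ?(ltW h3)// (le_trans h4)// ltW.
have openg (t : R) : M (g t) -> \forall s \near t, M (g s).
  move=> Mt; have gc : {for t, continuous g} by exact: is_derive_continuous (is_derive_geo x t N1).
  have H : \forall s \near t, quad al b ga (g s) = 0 -> M (g s) := gc _ (Mo _ Mt).
  by apply: filterS H => s /(_ (gq s)).
pose P (t : R) := forall s : R, 0 <= s <= t -> M (g s).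
have cI : connected `[(0 : R), t0]%classic.
  by apply/connected_intervalP; exact: interval_is_interval.
have P0 : P 0.
  by move=> s; rewrite -eq_le => /eqP <-; rewrite /g geo0.
suff : P t0 by move=> /(_ t0); rewrite /g gy; apply; rewrite ltW/=.
apply: (connected_locally_constant (P := P) cI _ _ _ P0); last 2 first.
- by rewrite /= in_itv/= lexx ltW.
- by rewrite /= in_itv/= lexx ltW.
move=> t; rewrite /= in_itv/= => /andP[tp tt0].
have [Pt|nPt] := pselect (P t).
  have Mt : M (g t) by apply: Pt; rewrite tp lexx.
  have /nbhs_ballP[e /= e0 eP] := openg _ Mt.
  apply/nbhs_ballP; exists e => //= t' tt' _; split=> // _ s /andP[s0 st'].
  have [st|st] := lerP s t; first by apply: Pt; rewrite s0.
  by apply: eP; move: tt'; rewrite /ball/= !ltr_norml; move: st st'; clear; lra.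
have [s /andP[s0 st] nMs] : exists2 s : R, 0 <= s < t & ~ M (g s).
  apply: contrapT => H; apply: nPt => s /andP[s0]; rewrite le_eqVlt => /predU1P[->|st].
    have [t1|t1] := eqVneq t 0; first by apply: P0; rewrite t1 lexx.
    apply: limit; first by rewrite lt_neqAle eq_sym t1.
    by move=> u u1; apply: contrapT => nM; apply: H; exists u.
  by apply: contrapT => nM; apply: H; exists s; rewrite ?s0.
have : \forall t' \near t, s < t' by exact: lt_nbhsr.
apply: filterS => t' stt' _; split=> [Pt'|/nPt//].
by case: nMs; apply: Pt'; rewrite s0 ltW.
Qed.

End HyperplaneGlobal.

(** * Hyperspheres *)

Section Hyperspheres.
Context {R : realType} {m : nat}.
Notation V := 'rV[R]_m.+1.
Implicit Types (x y z p u v w N : V) (S U M P : set V).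

(** The vector [n] is [height x] times the gradient of [q / height] at [x]. *)
Lemma sqr_quotient_grad (al : R) (b : V) (ga : R) x (F := quad al b ga x / height x)
  (n := grad (quad al b ga) x - F *: en) : 0 < height x ->
  height b = 0 -> dot b b - 4 * al * ga = 1 -> dot n n = 1 + F ^+ 2.
Proof.
move=> hx b0 D1; rewrite /n sqr_shift sqr_grad_quad D1 grad_quad heightD heightZ b0 addr0.
have -> : quad al b ga x = F * height x by rewrite /F divfK// gt_eqF.
by ring.
Qed.

(** The geodesic which leaves [x] along the gradient of [q / height] reaches the
    hyperplane at the time given by the Lipschitz bound [rdist_ge]. *)
Lemma rdist_hyperplane (al : R) (b : V) (ga : R) x
  (P := [set y | halfspace y /\ quad al b ga y = 0]) :
  height b = 0 -> dot b b - 4 * al * ga = 1 -> halfspace x ->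
  ereal_inf [set rdist (@halfspace R m) x y | y in P] =
  (asinh `|quad al b ga x / height x|)%:E.
Proof.
move=> b0 D1 Hx; have hx : 0 < height x := Hx.
set F := quad al b ga x / height x.
apply/eqP; rewrite eq_le; apply/andP; split; last first.
  apply: le_ereal_inf_tmp => _ [y [Hy qy] <-].
  have := @rdist_ge R m (@halfspace R m) al b ga x y (fun _ h => h) b0 D1.
  rewrite qy mul0r asinh0 sub0r normrN -/F; apply: le_trans.
  rewrite lee_fin; have [F0|F0] := lerP 0 F.
    by rewrite ger0_norm// ler_norm.
  by rewrite ltr0_norm// asinhN -normrN ler_norm.
pose s : R := if 0 <= F then 1 else - 1.
have sF : s * `|F| = F.
  rewrite /s; case: (lerP 0 F) => F0; first by rewrite ger0_norm// mul1r.
  by rewrite ltr0_norm// mulrNN mul1r.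
have ss : s ^+ 2 = 1 by rewrite /s; case: ifP; rewrite ?expr1n ?sqrrN ?expr1n.
pose n := grad (quad al b ga) x - F *: en.
pose C := Num.sqrt (1 + F ^+ 2).
have C0 : 0 < C := sqrt1_gt0 F.
have nn : dot n n = C ^+ 2.
  by rewrite /C sqr_sqrtr ?addr_ge0 ?sqr_ge0//; exact: sqr_quotient_grad.
pose N := (- s / C) *: n.
have N1 : dot N N = 1.
  rewrite /N dotZl dotZr nn; have -> : - s / C * (- s / C * C ^+ 2) = s ^+ 2.
    by field; rewrite gt_eqF.
  by [].
pose t := asinh `|F|.
have tS : sinh t = `|F| by exact: sinh_asinh.
have tC : cosh t = C.
  apply/eqP; rewrite -(@eqrXn2 _ 2) ?ltW ?cosh_gt0//; apply/eqP.
  by rewrite cosh_sqr tS /C sqr_sqrtr ?addr_ge0 ?sqr_ge0// real_normK ?num_real.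
have t0 : 0 <= t.
  have [F0|F0] := eqVneq F 0; first by rewrite /t F0 normr0 asinh0.
  by apply/ltW/asinh_gt0; rewrite normr_gt0.
have H := halfspace_geo t N1 Hx.
have gP : P (geo x N t).
  split=> //; have hg : height (geo x N t) != 0 by rewrite gt_eqF.
  have : quad al b ga (geo x N t) / height (geo x N t) = 0.
    rewrite (quotient_geo al ga t b0 N1 Hx) -/F -/n tC tS /N dotZr nn.
    rewrite -{1}sF; field; rewrite gt_eqF//.
  by move/eqP; rewrite mulf_eq0 invr_eq0 (negbTE hg) orbF => /eqP.
apply: le_trans (ereal_inf_lbound _) _; first by exists (geo x N t).
have := @rdist_geo R m (@halfspace R m) x N 0 t N1 Hx.
rewrite geo0 subr0 (ger0_norm t0); apply => u _; exact: halfspace_geo.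
Qed.

Lemma equidistant_setE (al : R) (b : V) (ga r : R) :
  height b = 0 -> dot b b - 4 * al * ga = 1 ->
  equidistant_set [set y | halfspace y /\ quad al b ga y = 0] r =
  [set x | halfspace x /\ `|quad al b ga x| = sinh r * height x].
Proof.
move=> b0 D1; apply/seteqP; split=> x /= [Hx]; have hx : 0 < height x := Hx.
  rewrite rdist_hyperplane// => -[<-]; split=> //.
  by rewrite sinh_asinh normrM normfV (gtr0_norm hx) divfK// gt_eqF.
move=> E; split=> //; rewrite rdist_hyperplane//.
by rewrite normrM normfV (gtr0_norm hx) E mulfK ?gt_eqF// asinh_sinh.
Qed.

(** The geodesics orthogonal to a hyperplane carry it onto each of its equidistant
    hypersurfaces, which are therefore connected. *)
Lemma equidistant_connected (al : R) (b : V) (ga r : R) :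
  height b = 0 -> dot b b - 4 * al * ga = 1 ->
  connected [set y | halfspace y /\ quad al b ga y = 0] ->
  connected [set x | halfspace x /\ quad al b ga x = sinh r * height x].
Proof.
move=> b0 D1 cP; pose q := quad al b ga.
have N1 y : q y = 0 -> dot (grad q y) (grad q y) = 1.
  by move=> qy; rewrite sqr_grad_quad -/q qy mulr0 add0r.
pose Phi y := geo y (grad q y) r.
suff -> : [set x | halfspace x /\ q x = sinh r * height x] =
    Phi @` [set y | halfspace y /\ q y = 0].
  apply: connected_continuous_connected => //.
  apply: continuous_in_subspaceT => y; rewrite inE => -[Hy qy].
  have F := nbhs_filter y.
  have gc : {for y, continuous (grad q)}.
    exact: (C1_grad_continuous (C2_C1 openT (quad_C2 al b ga openT)) I).
  have hc : {for y, continuous (@height R m)} by exact: continuous_height.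
  have hgc : {for y, continuous (fun x => height (grad q x))}.
    by apply: (@continuous_comp _ _ _ (grad q) (@height R m)) => //; exact: continuous_height.
  apply: (@cvgD _ _ _ _ F); first exact: cvg_id.
  apply: (@cvgZ _ _ _ _ F).
    apply: (@cvgM _ _ _ F) => //; apply: (@cvgV _ _ _ F).
      by rewrite gt_eqF// geo_den_gt0// N1.
    apply: (@cvgB _ _ _ _ F); first exact: cvg_cst.
    by apply: (@cvgM _ _ _ F); first exact: cvg_cst.
  apply: (@cvgD _ _ _ _ F); last exact: cvg_cst.
  by apply: (@cvgZr _ _ _ _ F).
apply/seteqP; split=> [x [Hx qx]|_ [y [Hy qy] <-]]; last first.
  have Hg : halfspace (Phi y) by exact: (halfspace_geo r (N1 _ qy) Hy).
  split=> //; have hg : height (Phi y) != 0 by rewrite gt_eqF.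
  have := quotient_geo al ga r b0 (N1 _ qy) Hy; rewrite -/q -/(Phi y) qy mul0r mulr0 add0r.
  rewrite scale0r subr0 N1// mulr1 => <-.
  by rewrite divfK.
have hx : 0 < height x := Hx.
have FE : q x / height x = sinh r by rewrite qx mulfK// gt_eqF.
pose n := grad q x - sinh r *: en.
have C0 := cosh_gt0 r.
have nn : dot n n = cosh r ^+ 2.
  by have := sqr_quotient_grad hx b0 D1; rewrite -/q FE cosh_sqr.
pose N := (cosh r)^-1 *: n.
have NN : dot N N = 1.
  by rewrite /N dotZl dotZr nn; field; rewrite gt_eqF.
pose y := geo x N (- r).
have Hy : halfspace y by exact: halfspace_geo.
exists y.
  split=> //; have hg : height y != 0 by rewrite gt_eqF.
  have : q y / height y = 0.
    rewrite (quotient_geo al ga (- r) b0 NN Hx) -/q FE -/n coshN sinhN /N dotZr nn.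
    by field; rewrite gt_eqF.
  by move/eqP; rewrite mulf_eq0 invr_eq0 (negbTE hg) orbF => /eqP.
have CS := cosh_sqr r.
have S2 : sinh r ^+ 2 = cosh r ^+ 2 - 1 by rewrite CS addrC addKr.
have hN : height N = (cosh r)^-1 * (2 * al * height x - sinh r).
  by rewrite /N heightZ /n heightB heightZ height_en mulr1 grad_quad heightD heightZ b0 addr0.
have denE : geo_den N (- r) = (1 + 2 * al * sinh r * height x) / cosh r.
  rewrite /geo_den coshN sinhN hN.
  have -> : cosh r - - sinh r * ((cosh r)^-1 * (2 * al * height x - sinh r)) =
    (cosh r ^+ 2 - sinh r ^+ 2 + 2 * al * sinh r * height x) / cosh r by field; rewrite gt_eqF.
  by rewrite CS addrK.
have w0 : 1 + 2 * al * sinh r * height x != 0.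
  have := geo_den_gt0 (- r) NN; rewrite denE pmulr_lgt0 ?invr_gt0// => w0.
  by rewrite gt_eqF.
have hy : height y = height x * cosh r / (1 + 2 * al * sinh r * height x).
  by rewrite height_geo// denE; field; rewrite w0 gt_eqF.
have yE : y = x + (height x / (1 + 2 * al * sinh r * height x)) *:
    (- sinh r *: grad q x + (cosh r - 1) *: en).
  rewrite /y /geo denE coshN sinhN /N /n.
  have e1 : sinh r * sinh r = cosh r ^+ 2 - 1 by rewrite -S2 expr2.
  apply/rowP => i; move: (grad q x) => g; rewrite !mxE.
  move: (cosh r) (sinh r) C0 e1 w0 (g 0 i) => C S C0 e1 w0 gi; move: (_ == _)%:R => ei.
  apply/eqP; rewrite -subr_eq0; apply/eqP.
  have Z : height x / (1 + 2 * al * S * height x) * (S * S - (C ^+ 2 - 1)) * ei = 0.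
    by rewrite e1 subrr mulr0 mul0r.
  rewrite -[RHS]Z; field; rewrite w0 gt_eqF//.
rewrite /Phi /geo.
have -> : geo_den (grad q y) r = cosh r / (1 + 2 * al * sinh r * height x).
  by rewrite /geo_den grad_quad heightD heightZ b0 addr0 hy; field.
rewrite hy.
have -> : height x * cosh r / (1 + 2 * al * sinh r * height x) /
   (cosh r / (1 + 2 * al * sinh r * height x)) = height x by field; rewrite w0 gt_eqF.
rewrite grad_quad yE grad_quad; apply/rowP => i; rewrite !mxE.
by field.
Qed.

(** The equidistant set is the union of the two sets [q = sinh r * height] and
    [q = - sinh r * height], each of them connected, and separated by the sign of
    [q]; a hypersphere is one of them. *)
Lemma hypersphere_quadric M : (0 < m)%N -> hypersphere M -> exists al b ga,
  [/\ M !=set0 /\ connected M, M = [set x | halfspace x /\ quad al b ga x = 0],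
      height b <= 0, 0 < dot b b - 4 * al * ga &
      0 <= dot b b - 4 * al * ga - height b ^+ 2].
Proof.
move=> m0 [P [r [x [hP r0 Ex ME]]]].
have [al0 [b0 [ga0 [hb0 D0 PE]]]] := hyperplane_quadric m0 hP.
have [_ cP0 _ _ _] := hP.
have S0 := sinh_gt0 r0.
have [al [b [ga [hb D PE' qx]]]] : exists al b ga, [/\ height b = 0,
    dot b b - 4 * al * ga = 1, P = [set y | halfspace y /\ quad al b ga y = 0] &
    0 <= quad al b ga x].
  have [q0|q0] := lerP 0 (quad al0 b0 ga0 x); first by exists al0, b0, ga0.
  exists (- al0), (- b0), (- ga0); split.
  - by rewrite -scaleN1r heightZ hb0 mulr0.
  - by rewrite dotNl dotNr -[RHS]D0; ring.
  - rewrite PE; apply/seteqP; split=> y /= [Hy]; rewrite quad_opp.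
      by move=> ->; rewrite oppr0.
    by move/eqP; rewrite oppr_eq0 => /eqP.
  - by rewrite quad_opp oppr_ge0 ltW.
have EE := equidistant_setE r hb D; rewrite -PE' in EE.
have cP : connected [set y | halfspace y /\ quad al b ga y = 0] by rewrite -PE'.
have cL := @equidistant_connected al b ga r hb D cP.
have hE : height (b - sinh r *: en) = - sinh r.
  by rewrite heightB heightZ height_en mulr1 hb sub0r.
have DE : dot (b - sinh r *: en) (b - sinh r *: en) - 4 * al * ga = 1 + sinh r ^+ 2.
  by rewrite sqr_shift hb -[X in _ = X + _]D; ring.
exists al, (b - sinh r *: en), ga; split.
- split; last by rewrite ME; exact: component_connected.
  by exists x; rewrite ME; exact: connected_component_refl.
- have LE : [set y | halfspace y /\ quad al (b - sinh r *: en) ga y = 0] =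
     [set y | halfspace y /\ quad al b ga y = sinh r * height y].
    apply/seteqP; split=> y /= [Hy]; rewrite quad_shift.
      by move/eqP; rewrite subr_eq0 => /eqP.
    by move=> ->; rewrite subrr.
  rewrite LE ME; apply/seteqP; split; last first.
    apply: connected_component_max => //.
      by move: Ex; rewrite EE => -[Hx]; rewrite ger0_norm.
    move=> y [Hy qy]; rewrite EE; split=> //.
    by rewrite qy ger0_norm// mulr_ge0 ?ltW.
  have Cx : connected_component (equidistant_set P r) x x by exact: connected_component_refl.
  have CE y : connected_component (equidistant_set P r) x y ->
      halfspace y /\ `|quad al b ga y| = sinh r * height y.
    by move=> /connected_component_sub; rewrite EE.
  have pos y : connected_component (equidistant_set P r) x y -> 0 < quad al b ga y.
    move=> Cy.
    have cC := @component_connected _ (equidistant_set P r) x.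
    apply: (connected_locally_constant (P := fun y => 0 < quad al b ga y) cC _ Cx Cy).
      move=> z Cz; have [Hz qz] := CE _ Cz.
      have hz : 0 < height z := Hz.
      have qc : {for z, continuous (quad al b ga)} by exact: quad_continuous.
      have [z0|z0] := ltrP 0 (quad al b ga z).
        by apply: filterS (continuous_near_gt qc z0) => u u0 _; split.
      have z1 : quad al b ga z < 0.
        rewrite lt_neqAle z0 andbT -normr_eq0 qz mulf_neq0// gt_eqF//.
      apply: filterS (continuous_near_lt qc z1) => u u0 _; split=> //.
      by move=> /(lt_trans u0); rewrite ltxx.
    have [Hx] := CE _ Cx; rewrite ger0_norm// => ->.
    by rewrite mulr_gt0.
  by move=> y Cy; have [Hy] := CE _ Cy; rewrite (gtr0_norm (pos _ Cy)).
- by rewrite hE oppr_le0 ltW.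
- by rewrite DE ltr_wpDr ?sqr_ge0.
- by rewrite DE hE sqrrN addrK.
Qed.

End Hyperspheres.

(** * Horospheres *)

Section Isometries.
Context {R : realType} {m : nat}.
Notation V := 'rV[R]_m.+1.
Notation H := (@halfspace R m).
Implicit Types (x y z p u v w N : V) (phi psi : V -> V) (c : R -> V).

(** The hyperbolic cosine of the distance between [x] and [y]. *)
Definition cosh_dist x y : R := 1 + dot (y - x) (y - x) / (2 * height x * height y).

Lemma ler_cosh (s t : R) : 0 <= s -> s <= t -> cosh s <= cosh t.
Proof.
move=> s0 st; have t0 := le_trans s0 st.
have cs (a : R) : 0 <= cosh a := ltW (cosh_gt0 a).
rewrite -(@ler_pXn2r _ 2) ?nnegrE// !cosh_sqr lerD2l.
have sh0 (a : R) : 0 <= a -> 0 <= sinh a.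
  by rewrite le_eqVlt => /predU1P[<-|/sinh_gt0/ltW//]; rewrite sinh0.
rewrite ler_pXn2r ?nnegrE ?sh0//.
by rewrite ler_pM2r ?invr_gt0// lerB// ler_expR// lerN2.
Qed.

Lemma Ck1_coord phi i : Ck 1 H phi -> Ck 1 H (fun x => phi x 0 i).
Proof.
move=> [fd fc].
have dE v x : H x -> 'D_v (fun x => phi x 0 i) x = ('D_v phi x) 0 i.
  by move=> Hx; rewrite derive_mx ?mxE//; exact: fd.
split=> [x v Hx|v]; first exact: (derivable_mxP _ _ _).1 (fd x v Hx) 0 i.
apply: (@Ck_eq R m 0 H (fun x => ('D_v phi x) 0 i)) => [||x Hx].
- exact: halfspace_open.
- by move=> x Hx; rewrite dE.
- have dc : {for x, continuous (fun x => 'D_v phi x)} by exact: fc.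
  exact: (cvg_comp _ _ dc (@coord_continuous _ _ _ 0 i _)).
Qed.

Lemma is_derive_map phi c (t : R) u : Ck 1 H phi -> H (c t) ->
  is_derive t 1 c u -> is_derive t 1 (phi \o c) ('D_u phi (c t)).
Proof.
move=> fC Hc cd; apply: is_derive_coordP => i.
have fi := Ck1_coord i fC.
apply: (is_derive_eq (is_derive_C1_comp (@halfspace_open R m) fi Hc cd)).
rewrite -(C1_deriveE u (@halfspace_open R m) fi Hc) derive_mx ?mxE//.
by case: fC => fd _; exact: fd.
Qed.

(** A map preserving the metric does not increase distances: it sends geodesics
    to curves of the same length. *)
Lemma cosh_dist_le phi x y : Ck 1 H phi -> phi @` H `<=` H ->
  (forall x u, H x -> hmetric (phi x) ('D_u phi x) ('D_u phi x) = hmetric x u u) ->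
  H x -> H y -> cosh_dist (phi x) (phi y) <= cosh_dist x y.
Proof.
move=> fC fH iso Hx Hy.
have fx : H (phi x) by apply: fH; exists x.
have fy : H (phi y) by apply: fH; exists y.
have k1 z w : H z -> H w -> 1 <= cosh_dist z w.
  by move=> Hz Hw; rewrite lerDl divr_ge0 ?dot_ge0// !mulr_ge0// ltW.
have [xy|xy] := eqVneq x y.
  by rewrite xy /cosh_dist !subrr !dot0l !mul0r.
have [fxy|fxy] := eqVneq (phi x) (phi y).
  by rewrite fxy {1}/cosh_dist subrr dot0l mul0r addr0 k1.
have [N [t [N1 t0 gt kt]]] := geo_exists Hx Hy xy.
have [N' [t' [N1' t0' gt' kt']]] := geo_exists fx fy fxy.
rewrite /cosh_dist -kt -kt'; apply: ler_cosh; first exact: ltW.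
have Hg (s : R) : H (geo x N s) by exact: halfspace_geo.
(* the hyperplane orthogonal at [phi x] to the geodesic separates the images *)
have lo : (t'%:E <= rdist H (phi x) (phi y))%E.
  have hfx : 0 < height (phi x) := fx.
  have := @rdist_ge R m H _ _ _ (phi x) (phi y) (fun _ h => h)
    (geo_b_height N' hfx) (geo_disc (phi x) N1').
  have := quotient_geo (geo_al (phi x) N') (geo_ga (phi x) N') t'
    (geo_b_height N' hfx) N1' fx.
  rewrite gt' => ->; rewrite geo_quad0 geo_quad_grad mul0r asinh0 subr0 mulr0 add0r.
  by rewrite scale0r subr0 N1' mulr1 asinh_sinh gtr0_norm.
have up : (rdist H (phi x) (phi y) <= `|t - 0|%:E)%E.
  rewrite -gt -{1}(geo0 x N).
  apply: (@rdist_unit_speed _ _ H (phi \o geo x N) (fun s => 'D_(geo' x N s) phi (geo x N s))).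
  - by move=> s; apply: is_derive_map => //; exact: is_derive_geo.
  - move=> s; apply: mx_continuous => i.
    have fi := Ck1_coord i fC.
    have -> : (fun s : R => ('D_(geo' x N s) phi (geo x N s)) 0 i) =
        (fun s => dot (grad (fun x => phi x 0 i) (geo x N s)) (geo' x N s)).
      apply/funext => s'; rewrite -(C1_deriveE _ (@halfspace_open R m) fi (Hg s')).
      by rewrite derive_mx ?mxE//; case: fC => fd _; exact: fd.
    apply: continuous_dot; last exact: geo'_continuous.
    apply: (@continuous_comp _ _ _ (geo x N) (grad (fun x => phi x 0 i))).
      exact: is_derive_continuous (is_derive_geo x s N1).
    exact: (C1_grad_continuous fi (Hg s)).
  - by move=> s; rewrite iso// geo_unit_speed.
  - by move=> s _; apply: fH; exists (geo x N (0 + s * (t - 0))).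
have := le_trans lo up; rewrite lee_fin subr0 gtr0_norm//.
Qed.

(** The inverse of an isometry preserves the metric by the chain rule, so that
    neither of the two maps increases distances. *)
Lemma isometry_cosh_dist phi : Defs.isometry phi ->
  [/\ forall x, H x -> {for x, continuous phi}, phi @` H `<=` H,
     (forall z, H z -> exists2 x, H x & phi x = z) &
     forall x y, H x -> H y -> cosh_dist (phi x) (phi y) = cosh_dist x y].
Proof.
move=> [fS fH [psi [gS gH gf fg]] iso].
have fC : Ck 1 H phi by exact: fS.
have gC : Ck 1 H psi by exact: gS.
split=> [x Hx|//|z Hz|x y Hx Hy].
- by have /(_ x Hx) : Ck 0 H phi by exact: fS.
- by exists (psi z); [apply: gH; exists z|exact: fg].
have fx : H (phi x) by apply: fH; exists x.
have fy : H (phi y) by apply: fH; exists y.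
apply/eqP; rewrite eq_le; apply/andP; split.
  exact: (cosh_dist_le fC fH (fun x u Hx => iso x u u Hx) Hx Hy).
rewrite -{1}(gf x Hx) -{1}(gf y Hy); apply: cosh_dist_le => // z u Hz.
have Hgz : H (psi z) by apply: gH; exists z.
have cd := is_derive_affine z u 0.
have z0 : z + (0 : R) *: u = z by rewrite scale0r addr0.
have c0 : H (z + (0 : R) *: u) by rewrite z0.
have d1 := is_derive_map gC c0 cd.
have c1 : H ((psi \o (fun s : R => z + s *: u)) 0) by rewrite /= z0.
have d2 := is_derive_map fC c1 d1.
have cc := is_derive_continuous cd.
have nH : \forall s \near (0 : R), H (z + s *: u).
  by apply: (cc _ (open_nbhs_nbhs _)); split; [exact: halfspace_open|exact: c0].
have E : \forall s \near (0 : R), (phi \o (psi \o (fun s : R => z + s *: u))) s = z + s *: u.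
  by apply: filterS nH => s; exact: fg.
have [_ e1] := near_eq_is_derive E d2; have [_ e2] := cd.
rewrite e2 /= z0 in e1.
by rewrite -iso// -e1 fg.
Qed.

(** For [y1 = en] and [y2 = 2 en], one has [3 / x_n = 4 cosh d(x, y2) - 2 cosh d(x, y1)],
    so [{x_n = 1}] is defined by distances; its image is defined in the same way
    from the images [w1], [w2] of [y1], [y2], and this equation is a quadric. Its
    discriminant depends only on the distance between [w1] and [w2]. *)
Lemma horosphere_quadric M : horosphere M -> exists al b ga,
  [/\ M !=set0 /\ connected M, M = [set x | H x /\ quad al b ga x = 0],
      height b <= 0, 0 < dot b b - 4 * al * ga &
      0 <= dot b b - 4 * al * ga - height b ^+ 2].
Proof.
move=> [phi /isometry_cosh_dist[fc fH fs fd] ME].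
have He (s : R) : 0 < s -> H (s *: en).
  by move=> s0; rewrite /halfspace /= heightZ height_en mulr1.
have kE x (s : R) : 0 < s -> H x -> cosh_dist x (s *: en) * (2 * s * height x) = dot x x + s ^+ 2.
  move=> s0 Hx; have hx : 0 < height x := Hx.
  rewrite /cosh_dist heightZ height_en mulr1 dotBl !dotBr !dotZl !dotZr (dotC en) !dot_en height_en.
  by field; rewrite !gt_eqF.
pose w1 := phi (1 *: en); pose w2 := phi (2 *: en).
have H1 : H (1 *: en) by exact: He.
have H2 : H (2 *: en) by exact: He.
have Hw1 : 0 < height w1 by apply: fH; exists (1 *: en).
have Hw2 : 0 < height w2 by apply: fH; exists (2 *: en).
pose al := 2 / height w2 - 1 / height w1.
pose b : V := - ((4 / height w2) *: w2) + (2 / height w1) *: w1 - en.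
pose ga := 2 * dot w2 w2 / height w2 - dot w1 w1 / height w1.
have hb : height b = - 3.
  rewrite /b heightB heightD -scaleNr !heightZ height_en; field.
  by rewrite !gt_eqF.
have D9 : dot b b - 4 * al * ga = 9.
  have k12 : dot (w2 - w1) (w2 - w1) = height w1 * height w2 / 2.
    have := fd _ _ H1 H2; rewrite -/w1 -/w2 /cosh_dist !heightZ height_en.
    rewrite -scalerBl dotZl dotZr dot_en height_en => /addrI E.
    have n0 : 2 * height w1 * height w2 != 0 by rewrite !mulf_neq0// gt_eqF.
    by rewrite (canRL (divfK n0) E); field.
  have -> : dot b b - 4 * al * ga = 5 + 8 * dot (w2 - w1) (w2 - w1) / (height w1 * height w2).
    rewrite /b /al /ga !dotE (dotC w2 w1) !(dotC en) !dot_en height_en.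
    by field; rewrite !gt_eqF.
  by rewrite k12; field; rewrite !gt_eqF.
have qE x : H x -> quad al b ga (phi x) = 3 * height (phi x) * ((height x)^-1 - 1).
  move=> Hx; have hx : 0 < height x := Hx.
  have hz : 0 < height (phi x) by apply: fH; exists x.
  have k1 := kE x 1 ltr01 Hx; have k2 := kE x 2 (ltr0n R 2) Hx.
  rewrite -(fd _ _ Hx H1) -/w1 in k1; rewrite -(fd _ _ Hx H2) -/w2 in k2.
  have -> : (height x)^-1 = (4 * cosh_dist (phi x) w2 - 2 * cosh_dist (phi x) w1) / 3.
    apply: (mulIf (negbT (gt_eqF hx))); rewrite mulVf ?gt_eqF//.
    by move: k1 k2; clear; lra.
  rewrite /quad /b /al /ga /cosh_dist; move: (phi x) hz => z hz.
  rewrite !dotE (dotC w2 z) (dotC w1 z) !(dotC en) !dot_en.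
  by field; rewrite !gt_eqF.
have qP x : H x -> quad al b ga (phi x) = 0 <-> height x = 1.
  move=> Hx; have hx : 0 < height x := Hx.
  have hz : 0 < height (phi x) by apply: fH; exists x.
  rewrite qE//; split=> [/eqP|->]; last by rewrite invr1 subrr mulr0.
  rewrite mulf_eq0 mulf_eq0 (gt_eqF hz) pnatr_eq0/= subr_eq0 invr_eq1.
  by move=> /eqP.
exists al, b, ga; split.
- split; first by exists (phi (1 *: en)); rewrite ME; exists (1 *: en) => //=;
    rewrite heightZ height_en mulr1.
  rewrite ME; apply: connected_continuous_connected.
    apply: convex_connected => x y t /= hx hy _.
    by rewrite heightD heightZ heightB hx hy subrr mulr0 addr0.
  apply: continuous_in_subspaceT => x; rewrite inE/= => hx; apply: fc.
  by rewrite /halfspace /= hx.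
- rewrite ME; apply/seteqP; split=> [_ [x /= hx <-]|z [Hz qz]].
    have Hx : H x by rewrite /halfspace /= hx.
    by split; [apply: fH; exists x|apply/qP].
  have [x Hx xz] := fs _ Hz; exists x => //=.
  by apply/qP => //; rewrite xz.
- by rewrite hb oppr_le0.
- by rewrite D9.
- by rewrite D9 hb; have -> : (9 : R) - (- 3) ^+ 2 = 0 by ring.
Qed.

End Isometries.

Theorem theorem2 (R : realType) (m : nat) (hn : (3 <= m.+1)%N)
  (M : set 'rV[R]_m.+1)
  (hM : horosphere M \/ hypersphere M \/ hyperplane M)
  (nuM : 'rV[R]_m.+1 -> 'rV[R]_m.+1) (HM : R)
  (hnuM : unit_normal M nuM)
  (hHM : forall p, M p -> is_mean_curvature M nuM p HM)
  (HM_ge0 : 0 <= HM)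
  (Sigma : set 'rV[R]_m.+1)
  (hSigma : C2_hypersurface Sigma)
  (hconn : connected Sigma)
  (hproper : properly_embedded Sigma)
  (hK : exists K : set 'rV[R]_m.+1,
      [/\ K `<=` @halfspace R m, compact K & Sigma `\` K = M `\` K])
  (nu : 'rV[R]_m.+1 -> 'rV[R]_m.+1)
  (hnu : unit_normal Sigma nu)
  (hH : forall p, Sigma p ->
      exists2 h, is_mean_curvature Sigma nu p h & HM <= h) :
  Sigma = M.
Proof.
have m0 : (0 < m)%N by move: hn; rewrite ltnS; exact: leq_trans.
have [K [KH cK SK]] := hK.
have [al [b [ga [[M0 cM] ME b0 D0 d0]]]] : exists al b ga,
    [/\ M !=set0 /\ connected M, M = [set x | halfspace x /\ quad al b ga x = 0],
      height b <= 0, 0 < dot b b - 4 * al * ga &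
      0 <= dot b b - 4 * al * ga - height b ^+ 2].
  case: hM => [|[]hM]; first exact: horosphere_quadric.
    exact: hypersphere_quadric.
  have [M0 cM _ _ _] := hM.
  have [al [b [ga [b0 D1 ME]]]] := hyperplane_quadric m0 hM.
  by exists al, b, ga; rewrite b0 D1 expr0n subr0.
exact: (quadric_uniqueness m0 ME M0 cM b0 D0 d0 hnuM hHM HM_ge0 hSigma hconn
  hproper hnu hH KH cK SK).
Qed.
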